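(* Let $p,q\in[1,\infty)$, $\lambda\in[-n/p,0)$, $\mu\in[-n/q,0)$, $u\in(0,\infty]$, $\Theta\in\Theta_*$, and let $$w(r)=r^{-\sigma}\Theta(r^{\tau}),\qquad \sigma,\tau\in(0,\infty)\ \text{with}\ \sigma>\tau.$$ Let $T$ be a sublinear operator defined on $L^1_{\mathrm{comp}}(\mathbb R^n)$ such that, for some constant $C>0$, $$|Tf(x)-Tg(x)|\le C|T(f-g)(x)|\quad\text{for all } f,g \text{ and a.e. }x,$$ and such that, for some $\alpha\in[0,n)$, some $\tilde p\in[1,\infty]$, some function $\Omega$ on $\mathbb R^n$ homogeneous of degree zero with $\Omega\in L^{\tilde p}(S^{n-1})$ and some $C\in(0,\infty)$, for all $f\in L^1_{\mathrm{comp}}(\mathbb R^n)$, $$|Tf(x)|\le C\int_{\mathbb R^n}\frac{|\Omega(x-y)|}{|x-y|^{n-\alpha}}|f(y)|\,dy,\qquad x\notin\operatorname{supp}f.$$ Assume one of the following conditions: (i) $\mu=\lambda+\alpha$, $\tilde p\ge p'$ and $\sigma+\lambda+\alpha<0$; (ii) $\mu=\lambda+\alpha$, $\tilde p\ge q$ and $\sigma+\lambda+n/\tilde p+\alpha<0$. Assume in addition that $T$ can be extended to a bounded operator from $L_{p,\lambda}(\mathbb R^n)$ to $L_{q,\mu}(\mathbb R^n)$ or to $WL_{q,\mu}(\mathbb R^n)$. Then $T$ can be further extended to a bounded operator from $B_w^u(L_{p,\lambda})(\mathbb R^n)$ to $B_w^u(L_{q,\mu})(\mathbb R^n)$ or to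 $B_w^u(WL_{q,\mu})(\mathbb R^n)$, respectively. The same conclusion holds with $\dot B_w^u$ in place of $B_w^u$.
   Context: For $r>0$, $Q_r\subset\mathbb R^n$ is the open cube $\{y:\max_i|y_i|<r\}$ (for all $r$), or the open ball $\{y:|y|<r\}$ (for all $r$); $Q(x,s)=x+Q_s$; $\chi_R$ is the characteristic function of $Q_R$. For $U=\mathbb R^n$ or $U=Q_r$, the Morrey space $L_{p,\lambda}(U)$ and weak Morrey space $WL_{p,\lambda}(U)$ consist of all $f$ with finite $$\|f\|_{L_{p,\lambda}(U)}=\sup_{Q(x,s)\subset U}\frac1{s^\lambda}\Big(\frac1{|Q(x,s)|}\int_{Q(x,s)}|f|^p\Big)^{1/p},\quad \|f\|_{WL_{p,\lambda}(U)}=\sup_{Q(x,s)\subset U}\frac1{s^\lambda}\Big(\frac{\sup_{t>0}t^p|\{y\in Q(x,s):|f(y)|>t\}|}{|Q(x,s)|}\Big)^{1/p}.$$ For $E$ any of these types of spaces, $w:(0,\infty)\to(0,\infty)$ and $u\in(0,\infty]$, $B_w^u(E)(\mathbb R^n)$ and $\dot B_w^u(E)(\mathbb R^n)$ are the sets of measurable $f$ on $\mathbb R^n$ with $f|_{Q_r}\in E(Q_r)$ for all $r>0$ and, respectively, $\|f\|_{B_w^u(E)}=\big\|w(r)\|f\|_{E(Q_r)}\big\|_{L^u([1,\infty),dr/r)}<\infty$, $\|f\|_{\dot B_w^u(E)}=\big\|w(r)\|f\|_{E(Q_r)}\big\|_{L^u((0,\infty),dr/r)}<\infty$. $\Theta_*$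 is the set of functions $\Theta:(0,\infty)\to(0,\infty)$ such that for some $C\in(0,\infty)$ and $\epsilon,\epsilon'\in(0,1)$, $\Theta(tr)/\Theta(r)\le C\max(t^{\epsilon},t^{\epsilon'})$ for all $r,t>0$. $L^1_{\mathrm{comp}}(\mathbb R^n)$ is the set of compactly supported integrable functions. Sublinear means $|T(f+g)(x)|\le|Tf(x)|+|Tg(x)|$ a.e. for all $f,g\in L^1_{\mathrm{comp}}(\mathbb R^n)$. $p'$ is the conjugate exponent of $p$. Extensions of $T$ to the larger spaces are understood as $Tf=\lim_{R\to\infty}T(f\chi_R)$, the limit existing a.e. or in $L^q_{\mathrm{loc}}(\mathbb R^n)$. *)

(* Defs.v *)
From HB Require Import structures.
From mathcomp Require Import all_boot all_order all_algebra.
From mathcomp Require Import lra.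
From mathcomp Require Import all_classical all_reals all_analysis.
From mathcomp Require Import measurable_realfun ess_sup_inf.

Set Implicit Arguments.
Unset Strict Implicit.
Unset Printing Implicit Defensive.

Import Order.TTheory GRing.Theory Num.Theory.
Import numFieldNormedType.Exports.

Local Open Scope classical_set_scope.
Local Open Scope ring_scope.

(* Throughout, R^d with d >= 1 is 'rV[R]_n.+1, d = n.+1. *)

Section lebesgue_measure_Rn.
Context {R : realType} {n : nat}.
Local Notation Rn := 'rV[R]_n.+1.
Implicit Types (a b x : Rn) (A X : set Rn).

Definition box a b : set Rn := [set x | forall i, a 0 i <= x 0 i < b 0 i].

Definition box_vol a b : R := \prod_(i < n.+1) Num.max 0 (b 0 i - a 0 i).

Definition box_cover X : set (nat -> Rn * Rn) :=
  [set F | X `<=` \bigcup_k box (F k).1 (F k).2].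

Local Open Scope ereal_scope.

Definition box_series (F : nat -> Rn * Rn) : \bar R :=
  \sum_(k <oo) (box_vol (F k).1 (F k).2)%:E.

Definition lebesgue_outer X : \bar R :=
  ereal_inf [set box_series F | F in box_cover X].

Lemma box_vol_ge0 a b : (0 <= box_vol a b)%R.
Proof. by apply: prodr_ge0 => i _; rewrite le_max lexx. Qed.

Lemma box_series_ge0 F : 0 <= box_series F.
Proof. by apply: nneseries_ge0 => k _ _; rewrite lee_fin box_vol_ge0. Qed.

Lemma lebesgue_outer_ge0 X : 0 <= lebesgue_outer X.
Proof.
by apply: le_ereal_inf_tmp => _ [F _ <-]; exact: box_series_ge0.
Qed.

Lemma lebesgue_outer0 : lebesgue_outer set0 = 0.
Proof.
apply/eqP; rewrite eq_le lebesgue_outer_ge0 andbT.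
apply: ereal_inf_lbound; exists (fun=> (0%R, 0%R)) => //.
rewrite /box_series eseries0// => k _ _.
by rewrite /box_vol big_ord_recl /= subrr maxxx mul0r.
Qed.

Lemma le_lebesgue_outer : {homo lebesgue_outer : A B / A `<=` B >-> A <= B}.
Proof.
move=> A B AB; apply: ereal_inf_le_tmp => _ [F BF <-]; exists F => //.
exact: subset_trans BF.
Qed.

Lemma lebesgue_outer_sigma_subadditive : sigma_subadditive lebesgue_outer.
Proof.
move=> A; have [[i ioo]|] := pselect (exists i, lebesgue_outer (A i) = +oo).
  rewrite (eseries_pinfty _ _ ioo) ?leey// => k _.
  by rewrite -ltNye (lt_le_trans _ (lebesgue_outer_ge0 _)).
rewrite -forallNE => Aoo.
suff add2e (e : {posnum R}) : lebesgue_outer (\bigcup_k A k) <=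
    \sum_(i <oo) lebesgue_outer (A i) + e%:num%:E.
  by apply/lee_addgt0Pr => _/posnumP[].
rewrite (le_trans _ (epsilon_trick _ _ _))//; last first.
  by move=> k; exact: lebesgue_outer_ge0.
pose P k (B : nat -> Rn * Rn) := box_cover (A k) B /\
  box_series B <= lebesgue_outer (A k) + (e%:num / (2 ^ k.+1)%:R)%:E.
have [G PG] : {G : (nat -> Rn * Rn)^nat & forall k, P k (G k)}.
  apply: (@choice _ _ P) => k; rewrite /P /lebesgue_outer.
  set S := (X in ereal_inf X); move infS : (ereal_inf S) => iS.
  case: iS infS => [r Sr|Soo|Soo].
  - have en1 : (0 < e%:num / (2 ^ k.+1)%:R)%R by [].
    have /(lb_ereal_inf_adherent en1) : ereal_inf S \is a fin_num by rewrite Sr.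
    move=> [y [B AB muBy] yS].
    by exists B; split => //; rewrite muBy -Sr; exact/ltW.
  - by have := Aoo k; rewrite /lebesgue_outer Soo.
  - suff : lbound S 0 by move/le_ereal_inf_tmp; rewrite Soo.
    by move=> /= _ [B AB <-]; exact: box_series_ge0.
pose v (ab : Rn * Rn) : \bar R := (box_vol ab.1 ab.2)%:E.
have v_ge0 ab : 0 <= v ab by rewrite lee_fin box_vol_ge0.
have vG_ge0 ij : 0 <= (v \o uncurry G) ij by exact: v_ge0.
apply: (@le_trans _ _ (\esum_(i in setT) (v \o uncurry G) i)).
  apply: ereal_inf_lbound => /=.
  have /card_esym/ppcard_eqP[f] := card_nat2.
  exists (uncurry G \o f).
    move=> t [i _ Ait]; have [j _ Gt] := (PG i).1 t Ait.
    by exists (f^-1%FUN (i, j)) => //=; rewrite invK ?inE.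
  rewrite /box_series.
  rewrite -(esum_pred_image (v \o uncurry G) _ xpredT) ?[fun=> _]set_true//.
  by rewrite image_eq.
rewrite (_ : esum _ _ = \sum_(i <oo) \sum_(j <oo) v (G i j)); last first.
  pose J : nat -> set (nat * nat) := fun i => [set (i, j) | j in setT].
  rewrite (_ : setT = \bigcup_k J k); last first.
    by rewrite predeqE => -[i j]; split => // _; exists i => //; exists j.
  rewrite esum_bigcupT /=; last 2 first.
    - apply/trivIsetP => i j _ _ ij.
      rewrite predeqE => -[k m] /=; split => //= -[] [_] _ [<-{k} _].
      by move=> [m' _] [] /esym/eqP; rewrite (negbTE ij).
    - by move=> /= [k m]; exact: v_ge0.
  rewrite -(image_id [set: nat]) -fun_true esum_pred_image//; last first.
    by move=> k _; exact: esum_ge0.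
  apply: eq_eseriesr => /= j _.
  rewrite -(esum_pred_image (v \o uncurry G) (pair j) predT)//=; last first.
    by move=> ? ? _ _; exact: (@can_inj _ _ _ snd).
  by congr esum; rewrite predeqE => -[i j']; split; move=> [l _ <-]; exists l.
apply: lee_lim.
- apply: is_cvg_nneseries => k *.
  by apply: nneseries_ge0 => m *; exact: (vG_ge0 (k, m)).
- apply: is_cvg_nneseries => k *.
  by apply: adde_ge0 => //; exact: lebesgue_outer_ge0.
- by near=> k; apply: lee_sum => i _; exact: (PG i).2.
Unshelve. all: by end_near. Qed.

HB.instance Definition _ := isOuterMeasure.Build R Rn lebesgue_outer
  lebesgue_outer0 lebesgue_outer_ge0 le_lebesgue_outer
  lebesgue_outer_sigma_subadditive.

(* lebesgueT is R^d with the sigma-algebra of Lebesgue measurable sets, that is,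
   of the Caratheodory measurable sets of Lebesgue outer measure; it contains
   all null sets. *)
Definition lebesgue_om : {outer_measure set Rn -> \bar R} := lebesgue_outer.

Definition lebesgueT := caratheodory_type lebesgue_om.

HB.instance Definition _ := Measurable.on lebesgueT.

Definition lebesgue : {measure set lebesgueT -> \bar R} :=
  (lebesgue_om : set (caratheodory_type lebesgue_om) -> \bar R).

Let cut_hi (c : R) (i : 'I_n.+1) b : Rn :=
  (\row_j if j == i then Num.min (b 0 j) c else b 0 j)%R.
Let cut_lo (c : R) (i : 'I_n.+1) a : Rn :=
  (\row_j if j == i then Num.max (a 0 j) c else a 0 j)%R.

Let box_vol_cut c i a b :
  (box_vol a (cut_hi c i b) + box_vol (cut_lo c i a) b)%R = box_vol a b.
Proof.
have vD (u v : Rn) : box_vol u v = (Num.max 0 (v 0 i - u 0 i) *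
    \prod_(j < n.+1 | j != i) Num.max 0 (v 0 j - u 0 j))%R.
  by rewrite /box_vol (bigD1 i).
rewrite !vD !mxE eqxx.
under eq_bigr => j ji do rewrite mxE (negbTE ji).
under [X in (_ + _ * X)%R]eq_bigr => j ji do rewrite mxE (negbTE ji).
rewrite -mulrDl; congr (_ * _)%R.
move: (a 0%R i) (b 0%R i) => s t.
rewrite /Num.max /Num.min; repeat case: ifPn => //; rewrite -?leNgt; lra.
Qed.

Lemma measurable_halfspace (c : R) i :
  measurable ([set x | (x 0 i < c)%R] : set lebesgueT).
Proof.
apply: le_caratheodory_measurable => X /=.
apply: le_ereal_inf_tmp => _ [F XF <-].
pose F1 k := ((F k).1, cut_hi c i (F k).2).
pose F2 k := (cut_lo c i (F k).1, (F k).2).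
have -> : box_series F = box_series F1 + box_series F2.
  rewrite /box_series -nneseriesD; last 2 first.
  - by move=> k _ _; rewrite lee_fin box_vol_ge0.
  - by move=> k _ _; rewrite lee_fin box_vol_ge0.
  by apply: eq_eseriesr => k _; rewrite -EFinD box_vol_cut.
apply: leeD; apply: ereal_inf_lbound.
  exists F1 => // x [Xx xc]; have [k _ Fx] := XF _ Xx.
  exists k => // j; have := Fx j; rewrite /= mxE.
  by case: eqP => // -> /andP[-> xb]; rewrite lt_min xb.
exists F2 => // x [Xx /negP]; rewrite -leNgt => cx; have [k _ Fx] := XF _ Xx.
exists k => // j; have := Fx j; rewrite /= mxE.
by case: eqP => // -> /andP[ax ->]; rewrite ge_max ax cx.
Qed.

Lemma measurable_coord i :
  measurable_fun [set: lebesgueT] (fun x : Rn => x 0%R i).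
Proof.
move=> mD; apply: (measurability _ (RGenInftyO.measurableE R)) => //.
move=> _ [_ [c ->] <-]; rewrite setTI.
rewrite (_ : _ @^-1` _ = [set x : Rn | (x 0 i < c)%R]).
  exact: measurable_halfspace.
by apply/seteqP; split => x /=; rewrite in_itv.
Qed.

End lebesgue_measure_Rn.

Arguments lebesgueT R n : clear implicits.
Arguments lebesgue {R n}.

Section euclidean_space.
Context {R : realType} {n : nat}.
Local Notation Rn := 'rV[R]_n.+1.
Implicit Types (x y : Rn).

(* The norm `|x| of the library on 'rV[R]_n.+1 is max_i |x_i|. *)
Definition enorm x : R := Num.sqrt (\sum_(i < n.+1) x 0 i ^+ 2).

Inductive Q_shape := cubes | balls.

Definition Q (sh : Q_shape) x (s : R) : set Rn :=
  match sh with
  | cubes => [set y | `|y - x| < s]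
  | balls => [set y | enorm (y - x) < s]
  end.

Lemma measurable_unit_ball :
  measurable ([set x | enorm x < 1] : set (lebesgueT R n)).
Proof.
rewrite (_ : [set x | _] =
    (fun x : Rn => \sum_(i < n.+1) x 0 i ^+ 2) @^-1` `]-oo, 1[%classic); last first.
  apply/seteqP; split => x; rewrite /= in_itv /= /enorm;
    by rewrite -[X in (Num.sqrt _ < X)]sqrtr1 ltr_sqrt.
rewrite -[X in measurable X]setTI.
suff : measurable_fun [set: lebesgueT R n]
    (fun x : Rn => \sum_(i < n.+1) x 0 i ^+ 2).
  by apply => //; exact: measurable_itv.
apply: measurable_sum => i; apply: measurable_funX; exact: measurable_coord.
Qed.

(* The unit sphere S^{d-1} with surface measure, realized on the points of R^d
   by polar coordinates: A is measurable when the cone {x | x/|x| \in A} is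
   Lebesgue measurable, and its measure is d |{x | |x| < 1, x/|x| \in A}|. The
   resulting measure is carried by the sphere. *)
Definition direction x : Rn := (enorm x)^-1 *: x.

Definition sphereT : Type := Rn.

Definition sphere_display : measure_display. Proof. by []. Qed.

HB.instance Definition _ := Pointed.on sphereT.

Definition sphere_measurable : set (set sphereT) :=
  [set A | measurable (direction @^-1` A : set (lebesgueT R n))].

Let sphere_measurable0 : sphere_measurable set0.
Proof. by rewrite /sphere_measurable /= preimage_set0. Qed.

Let sphere_measurableC A : sphere_measurable A -> sphere_measurable (~` A).
Proof. by rewrite /sphere_measurable /= -preimage_setC; exact: measurableC. Qed.

Let sphere_measurable_bigcup (F : (set sphereT)^nat) :
  (forall i, sphere_measurable (F i)) -> sphere_measurable (\bigcup_i F i).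
Proof.
by rewrite /sphere_measurable /= preimage_bigcup => mF; exact: bigcupT_measurable.
Qed.

HB.instance Definition _ := @isMeasurable.Build sphere_display sphereT
  sphere_measurable sphere_measurable0 sphere_measurableC
  sphere_measurable_bigcup.

Definition surface (A : set sphereT) : \bar R :=
  (n.+1%:R%:E * lebesgue ([set x | (enorm x < 1)%R] `&` direction @^-1` A))%E.

Let surface0 : surface set0 = 0%E.
Proof. by rewrite /surface preimage_set0 setI0 measure0 mule0. Qed.

Let surface_ge0 A : (0 <= surface A)%E.
Proof. by rewrite /surface mule_ge0. Qed.

Let surface_sigma_additive : semi_sigma_additive surface.
Proof.
move=> F mF tF mUF.
rewrite [X in X @ \oo --> _](_ : _ = (fun k => n.+1%:R%:E * \sum_(0 <= i < k)
    lebesgue ([set x : Rn | (enorm x < 1)%R] `&` direction @^-1` F i))%E);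
    last first.
  by apply/funext => k; rewrite ge0_sume_distrr.
rewrite /surface preimage_bigcup setI_bigcupr.
have mBF i : measurable ([set x : Rn | (enorm x < 1)%R] `&` direction @^-1` F i
    : set (lebesgueT R n)).
  by apply: measurableI; [exact: measurable_unit_ball|exact: mF].
apply: cvgeZl => //; apply: measure_semi_sigma_additive => //.
- apply/trivIsetP => i j _ _ ij; rewrite setIACA setIid -preimage_setI.
  by move/trivIsetP : tF => ->//; rewrite preimage_set0 setI0.
- exact: bigcupT_measurable.
Qed.

HB.instance Definition _ := isMeasure.Build sphere_display sphereT R surface
  surface0 surface_ge0 surface_sigma_additive.

End euclidean_space.

Arguments sphereT R n : clear implicits.
Arguments surface {R n}.

Section function_spaces.
Context {R : realType} {n : nat}.
Local Notation Rn := 'rV[R]_n.+1.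
Implicit Types (f g : Rn -> R) (U : set Rn) (p q lam r s t : R).

Record fspace := FSpace {
  mem_fspace : (Rn -> R) -> Prop;
  fnorm : (Rn -> R) -> \bar R }.

Local Open Scope ereal_scope.

Definition morrey_norm sh p lam U f : \bar R :=
  ereal_sup [set ((z.2 `^ lam)^-1)%:E *
      ((lebesgue (Q sh z.1 z.2))^-1 *
       \int[lebesgue]_(y in (Q sh z.1 z.2 : set (lebesgueT R n)))
         (`|f y| `^ p)%:E) `^ p^-1
    | z in [set z : Rn * R | (0 < z.2)%R /\ Q sh z.1 z.2 `<=` U]].

Definition weak_integral p U f : \bar R :=
  ereal_sup [set (t `^ p)%:E * lebesgue (U `&` [set y | (t < `|f y|)%R])
    | t in [set t : R | (0 < t)%R]].

Definition weak_morrey_norm sh p lam U f : \bar R :=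
  ereal_sup [set ((z.2 `^ lam)^-1)%:E *
      ((lebesgue (Q sh z.1 z.2))^-1 * weak_integral p (Q sh z.1 z.2) f) `^ p^-1
    | z in [set z : Rn * R | (0 < z.2)%R /\ Q sh z.1 z.2 `<=` U]].

Definition morrey sh p lam U : fspace := FSpace
  (fun f => measurable_fun (U : set (lebesgueT R n)) f /\
            morrey_norm sh p lam U f < +oo)
  (morrey_norm sh p lam U).

Definition weak_morrey sh p lam U : fspace := FSpace
  (fun f => measurable_fun (U : set (lebesgueT R n)) f /\
            weak_morrey_norm sh p lam U f < +oo)
  (weak_morrey_norm sh p lam U).

(* The norm of L^u(I, dr/r), for I included in (0, +oo) and h >= 0. For u = +oo,
   dr/r and Lebesgue measure have the same null sets in I. *)
Definition Lu_norm (u : \bar R) (I : set R) (h : R -> \bar R) : \bar R :=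
  match u with
  | v%:E => (\int[lebesgue_measure]_(r in I) (h r `^ v * (r^-1)%:E)) `^ v^-1
  | +oo => ess_sup lebesgue_measure (h \_ I)
  | -oo => 0
  end.

(* B_w^u(E) for I = [1, +oo[ and its homogeneous version for I = ]0, +oo[ *)
Definition B_space (I : set R) sh (w : R -> R) (u : \bar R)
    (E : set Rn -> fspace) : fspace :=
  let N f := Lu_norm u I (fun r => (w r)%:E * fnorm (E (Q sh 0 r)) f) in
  FSpace
    (fun f => [/\ measurable_fun [set: lebesgueT R n] f,
                  forall r, (0 < r)%R -> mem_fspace (E (Q sh 0 r)) f &
                  N f < +oo])
    N.

Definition B_inhom := B_space `[1%R, +oo[.
Definition B_hom := B_space `]0%R, +oo[.

Definition Theta_star (Theta : R -> R) : Prop :=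
  (forall r, 0 < r -> 0 < Theta r)%R /\
  exists C eps eps' : R, [/\ (0 < C)%R, (0 < eps < 1)%R, (0 < eps' < 1)%R &
    forall r t, (0 < r)%R -> (0 < t)%R ->
      (Theta (t * r) / Theta r <= C * Num.max (t `^ eps) (t `^ eps'))%R].

End function_spaces.

Arguments fspace R n : clear implicits.

Section operators.
Context {R : realType} {n : nat}.
Local Notation Rn := 'rV[R]_n.+1.
Implicit Types (f g : Rn -> R) (T : (Rn -> R) -> Rn -> R).

Local Open Scope ereal_scope.

(* The support of f as an element of L^1_loc, which is insensitive to null sets:
   the complement of the largest open set on which f = 0 a.e. *)
Definition supp f : set Rn := [set x | forall V : set Rn, nbhs x V ->
  ~ {ae lebesgue, forall y : lebesgueT R n, V y -> f y = 0%R}].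

Definition L1comp f : Prop :=
  lebesgue.-integrable [set: lebesgueT R n] (EFin \o f) /\ compact (supp f).

Definition defined_on_L1comp T : Prop :=
  forall f, L1comp f -> measurable_fun [set: lebesgueT R n] (T f).

Definition sublinear T : Prop := forall f g, L1comp f -> L1comp g ->
  {ae lebesgue, forall x : lebesgueT R n,
    (`|T (f \+ g) x| <= `|T f x| + `|T g x|)%R}.

Definition diff_bounded T : Prop := exists2 C : R, (0 < C)%R &
  forall f g, L1comp f -> L1comp g ->
    {ae lebesgue, forall x : lebesgueT R n,
      (`|T f x - T g x| <= C * `|T (f \- g) x|)%R}.

Definition homogeneous0 (Omega : Rn -> R) : Prop :=
  forall (t : R) (x : Rn), (0 < t)%R -> (x != 0)%R ->
    Omega (t *: x)%R = Omega x.

Definition in_Lp_sphere (pt : \bar R) (Omega : Rn -> R) : Prop :=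
  measurable_fun [set: sphereT R n] Omega /\
  Lnorm surface pt (EFin \o Omega) < +oo.

Definition size_condition T (Omega : Rn -> R) (alpha : R) : Prop :=
  exists2 C : R, (0 < C)%R & forall f, L1comp f ->
    {ae lebesgue, forall x : lebesgueT R n, ~ supp f x ->
      `|T f x|%:E <= C%:E * \int[lebesgue]_(y in [set: lebesgueT R n])
        (`|Omega (x - y : Rn)| / enorm (x - y : Rn) `^ (n.+1%:R - alpha)
          * `|f y|)%:E}.

Definition extension_limit sh (q : R) T f g : Prop :=
  let Tcut (r : R) := T (f \* \1_(Q sh 0 r))%R in
  {ae lebesgue, forall x : lebesgueT R n, Tcut r x @[r --> +oo%R] --> g x} \/
  (forall s : R, (0 < s)%R ->
    \int[lebesgue]_(y in (Q sh 0%R s : set (lebesgueT R n)))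
      (`|Tcut r y - g y| `^ q)%:E @[r --> +oo%R] --> 0).

Definition extends_bounded sh (q : R) T (X Y : fspace R n) : Prop :=
  exists T' : (Rn -> R) -> Rn -> R, exists2 C : R, (0 < C)%R &
    forall f, mem_fspace X f ->
      [/\ extension_limit sh q T f (T' f), mem_fspace Y (T' f) &
          fnorm Y (T' f) <= C%:E * fnorm X f].

End operators.

(* Main.v *)
From HB Require Import structures.
Require Import Defs.
From mathcomp Require Import all_boot all_order all_algebra.
From mathcomp Require Import ring lra.
From mathcomp Require Import all_classical all_reals all_analysis.
From mathcomp Require Import measurable_realfun ess_sup_inf.

Set Implicit Arguments.
Unset Strict Implicit.
Unset Printing Implicit Defensive.

Import Order.TTheory GRing.Theory Num.Theory.
Import numFieldNormedType.Exports.

Local Open Scope classical_set_scope.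
Local Open Scope ring_scope.

(** Let d = n + 1, let F r be the Morrey norm of f on Q (0, r), and extend T to f by the
    limit of T (f chi_R) along R = 2 ^ k. The theorem rests on one local inequality:
    there are gamma with sigma + gamma < 0 and constants c0, C such that

      F (c0 2 ^ j r) <= M 2 ^ (- gamma j) for all j >= 0

    implies that the norm of T f on Q (0, r) is at most C M (dyadic_extension). To prove
    it, compare T f on Q (0, r) with T g, where g = f chi_(R') and R' = 2 d r. The bound
    of T on the whole space controls T g, because the norm of g on R^d is at most the
    norm of f on a fixed dilate of Q (0, R') (cutoff_strong_le). The difference of T
    at two cutoffs beyond R' is bounded by T at a function that vanishes on Q (0, R'),
    hence by a potential of f outside Q (0, R') (cutoff_difference_tail), which is cut
    into dyadic shells. A shell of radius rho contributes at most a constant times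
    (rho / r) ^ beta times the norm of f on its scale, for some beta with
    sigma + beta < 0 (shell_estimate). If pt >= p', Young's inequality with exponents p
    and p' gives beta = mu; if pt >= q, the kernel is integrated in x instead of y, and
    beta = mu + d / pt. For gamma strictly between beta and - sigma the sum over the
    shells is a geometric series (tail_estimate). The same estimate, applied to a
    function with F r = O(r ^ sigma), shows that the cutoffs converge.

    For the B-spaces, Theta is increasing up to a constant factor, so that
    w r <= D x ^ sigma w (x r) for x >= 1. The local inequality then says that
    w r times the norm of T f on Q (0, r) is at most a constant times the
    supremum over j of a ^ j h (2 ^ (j + m) r), where h = w F, a = 2 ^ (sigma + gamma) is
    less than 1 and m is fixed.
    As F increases, h is comparable from below on a dyadic block to its value at the
    left end, hence the L^u norm of h dominates the l^u norm of its values at the points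
    2 ^ k r0, and the geometric weight a ^ j transfers this to T f (Lu_growth, Lu_bound).
    The weight w may fail to be measurable, so integrals over dr / r are compared with
    those of step functions.

    Two devices are used throughout. Strong and weak Morrey norms are treated at once, as
    averages of a functional for which adding an error measured in L^q is harmless
    (quasi_additive). And |Omega| is replaced by a Borel representative
    (homogeneous_borel_representative), for which Omega (x - y) is measurable in the
    pair (x, y) and Tonelli's theorem applies. *)

(** * Lebesgue outer measure under affine changes of variables *)

Section lebesgue_boxes.
Context {R : realType} {n : nat}.
Local Notation Rn := 'rV[R]_n.+1.
Implicit Types (a b x c : Rn) (A : set Rn).

Local Open Scope ereal_scope.

Lemma le_outer_covers (A B : set Rn) (k : R) : (0 < k)%R ->
  (forall F, box_cover B F -> exists2 G, box_cover A G &
     box_series G <= k%:E * box_series F) ->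
  lebesgue_outer A <= k%:E * lebesgue_outer B.
Proof.
move=> k0 H; rewrite -lee_pdivrMl//.
apply: le_ereal_inf_tmp => _ [F BF <-]; rewrite lee_pdivrMl//.
have [G AG] := H F BF; apply: le_trans.
by apply: ereal_inf_lbound; exists G.
Qed.

Lemma box_volZ (t : R) a b c : (0 < t)%R ->
  box_vol (t *: (a - c)) (t *: (b - c)) = (t ^+ n.+1 * box_vol a b)%R.
Proof.
move=> t0; rewrite /box_vol -[X in (t ^+ X)%R]card_ord -prodr_const -big_split /=.
apply: eq_bigr => i _; rewrite !mxE -mulrBr opprB addrA subrK.
by rewrite [RHS]maxr_pMr ?mulr0 // ltW.
Qed.

Lemma outer_preimage_pos (t : R) c A : (0 < t)%R ->
  lebesgue_outer [set x | A (t *: x + c)%R] <= (t ^- n.+1)%:E * lebesgue_outer A.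
Proof.
move=> t0; apply: le_outer_covers => [|F AF]; first by rewrite invr_gt0 exprn_gt0.
exists (fun k => (t^-1 *: ((F k).1 - c), t^-1 *: ((F k).2 - c))%R).
  move=> x /AF[k _ xF]; exists k => // i; have := xF i.
  by rewrite !mxE /= ler_pdivrMl// ltr_pdivlMl// lerBlDr ltrBrDr.
rewrite /box_series -nneseriesZl//; last by move=> k _; rewrite lee_fin box_vol_ge0.
apply: lee_nneseries => k _; first by rewrite lee_fin box_vol_ge0.
by rewrite -EFinM /= box_volZ ?invr_gt0// exprVn.
Qed.

(** The chord of the convex function (1 + h) ^ k over [0, 1] lies above it. *)
Lemma expr1D_le (h : R) (k : nat) : (0 <= h <= 1)%R ->
  ((1 + h) ^+ k <= 1 + h * 2 ^+ k)%R.
Proof.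
move=> /andP[h0 h1].
suff : ((1 + h) ^+ k <= 1 + h * (2 ^+ k - 1))%R.
  by move/le_trans; apply; rewrite lerD2l ler_wpM2l// gerBl.
elim: k => [|k IH]; first by rewrite !expr0 subrr mulr0 addr0.
rewrite exprS (le_trans (ler_wpM2l _ IH)) ?addr_ge0//.
have : (1 <= (2 : R) ^+ k)%R by rewrite exprn_ege1// ler1n.
rewrite exprS; move: (2 ^+ k)%R => y y1.
have : (0 <= h * (1 - h) * (y - 1))%R by rewrite !mulr_ge0// subr_ge0.
by nra.
Qed.

(** The reflection of a half-open box is half-open on the wrong side; dilating it
    slightly about its lower corner covers it. *)
Lemma outer_opp_le A : lebesgue_outer [set x | A (- x)%R] <= lebesgue_outer A.
Proof.
have step (h : R) : (0 < h)%R ->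
    lebesgue_outer [set x | A (- x)%R] <= ((1 + h) ^+ n.+1)%:E * lebesgue_outer A.
  move=> h0; have h1 : (0 < 1 + h)%R by rewrite addr_gt0.
  apply: le_outer_covers => [|F AF]; first by rewrite exprn_gt0.
  exists (fun k => (- (F k).2, - (F k).2 + (1 + h) *: ((F k).2 - (F k).1))%R).
    move=> x /AF[k _ xF]; exists k => // i; have := xF i; rewrite !mxE /=.
    move: ((F k).1 0%R i) ((F k).2 0%R i) (x 0%R i) => u v w /andP[uw wv].
    by apply/andP; split; nra.
  rewrite /box_series -nneseriesZl//; last by move=> k _; rewrite lee_fin box_vol_ge0.
  apply: lee_nneseries => k _; first by rewrite lee_fin box_vol_ge0.
  rewrite -EFinM /= -(box_volZ _ _ (F k).1 h1) lee_fin.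
  rewrite le_eqVlt; apply/orP; left; apply/eqP; apply: eq_bigr => i _.
  by rewrite !mxE; f_equal; ring.
have := lebesgue_outer_ge0 A; move: step.
case: (lebesgue_outer A) => [v| |] step //; last by rewrite !leey.
rewrite lee_fin => v0; apply/lee_addgt0Pr => e e0.
have v1 : (0 < v * 2 ^+ n.+1 + 1)%R.
  by rewrite ltr_pwDr// mulr_ge0// exprn_ge0.
pose h := (Num.min 1 (e / (v * 2 ^+ n.+1 + 1)))%R.
have h0 : (0 < h)%R by rewrite lt_min ltr01 divr_gt0.
apply: le_trans (step _ h0) _; rewrite -EFinM -EFinD lee_fin.
have h01 : (0 <= h <= 1)%R by rewrite ltW//= ge_min lexx.
apply: le_trans (ler_wpM2r v0 (expr1D_le n.+1 h01)) _.
have : (h * (v * 2 ^+ n.+1 + 1) <= e)%R.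
  by rewrite -ler_pdivlMr// ge_min lexx orbT.
by clear h01 v1; clearbody h; move: (2 ^+ n.+1)%R => y; nra.
Qed.

Lemma outer_preimage_le (t : R) c A : (t != 0)%R ->
  lebesgue_outer [set x | A (t *: x + c)%R] <= (`|t| ^- n.+1)%:E * lebesgue_outer A.
Proof.
rewrite neq_lt => /orP[t0|t0]; last by rewrite gtr0_norm//; exact: outer_preimage_pos.
have nt0 : (0 < - t)%R by rewrite oppr_gt0.
rewrite ltr0_norm//; apply: le_trans (outer_preimage_pos c A nt0).
rewrite -[leRHS]/(lebesgue_outer [set x | A (- t *: x + c)%R]).
have := outer_opp_le [set x | A (- t *: x + c)%R]; apply: le_trans.
by apply: le_lebesgue_outer => x /=; rewrite scalerN scaleNr opprK.
Qed.

(** The inequality applies to the affine map and to its inverse. *)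
Lemma outer_preimage (t : R) c A : (t != 0)%R ->
  lebesgue_outer [set x | A (t *: x + c)%R] = (`|t| ^- n.+1)%:E * lebesgue_outer A.
Proof.
move=> t0; apply/eqP; rewrite eq_le outer_preimage_le//=.
have tV : (t^-1 != 0)%R by rewrite invr_eq0.
have tn : (0 < `|t| ^+ n.+1)%R by rewrite exprn_gt0// normr_gt0.
rewrite lee_pdivrMl//.
have := outer_preimage_le (- (t^-1 *: c))%R [set x | A (t *: x + c)%R] tV.
rewrite normfV exprVn invrK; apply: le_trans.
apply: le_lebesgue_outer => x Ax /=.
by rewrite scalerDr scalerA divff// scale1r scalerN scalerA divff// scale1r subrK.
Qed.

(** The indicator function of a box, integrated over its first m coordinates: it goes
    from the indicator function itself, at m = 0, to the volume, at m = d. *)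
Let partial_vol (m : nat) a b x : R := (\prod_(i < n.+1)
  if (i < m)%N then Num.max 0 (b 0 i - a 0 i) else (a 0 i <= x 0 i < b 0 i)%R%:R)%R.

Let partial_vol_ge0 m a b x : (0 <= partial_vol m a b x)%R.
Proof. by apply: prodr_ge0 => i _; case: ifP => _; rewrite ?le_max ?lexx. Qed.

Let upd (m : 'I_n.+1) x (t : R) : Rn := (\row_j if j == m then t else x 0 j)%R.

Let partial_vol_upd (m : 'I_n.+1) a b x (t : R) :
  partial_vol m a b (upd m x t) =
  ((\prod_(i < n.+1 | i != m) if (i < m)%N then Num.max 0 (b 0 i - a 0 i)
      else (a 0 i <= x 0 i < b 0 i)%R%:R) * \1_(`[a 0 m, b 0 m[%classic) t)%R.
Proof.
rewrite /partial_vol (bigD1 m)//= ltnn mulrC mxE eqxx indicE; congr (_ * _)%R.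
  by apply: eq_bigr => i im; rewrite mxE (negbTE im).
by congr (_ %:R)%R; congr nat_of_bool; apply/idP/idP; rewrite ?inE /= in_itv.
Qed.

Let partial_volS (m : 'I_n.+1) a b x :
  (partial_vol m.+1 a b x)%:E =
  \int[lebesgue_measure]_(t in setT) (partial_vol m a b (upd m x t))%:E.
Proof.
under eq_integral do rewrite partial_vol_upd EFinM.
rewrite ge0_integralZl//; last 2 first.
- by apply/measurable_EFinP; apply: measurable_indic; exact: measurable_itv.
- by rewrite lee_fin prodr_ge0// => i _; case: ifP => _; rewrite ?le_max ?lexx.
rewrite integral_indic// setIT /= lebesgue_measure_itv /= lte_fin.
rewrite /partial_vol (bigD1 m)//= ltnSn mulrC EFinM; congr (_ * _).
  congr (_%:E); apply: eq_bigr => i im.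
  by rewrite ltnS leq_eqVlt (inj_eq val_inj) (negbTE im).
rewrite -EFinB; case: ltP => ab; congr (_%:E).
  by rewrite max_r// subr_ge0 ltW.
by rewrite max_l// subr_le0.
Qed.

(** On a cover of the box, the indicator function of the box is at most the sum of
    those of the cover; integrating one coordinate after the other, with monotone
    convergence for the series, turns this into the inequality of volumes. *)
Lemma box_vol_le_outer a b : (box_vol a b)%:E <= lebesgue_outer (box a b).
Proof.
apply: le_ereal_inf_tmp => _ [F cF <-].
have pv m : (m <= n.+1)%N -> forall x, (partial_vol m a b x)%:E <=
    \sum_(k <oo) (partial_vol m (F k).1 (F k).2 x)%:E.
  elim: m => [_ x|m IH mn x].
    have s0 : forall k : nat, (0 <= k)%N -> true ->
        0 <= (partial_vol 0 (F k).1 (F k).2 x)%:E.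
      by move=> k _ _; rewrite lee_fin partial_vol_ge0.
    have [xab|xab] := pselect (box a b x).
      have [k _ kx] := cF _ xab.
      have := nneseries_lim_ge k.+1 s0; apply: le_trans.
      rewrite big_nat_recr//= (_ : partial_vol 0 a b x = 1%R); last first.
        by rewrite /partial_vol big1// => i _; rewrite (xab i).
      rewrite (_ : partial_vol 0 (F k).1 (F k).2 x = 1%R) ?leeDr//; last first.
        by rewrite /partial_vol big1// => i _; rewrite (kx i).
      by apply: sume_ge0 => i _; rewrite lee_fin partial_vol_ge0.
    have -> : partial_vol 0 a b x = 0%R.
      move: xab => /existsNP[i /negP xi].
      by rewrite /partial_vol (bigD1 i)//= (negbTE xi) mul0r.
    exact: nneseries_ge0.
  pose m' := Ordinal mn; rewrite (partial_volS m').
  under eq_eseriesr do rewrite (partial_volS m').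
  have mp (u v : Rn) : measurable_fun [set: measurableTypeR R]
      (fun t => (partial_vol m' u v (upd m' x t))%:E).
    apply/measurable_EFinP; under eq_fun do rewrite partial_vol_upd.
    by apply: measurable_funM => //; apply: measurable_indic; exact: measurable_itv.
  rewrite -integral_nneseries//; last by move=> k t _; rewrite lee_fin partial_vol_ge0.
  apply: ge0_le_integral => //.
  - by move=> t _; rewrite lee_fin partial_vol_ge0.
  - apply: ge0_emeasurable_sum => // k t _ _; by rewrite lee_fin partial_vol_ge0.
  - by move=> t _; apply: IH; exact: ltnW.
have full u v : partial_vol n.+1 u v 0%R = box_vol u v.
  by apply: eq_bigr => i _; rewrite ltn_ord.
have := pv _ (leqnn _) 0%R; rewrite full /box_series.
by under eq_eseriesr do rewrite full.
Qed.

Lemma outer_box_le a b : lebesgue_outer (box a b) <= (box_vol a b)%:E.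
Proof.
apply: ereal_inf_lbound; exists (fun k : nat => if k == 0%N then (a, b) else (0%R, 0%R)).
  by move=> x xab; exists 0%N.
have b0 : box_vol (0 : Rn)%R 0%R = 0%R.
  by rewrite /box_vol big_ord_recl /= subrr maxxx mul0r.
rewrite /box_series (nneseriesD1 (n := 0%N))//; last first.
  by move=> k _; rewrite lee_fin box_vol_ge0.
rewrite eseries0 ?adde0// => -[|k]//= _ _; by rewrite b0.
Qed.

End lebesgue_boxes.

(** * Change of variables, Borel sets and the sets Q (x, s) *)

Section lebesgue_affine.
Context {R : realType} {n : nat}.
Local Notation Rn := 'rV[R]_n.+1.
Local Notation LT := (lebesgueT R n).
Implicit Types (a b x c : Rn) (A D : set Rn).

Lemma measurable_affine (t : R) c : t != 0 ->
  measurable_fun [set: LT] (fun x : LT => (t *: (x : Rn) + c) : LT).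
Proof.
move=> t0 _ A mA; rewrite setTI.
have {}mA : lebesgue_om.-caratheodory (A : set Rn) := mA.
suff : lebesgue_om.-caratheodory [set x : Rn | A (t *: x + c)] by [].
move=> X /=.
pose Y : set Rn := [set y | X (t^-1 *: (y - c))].
have XY (Z : set Rn) : X `&` [set x | Z (t *: x + c)] =
    [set x | (Y `&` Z) (t *: x + c)].
  by apply/seteqP; split => x; rewrite /Y /= addrK scalerA mulVf// scale1r.
have -> : X = [set x | Y (t *: x + c)].
  by have := XY setT; rewrite [X in X = _](_ : _ = X) ?setIT//; apply: setIT.
have E Z : [set x | Y (t *: x + c)] `&` [set x | Z (t *: x + c)] =
    [set x | (Y `&` Z) (t *: x + c)] by [].
have -> : ~` [set x : Rn | A (t *: x + c)] =
    [set x | (~` A) (t *: x + c)] by [].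
rewrite (E A) (E (~` A)).
have aff := @outer_preimage R n t c _ t0.
have k0 : (0%:E <= (`|t| ^- n.+1)%:E :> \bar R)%E.
  by rewrite lee_fin invr_ge0 exprn_ge0.
have aY : lebesgue_om [set x | Y (t *: x + c)] = ((`|t| ^- n.+1)%:E * lebesgue_om Y)%E
  := aff Y.
have aYA : lebesgue_om [set x | (Y `&` A) (t *: x + c)] =
    ((`|t| ^- n.+1)%:E * lebesgue_om (Y `&` A))%E := aff (Y `&` A).
have aYC : lebesgue_om [set x | (Y `&` ~` A) (t *: x + c)] =
    ((`|t| ^- n.+1)%:E * lebesgue_om (Y `&` ~` A))%E := aff (Y `&` ~` A).
by rewrite aY aYA aYC (mA Y) ge0_muleDr ?outer_measure_ge0.
Qed.

Lemma lebesgue_affine (t : R) c (A : set LT) : t != 0 ->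
  lebesgue [set x : LT | A (t *: (x : Rn) + c)] =
  ((`|t| ^- n.+1)%:E * lebesgue A)%E.
Proof. exact: outer_preimage. Qed.

Lemma ge0_integral_affine (t : R) c (D : set LT) (f : LT -> \bar R) : t != 0 ->
  measurable D -> measurable_fun D f -> (forall y, D y -> 0 <= f y)%E ->
  (\int[lebesgue]_(x in [set x : LT | D (t *: (x : Rn) + c)%R])
     f (t *: (x : Rn) + c)%R =
   (`|t| ^- n.+1)%:E * \int[lebesgue]_(y in D) f y)%E.
Proof.
move=> t0 mD mf f0.
have mphi := measurable_affine c t0.
have k0 : 0 <= `|t| ^- n.+1 by rewrite invr_ge0 exprn_ge0.
have := @ge0_integral_pushforward _ _ _ _ R _ mphi lebesgue D f mD mf.
move=> <-; last by move=> y; rewrite inE; exact: f0.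
rewrite -(@ge0_integral_mscale _ _ _ lebesgue D mD (NngNum k0) f)//.
apply: eq_measure_integral => A mA AD.
exact: lebesgue_affine.
Qed.

End lebesgue_affine.

Section borel_space.
Context {R : realType} {n : nat}.
Local Notation Rn := 'rV[R]_n.+1.
Local Notation LT := (lebesgueT R n).

Definition halfspaces : set (set Rn) :=
  [set H | exists (c : R) (i : 'I_n.+1), H = [set x : Rn | x 0 i < c]].

(** The Borel sigma-algebra of R^d. Subtraction is measurable from a product of two
    Lebesgue sigma-algebras to the Borel sets but not to the Lebesgue sets, so the
    kernels evaluated at x - y have to be Borel functions. *)
Definition borelT : Type := g_sigma_algebraType halfspaces.
HB.instance Definition _ := Measurable.on borelT.

Lemma measurable_to_borel d (S : measurableType d) (D : set S) (f : S -> Rn) :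
  (forall i, measurable_fun D (fun z => f z 0 i)) ->
  measurable_fun D (f : S -> borelT).
Proof.
move=> mf mD; have := @measurability _ _ S borelT D f halfspaces erefl.
apply=> //; move=> _ [_ [c [i ->]] <-].
rewrite (_ : f @^-1` _ = (fun z => f z 0 i) @^-1` `]-oo, c[%classic).
  by apply: mf => //; exact: measurable_itv.
by apply/seteqP; split => z /=; rewrite in_itv.
Qed.

Lemma measurable_borel_coord (i : 'I_n.+1) :
  measurable_fun [set: borelT] (fun x : borelT => (x : Rn) 0 i).
Proof.
move=> mD; apply: (measurability _ (RGenInftyO.measurableE R)) => //.
move=> _ [_ [c ->] <-]; rewrite setTI.
apply: sub_sigma_algebra; exists c, i.
by apply/seteqP; split => x /=; rewrite in_itv.
Qed.

Lemma measurable_box (a b : Rn) : measurable (box a b : set (borelT)).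
Proof.
rewrite (_ : box a b = \bigcap_(i in [set: 'I_n.+1])
   ((fun x : Rn => x 0 i) @^-1` `[a 0 i, b 0 i[%classic)); last first.
  by apply/seteqP; split => [x xab i _|x xab i]; have := xab i; rewrite /= in_itv; [|move/(_ Logic.I)].
apply: fin_bigcap_measurable => [|i _]; first exact: finite_finset.
by rewrite -[X in measurable X]setTI; apply: measurable_borel_coord => //; exact: measurable_itv.
Qed.

Lemma borel_lebesgue : measurable_fun [set: LT] (fun x : LT => (x : Rn) : borelT).
Proof. by apply: measurable_to_borel => i; exact: measurable_coord. Qed.

Lemma measurable_borel_sub : measurable_fun [set: LT * LT]
  (fun z : LT * LT => ((z.1 : Rn) - (z.2 : Rn)) : borelT).
Proof.
apply: measurable_to_borel => i; under eq_fun do rewrite !mxE.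
by apply: measurable_funB; apply: measurableT_comp (measurable_coord i) _.
Qed.

Lemma measurable_borel_subr (c : Rn) : measurable_fun [set: LT]
  (fun y : LT => (c - (y : Rn)) : borelT).
Proof.
apply: measurable_to_borel => i; under eq_fun do rewrite !mxE.
by apply: measurable_funB; [exact: measurable_cst|exact: measurable_coord].
Qed.

End borel_space.
Arguments borelT R n : clear implicits.

Section Q_shapes.
Context {R : realType} {n : nat}.
Local Notation Rn := 'rV[R]_n.+1.
Local Notation LT := (lebesgueT R n).
Implicit Types (a b x c : Rn) (A D : set Rn).

Definition Qnorm (sh : Q_shape) x : R :=
  match sh with cubes => `|x| | balls => enorm x end.

Lemma QE sh x (s : R) : Q sh x s = [set y | Qnorm sh (y - x) < s].
Proof. by case: sh. Qed.

Lemma coord_le_norm x i : `|x 0 i| <= `|x|.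
Proof.
rewrite /Num.norm /= mx_normrE.
by apply: (le_bigmax _ (fun ij : 'I_1 * 'I_n.+1 => `|x ij.1 ij.2|) (0, i)).
Qed.

Lemma norm_le_coord x (s : R) : 0 <= s -> (forall i, `|x 0 i| <= s) -> `|x| <= s.
Proof.
move=> s0 H; rewrite /Num.norm /= mx_normrE; apply: bigmax_le => // -[i j] _ /=.
by rewrite (ord1 i).
Qed.

Lemma norm_le_enorm x : `|x| <= enorm x.
Proof.
apply: norm_le_coord => [|i]; first exact: sqrtr_ge0.
rewrite -sqrtr_sqr ler_sqrt ?sumr_ge0//; last by move=> j _; rewrite sqr_ge0.
by rewrite (bigD1 i)//= lerDl sumr_ge0// => j _; rewrite sqr_ge0.
Qed.

Lemma enorm_le_norm x : enorm x <= n.+1%:R * `|x|.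
Proof.
have n0 : 0 <= n.+1%:R * `|x| by rewrite mulr_ge0.
rewrite -(ger0_norm n0) -sqrtr_sqr ler_sqrt ?sqr_ge0//.
apply: (@le_trans _ _ (\sum_(i < n.+1) `|x| ^+ 2)).
  by apply: ler_sum => i _; rewrite -real_normK ?num_real// lerXn2r ?nnegrE// coord_le_norm.
rewrite sumr_const card_ord exprMn -[leLHS]mulr_natl ler_wpM2r ?sqr_ge0//.
by rewrite -natrX ler_nat expnS expn1 leq_pmulr.
Qed.

Lemma norm_le_Qnorm sh x : `|x| <= Qnorm sh x.
Proof. by case: sh => //=; exact: norm_le_enorm. Qed.

Lemma Qnorm_le_norm sh x : Qnorm sh x <= n.+1%:R * `|x|.
Proof.
by case: sh => /=; [rewrite ler_peMl// ler1n|exact: enorm_le_norm].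
Qed.

Lemma Qnorm_ge0 sh x : 0 <= Qnorm sh x.
Proof. by apply: le_trans (norm_le_Qnorm sh x). Qed.

Lemma QnormZ sh (t : R) x : Qnorm sh (t *: x) = `|t| * Qnorm sh x.
Proof.
case: sh => /=; first by rewrite normrZ.
rewrite /enorm -(sqrtr_sqr t) -sqrtrM ?sqr_ge0// mulr_sumr.
by congr Num.sqrt; apply: eq_bigr => i _; rewrite mxE exprMn.
Qed.

Lemma measurable_Qnorm_borel sh :
  measurable_fun [set: borelT R n] (fun x : borelT R n => Qnorm sh (x : Rn)).
Proof.
have mc := @measurable_borel_coord R n; case: sh => /=.
  rewrite (_ : (fun _ => _) =
      (fun x : Rn => \big[Num.max/0]_(i <- enum 'I_n.+1) `|x 0 i|)); last first.
    apply/funext => x; rewrite big_enum; apply/eqP; rewrite eq_le; apply/andP; split.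
      apply: norm_le_coord => [|i]; first exact: bigmax_ge_id.
      exact: (le_bigmax_cond _ (fun i => `|x 0 i|)).
    by apply: bigmax_le => // i _; exact: coord_le_norm.
  elim: (enum _) => [|i s IH]; first by under eq_fun do rewrite big_nil; exact: measurable_cst.
  under eq_fun do rewrite big_cons.
  by apply: measurable_maxr => //; apply: measurableT_comp; [|exact: mc].
have msq : measurable_fun [set: R] (@Num.sqrt R).
  by apply: continuous_measurable_fun; exact: sqrt_continuous.
have mss : measurable_fun [set: borelT R n]
    (fun x : borelT R n => \sum_(i < n.+1) (x : Rn) 0 i ^+ 2).
  by apply: measurable_sum => i; apply: measurable_funX; exact: mc.
exact: measurableT_comp msq mss.
Qed.

Lemma measurable_Qnorm sh c :
  measurable_fun [set: LT] (fun x : LT => Qnorm sh ((x : Rn) - c)).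
Proof.
apply: (measurableT_comp (measurable_Qnorm_borel sh)).
apply: measurable_to_borel => i; under eq_fun do rewrite !mxE.
by apply: measurable_funB; [exact: measurable_coord|exact: measurable_cst].
Qed.

Lemma measurable_Q sh x (s : R) : measurable (Q sh x s : set LT).
Proof.
rewrite QE (_ : [set y | _] = (fun y => Qnorm sh (y - x)) @^-1` `]-oo, s[%classic).
  by rewrite -[X in measurable X]setTI; apply: measurable_Qnorm => //; exact: measurable_itv.
by apply/seteqP; split => y /=; rewrite in_itv.
Qed.

Definition kappa sh : R := fine (lebesgue (Q sh (0 : Rn) 1)).

Lemma lebesgue_Q1 sh : lebesgue (Q sh (0 : Rn) 1) = (kappa sh)%:E.
Proof.
rewrite /kappa fineK// ge0_fin_numE//.
have sub : Q sh (0 : Rn) 1 `<=` box (const_mx (-1)) (const_mx 1).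
  move=> x; rewrite QE /= subr0 => xs i; rewrite !mxE.
  have := le_lt_trans (le_trans (coord_le_norm x i) (norm_le_Qnorm sh x)) xs.
  by rewrite ltr_norml => /andP[/ltW-> ->].
apply: le_lt_trans (le_lebesgue_outer sub) _.
by apply: le_lt_trans (outer_box_le _ _) _; rewrite ltry.
Qed.

Lemma kappa_gt0 sh : 0 < kappa sh.
Proof.
rewrite -lte_fin -lebesgue_Q1.
pose h : R := (n.+2%:R)^-1.
have h0 : 0 < h by rewrite invr_gt0.
have sub : box (0 : Rn) (const_mx h) `<=` Q sh (0 : Rn) 1.
  move=> x xh; rewrite QE /= subr0.
  apply: le_lt_trans (Qnorm_le_norm sh x) _.
  apply: (@le_lt_trans _ _ (n.+1%:R * h)).
    rewrite ler_wpM2l// norm_le_coord ?(ltW h0)// => i.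
    by have := xh i; rewrite !mxE => /andP[x0 /ltW]; rewrite ger0_norm.
  by rewrite ltr_pdivrMr// mul1r ltr_nat.
apply: lt_le_trans (le_lebesgue_outer sub).
apply: lt_le_trans (box_vol_le_outer _ _); rewrite lte_fin.
by apply: prodr_gt0 => i _; rewrite !mxE subr0 lt_max h0 orbT.
Qed.

Lemma Q_affine sh x (s : R) : 0 < s ->
  Q sh x s = [set y | Q sh 0 1 (s^-1 *: y + - (s^-1 *: x))].
Proof.
move=> s0; rewrite !QE; apply/seteqP; split => y;
  by rewrite /= subr0 -scalerBr QnormZ gtr0_norm ?invr_gt0// ltr_pdivrMl// mulr1.
Qed.

Lemma lebesgue_Q sh x (s : R) : 0 < s ->
  lebesgue (Q sh x s) = (kappa sh * s ^+ n.+1)%:E.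
Proof.
move=> s0; rewrite (Q_affine _ _ s0).
rewrite (@lebesgue_affine R n s^-1 (- (s^-1 *: x)) (Q sh 0 1)) ?invr_eq0 ?gt_eqF//.
by rewrite gtr0_norm ?invr_gt0// exprVn invrK lebesgue_Q1 -EFinM mulrC.
Qed.

Lemma Q_nat_cover sh (x : Rn) : exists k : nat, Q sh 0 k.+1%:R x.
Proof.
exists (Num.bound (Qnorm sh x)); rewrite QE /= subr0.
by rewrite (lt_le_trans (archi_boundP (Qnorm_ge0 sh x)))// ler_nat.
Qed.

End Q_shapes.
Arguments kappa R n sh : clear implicits.

Section sigma_finite.
Context {R : realType} {n : nat}.

Lemma lebesgue_sigma_finite : sigma_finite [set: lebesgueT R n] lebesgue.
Proof.
exists (fun k => Q cubes 0 k.+1%:R).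
  by apply/seteqP; split => // x _; have [k xk] := Q_nat_cover cubes x; exists k.
move=> k; split; first exact: measurable_Q.
by rewrite lebesgue_Q// ltry.
Qed.

(** An alias of Lebesgue measure that carries the instance of sigma-finite measure on
    which Tonelli's theorem relies. *)
Definition lebesgue_sigma : set (lebesgueT R n) -> \bar R := lebesgue.

HB.instance Definition _ := Measure.copy lebesgue_sigma lebesgue.

HB.instance Definition _ := @Measure_isSigmaFinite.Build _ (lebesgueT R n) R lebesgue_sigma
  lebesgue_sigma_finite.

End sigma_finite.

Arguments lebesgue_sigma R n : clear implicits.

(** * Homogeneous kernels and integration over the sphere *)

Section measurable_powers.
Context d {T : measurableType d} {R : realType}.
Implicit Types (D : set T) (f : T -> R).

Lemma measurable_EFin_powR D f (e : R) :
  measurable_fun D f -> measurable_fun D (fun x => (f x `^ e)%:E).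
Proof.
by move=> mf; apply/measurable_EFinP; exact: measurableT_comp (measurable_powR e) mf.
Qed.

Lemma measurable_normr_fun D f :
  measurable_fun D f -> measurable_fun D (fun x => `|f x|).
Proof. by move=> mf; exact: measurableT_comp. Qed.

Lemma measurable_EFin_normr_powR D f (e : R) :
  measurable_fun D f -> measurable_fun D (fun x => (`|f x| `^ e)%:E).
Proof. by move=> mf; apply/measurable_EFin_powR/measurable_normr_fun. Qed.

End measurable_powers.

Section borel_representative.
Context {R : realType} {n : nat}.
Local Notation Rn := 'rV[R]_n.+1.
Local Notation LT := (lebesgueT R n).
Local Notation BT := (borelT R n).

Lemma borel_measurable (G : set BT) : measurable G -> measurable (G : set LT).
Proof.
by move=> mG; rewrite -[X in measurable X]setTI; exact: (borel_lebesgue measurableT).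
Qed.

(** The hull is the intersection of the covers by boxes whose total volumes tend to
    the outer measure of A. *)
Let borel_hull_fin (A : set LT) : measurable A -> (lebesgue A < +oo)%E ->
  exists G : set BT, [/\ measurable G, A `<=` G & lebesgue (G `\` A : set LT) = 0%E].
Proof.
move=> mA Afin.
have Af : lebesgue A \is a fin_num by rewrite ge0_fin_numE.
have cov (k : nat) : exists F : nat -> Rn * Rn, box_cover A F /\
    (box_series F < lebesgue A + (k.+1%:R^-1)%:E)%E.
  have k0 : 0 < k.+1%:R^-1 :> R by rewrite invr_gt0.
  by have [_ [F AF <-] Flt] := lb_ereal_inf_adherent k0 Af; exists F.
have [F FP] := choice cov.
pose G : set BT := \bigcap_k \bigcup_j box (F k j).1 (F k j).2.
have mG : measurable G.
  by apply: bigcapT_measurable => k; apply: bigcupT_measurable => j; exact: measurable_box.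
have AG : A `<=` G by move=> x Ax k _; exact: (FP k).1.
have mGL := borel_measurable mG.
have GA : (lebesgue (G : set LT) <= lebesgue A)%E.
  apply/lee_addgt0Pr => e e0.
  have [k ke] : exists k : nat, k.+1%:R^-1 < e.
    exists (Num.bound e^-1); rewrite invf_plt ?posrE//.
    rewrite (lt_le_trans (archi_boundP _)) ?ler_nat// invr_ge0; exact: ltW.
  apply: (@le_trans _ _ (box_series (F k))).
    by apply: ereal_inf_lbound; exists (F k) => //; exact: bigcap_inf.
  by apply: (le_trans (ltW (FP k).2)); rewrite leeD2l// lee_fin ltW.
exists G; split => //; apply/eqP; rewrite eq_le measure_ge0 andbT.
rewrite measureD//; last by apply: le_lt_trans Afin.
by rewrite setIC (setIidl AG) leeBlDr// add0e.
Qed.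

Lemma borel_hull (A : set LT) : measurable A ->
  exists G : set BT, [/\ measurable G, A `<=` G &
    lebesgue.-negligible (G `\` A : set LT)].
Proof.
move=> mA.
have mAk (k : nat) : measurable (A `&` Q cubes 0 k.+1%:R : set LT).
  by apply: measurableI => //; exact: measurable_Q.
have H k : exists G : set BT, [/\ measurable G, A `&` Q cubes 0 k.+1%:R `<=` G &
    lebesgue (G `\` (A `&` Q cubes 0 k.+1%:R) : set LT) = 0%E].
  apply: borel_hull_fin => //; apply: (@le_lt_trans _ _ (lebesgue (Q cubes 0 k.+1%:R))).
    by apply: le_lebesgue_outer; exact: subIsetr.
  by rewrite lebesgue_Q// ltry.
have [G GP] := choice H.
exists (\bigcup_k G k); split.
- by apply: bigcupT_measurable => k; have [] := GP k.
- move=> x Ax; have [k xk] := Q_nat_cover cubes x.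
  by exists k => //; have [_ + _] := GP k; apply.
- have sub : ((\bigcup_k G k) `\` A : set LT) `<=`
      (\bigcup_k (G k `\` (A `&` Q cubes 0 k.+1%:R)) : set LT).
    by move=> x [[k _ Gx] nAx]; exists k => //; split => // -[].
  apply: negligibleS sub _.
  apply: negligible_bigcup => k; have [mG _ G0] := GP k.
  apply/negligibleP => //; apply: measurableD => //; exact: borel_measurable.
Qed.

(** A Borel representative is the supremum of the multiples of indicators of Borel
    hulls of its superlevel sets at rational levels. *)
Lemma borel_representative (g : LT -> R) : measurable_fun [set: LT] g ->
  (forall x, 0 <= g x) -> exists g' : BT -> R,
    [/\ measurable_fun [set: BT] g', forall x, 0 <= g' x &
        {ae lebesgue, forall x : LT, g' x = g x}].
Proof.
move=> mg g0.
pose c (k : nat) : R := if unpickle k is Some q then Num.max 0 (ratr (q : rat)) else 0.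
have c0 k : 0 <= c k by rewrite /c; case: unpickle => // q; rewrite le_max lexx.
have mA k : measurable ([set x | c k < g x] : set LT).
  rewrite (_ : [set x | _] = g @^-1` `]c k, +oo[%classic).
    by rewrite -[X in measurable X]setTI; apply: mg => //; exact: measurable_itv.
  by apply/seteqP; split => x /=; rewrite in_itv /= andbT.
have [G GP] := choice (fun k => borel_hull (mA k)).
pose u k (x : BT) : \bar R := (c k * \1_(G k) x)%:E.
have u0 k x : (0 <= u k x)%E by rewrite lee_fin mulr_ge0.
pose h x := esups (u^~ x) 0.
have mh : measurable_fun [set: BT] h.
  apply: measurable_fun_esups => k; apply/measurable_EFinP.
  by apply: measurable_funM => //; apply: measurable_indic; have [] := GP k.
have hub k x : (u k x <= h x)%E by apply: ereal_sup_ubound; exists k.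
exists (fine \o h); split.
- by apply: measurableT_comp mh; exact: fine_measurable.
- by move=> x; rewrite fine_ge0// (le_trans (u0 0%N x)).
have negl : lebesgue.-negligible (\bigcup_k (G k `\` [set x | c k < g x]) : set LT).
  by apply: negligible_bigcup => k; have [] := GP k.
apply: negligibleS negl => x /= hgx; apply: contrapT => nx; apply: hgx.
have Gx k : G k x <-> c k < g x.
  split=> [Gkx|]; last by have [_ + _] := GP k; apply.
  by apply: contrapT => cg; apply: nx; exists k.
have hg : (h x <= (g x)%:E)%E.
  apply: ge_ereal_sup => _ [k _ <-]; rewrite /u lee_fin indicE.
  by have [/set_mem/Gx/ltW cg|_] := boolP (x \in G k); rewrite ?mulr1 ?mulr0.
have hfin : h x \is a fin_num by rewrite ge0_fin_numE ?(le_lt_trans hg) ?ltry// (le_trans (u0 0%N x)).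
apply/eqP; rewrite eq_le -lee_fin fineK// hg leNgt; apply/negP => /rat_in_itvoo[q].
rewrite in_itv /= => /andP[hq qg].
have cq : c (pickle q) = ratr q.
  by rewrite /c pickleK max_r// ltW// (le_lt_trans _ hq)// fine_ge0// (le_trans (u0 0%N x)).
have := hub (pickle q) x; rewrite /u indicE mem_set; last by apply/Gx; rewrite cq.
by rewrite mulr1 cq -(fineK hfin) lee_fin leNgt hq.
Qed.

End borel_representative.

Section homogeneous_functions.
Context {R : realType} {n : nat}.
Local Notation Rn := 'rV[R]_n.+1.
Local Notation LT := (lebesgueT R n).
Local Notation BT := (borelT R n).

Definition moment_bound (W : BT -> R) (e I : R) : Prop := forall s, 0 < s ->
  (\int[lebesgue]_(x in (Q balls (0 : Rn) s : set LT)) (W x `^ e)%:E <=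
   (I * s ^+ n.+1)%:E)%E.

(** What the proof keeps of |Omega|: by homogeneity of degree zero, the integral of its
    e-th power over a ball of radius s is a multiple of s ^ d. *)
Definition profile (pt : \bar R) (W : BT -> R) : Prop :=
  [/\ measurable_fun [set: BT] W, forall z, 0 <= W z,
      forall e : R, 0 < e -> (e%:E <= pt)%E -> exists2 I : R, 0 < I & moment_bound W e I &
      pt = +oo%E -> exists2 M : R, 0 < M & forall x, W x <= M].

Variable Omega : Rn -> R.
Hypothesis hOmega : homogeneous0 Omega.

Lemma enorm_gt0 (x : Rn) : x != 0 -> 0 < enorm x.
Proof. by move=> x0; rewrite (lt_le_trans _ (norm_le_enorm x))// normr_gt0. Qed.

Lemma homogeneous_direction (x : Rn) : Omega (direction x) = Omega x.
Proof.
have [->|x0] := eqVneq x 0; first by rewrite /direction scaler0.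
by rewrite /direction hOmega// invr_gt0 enorm_gt0.
Qed.

Lemma directionZ (t : R) (x : Rn) : 0 < t -> direction (t *: x) = direction x.
Proof.
move=> t0; rewrite /direction.
have -> : enorm (t *: x) = t * enorm x by rewrite -[t in RHS]gtr0_norm//; exact: (QnormZ balls).
by rewrite scalerA invfM mulrAC mulVf ?gt_eqF// mul1r.
Qed.

Lemma measurable_direction :
  measurable_fun [set: LT] (fun x : LT => direction (x : Rn) : sphereT R n).
Proof. by move=> _ A mA; rewrite setTI. Qed.

(** Omega agrees with Omega \o direction, and direction is measurable because the
    sigma-algebra of the sphere is the one that it induces. *)
Lemma measurable_homogeneous : measurable_fun [set: sphereT R n] Omega ->
  measurable_fun [set: LT] Omega.
Proof.
move=> mO; rewrite (_ : Omega = Omega \o (fun x : Rn => direction x)).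
  exact: measurableT_comp mO measurable_direction.
by apply/funext => x; rewrite /= homogeneous_direction.
Qed.

Local Notation B1 := (Q balls (0 : Rn) 1 : set LT).

(** By definition the surface measure is the image under direction of d times Lebesgue
    measure on the unit ball. *)
Lemma integral_sphere (f : sphereT R n -> \bar R) :
  measurable_fun [set: sphereT R n] f -> (forall x, 0 <= f x)%E ->
  (\int[surface]_x f x = n.+1%:R%:E * \int[lebesgue]_(x in B1) f (direction x))%E.
Proof.
move=> mf f0.
have mB : measurable B1 := measurable_Q balls 0 1.
have d0 : 0 <= n.+1%:R :> R by [].
pose m1 := mrestr (@lebesgue R n) mB.
have mdir := measurable_direction.
transitivity (\int[mscale (NngNum d0) m1]_(x in setT)
    (f \o (fun x : LT => direction (x : Rn) : sphereT R n)) x)%E.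
  have := @ge0_integral_pushforward _ _ _ _ R _ mdir (mscale (NngNum d0) m1) setT f
    measurableT mf.
  rewrite preimage_setT => <-; last by move=> y _; exact: f0.
  apply: eq_measure_integral => A mA _; rewrite /mscale /= /surface /pushforward.
  rewrite /mscale /= /m1 /mrestr /= setIC; congr (_ * lebesgue (_ `&` _))%E.
  by apply/seteqP; split => x /=; rewrite subr0.
have mfd : measurable_fun [set: LT] (f \o (fun x : LT => direction (x : Rn) : sphereT R n)).
  exact: measurableT_comp mf mdir.
rewrite (ge0_integral_mscale m1 measurableT (NngNum d0) mfd (fun x _ => f0 _)).
congr (_ * _)%E.
have nB : measurable (~` B1) := measurableC mB.
have m0 : m1 (~` B1) = 0%E by rewrite /m1 /mrestr setICl; exact: measure0.
rewrite (ge0_negligible_integral nB measurableT mfd (fun x _ => f0 _) m0).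
rewrite setTD setCK; apply: eq_measure_integral => A mA AB.
by rewrite /m1 /= /mrestr setIidl.
Qed.

Lemma integral_homogeneous (e s : R) : measurable_fun [set: LT] Omega -> 0 < s ->
  (\int[lebesgue]_(x in (Q balls (0 : Rn) s : set LT)) (`|Omega x| `^ e)%:E =
   (s ^+ n.+1)%:E * \int[lebesgue]_(x in B1) (`|Omega x| `^ e)%:E)%E.
Proof.
move=> mO s0.
have sV : s^-1 != 0 by rewrite invr_eq0 gt_eqF.
have mOe : measurable_fun [set: LT] (fun x : LT => (`|Omega x| `^ e)%:E).
  exact: measurable_EFin_normr_powR.
have mB : measurable B1 := measurable_Q balls 0 1.
have := @ge0_integral_affine R n s^-1 0 B1 (fun x => (`|Omega x| `^ e)%:E) sV mB
  (measurable_funTS mOe) (fun x _ => powR_ge0 _ _).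
rewrite gtr0_norm ?invr_gt0// exprVn invrK => <-.
rewrite (_ : [set x : LT | _] = Q balls 0 s); last first.
  by rewrite (Q_affine balls 0 s0) scaler0 oppr0.
apply: eq_integral => x _; rewrite addr0.
have [->|x0] := eqVneq (x : Rn) 0; first by rewrite scaler0.
by rewrite hOmega ?invr_gt0.
Qed.

(** t ^ e <= 1 + t ^ v for e <= v, and the unit ball has finite volume. *)
Lemma Lp_sphere_ball (v e : R) : 0 < e -> e <= v -> in_Lp_sphere v%:E Omega ->
  (\int[lebesgue]_(x in B1) (`|Omega x| `^ e)%:E < +oo)%E.
Proof.
move=> e0 ev [mO LO].
have v0 : 0 < v by exact: lt_le_trans ev.
have mOl := measurable_homogeneous mO.
have mB : measurable B1 := measurable_Q balls 0 1.
have mp (r : R) : measurable_fun B1 (fun x : LT => (`|Omega x| `^ r)%:E).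
  by apply: measurable_funTS; exact: measurable_EFin_normr_powR.
have Iv : (\int[lebesgue]_(x in B1) (`|Omega x| `^ v)%:E < +oo)%E.
  move: LO; rewrite unlock => /lty_poweRy; rewrite invr_eq0 gt_eqF// => /(_ isT).
  rewrite integral_sphere; last 2 first.
  - exact: measurable_EFin_normr_powR.
  - by move=> x; exact: poweR_ge0.
  under eq_integral do rewrite /= homogeneous_direction.
  have I0 : (0 <= \int[lebesgue]_(x in B1) (`|Omega x| `^ v)%:E)%E.
    by apply: integral_ge0 => x _; rewrite lee_fin powR_ge0.
  rewrite !ltey; apply: contra => /eqP ->.
  by rewrite gt0_muley// lte_fin.
have I1 : (\int[lebesgue]_(x in B1) (cst 1%:E : LT -> \bar R) x < +oo)%E.
  by rewrite integral_cst// mul1e lebesgue_Q1 ltry.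
apply: (@le_lt_trans _ _ (\int[lebesgue]_(x in B1)
   (cst 1%:E x + (`|Omega x| `^ v)%:E))%E); last first.
  by rewrite ge0_integralD//; exact: lte_add_pinfty.
apply: ge0_le_integral.
- exact: mB.
- by move=> x _; rewrite lee_fin powR_ge0.
- exact: mp.
- by apply: emeasurable_funD; [exact: measurable_cst|exact: mp].
- move=> x _; rewrite -EFinD lee_fin.
  have [h1|h1] := leP 1 `|Omega x|.
    by rewrite (le_trans (ler_powR h1 ev))// lerDr.
  rewrite (@le_trans _ _ 1)//; last by rewrite lerDl powR_ge0.
  by have := @ge0_ler_powR R e (ltW e0) `|Omega x| 1; rewrite !nnegrE powR1; apply => //; exact: ltW.
Qed.

Lemma Linfty_sphere_bound : in_Lp_sphere +oo%E Omega ->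
  exists2 M : R, 0 < M & {ae lebesgue, forall x : LT, `|Omega x| <= M}.
Proof.
move=> [mO]; rewrite unlock.
have sT : (0 < surface [set: sphereT R n])%E.
  rewrite /surface preimage_setT setIT.
  have -> : [set x : Rn | enorm x < 1] = Q balls 0 1.
    by apply/seteqP; split => x /=; rewrite subr0.
  by rewrite lebesgue_Q1 -EFinM lte_fin mulr_gt0// kappa_gt0.
rewrite sT => ess.
have [M M0 [N [mN N0 sub]]] : exists2 M : R, 0 < M &
    {ae surface, forall x : sphereT R n, `|Omega x| <= M}.
  have := @ess_sup_ge _ (sphereT R n) R surface (abse \o (EFin \o Omega)).
  move: ess; set E := ess_sup _ _; case: E => [M| |] // _ aeM.
    exists (Num.max M 1); first by rewrite lt_max ltr01 orbT.
    by apply: filterS aeM => x /=; rewrite lee_fin le_max => ->.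
  by exists 1 => //; apply: filterS aeM => x /=.
exists M => //.
pose Z : set LT := [set x | (enorm (x : Rn) < 1)%R] `&` (fun x : Rn => direction x) @^-1` N.
have mZ : measurable Z.
  apply: measurableI; first exact: measurable_unit_ball.
  by have := measurable_direction measurableT mN; rewrite setTI.
have Z0 : lebesgue Z = 0%E.
  by have /eqP := N0; rewrite /surface mule_eq0 -/Z eqe pnatr_eq0 /= => /eqP.
have k0 (k : nat) : k.+1%:R^-1 != 0 :> R by rewrite invr_eq0.
pose Zk (k : nat) : set LT := [set x : LT | Z (k.+1%:R^-1 *: (x : Rn) + 0)].
have : lebesgue.-negligible (\bigcup_k Zk k : set LT).
  apply: negligible_bigcup => k; apply/negligibleP.
    by have := measurable_affine 0 (k0 k) measurableT mZ; rewrite setTI.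
  by have := lebesgue_affine 0 Z (k0 k); rewrite Z0 mule0.
apply: negligibleS => x /= nx.
have [k] := Q_nat_cover balls (x : Rn); rewrite QE /= subr0 => xk.
exists k => //; rewrite /Zk /Z /= addr0; split.
  have -> : enorm (k.+1%:R^-1 *: (x : Rn)) = k.+1%:R^-1 * enorm (x : Rn).
    by have := QnormZ balls k.+1%:R^-1 (x : Rn); rewrite /= gtr0_norm ?invr_gt0.
  by rewrite ltr_pdivrMl// mulr1.
by rewrite directionZ ?invr_gt0//; apply: sub => /=; rewrite homogeneous_direction.
Qed.

(** The Borel representative makes W (x - y) measurable in the pair (x, y). For
    pt = +oo, truncating it turns the essential bound into a bound at every point. *)
Lemma homogeneous_borel_representative (pt : \bar R) : (1 <= pt)%E ->
  in_Lp_sphere pt Omega -> exists W : BT -> R, profile pt W /\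
    {ae lebesgue, forall x : LT, W x = `|Omega x|}.
Proof.
move=> pt1 LO.
have mOl := measurable_homogeneous LO.1.
have mOa : measurable_fun [set: LT] (fun x : LT => `|Omega x|) by exact: measurable_normr_fun.
have [W [mW W0 aeW]] := borel_representative mOa (fun x => normr_ge0 _).
have mWe (V : BT -> R) (e : R) : measurable_fun [set: BT] V ->
    measurable_fun [set: LT] (fun x : LT => (V x `^ e)%:E).
  by move=> mV; apply: measurable_EFin_powR; exact: measurableT_comp mV borel_lebesgue.
have mQ (s : R) : measurable (Q balls (0 : Rn) s : set LT) := measurable_Q balls 0 s.
case: pt pt1 LO => [v| |] // v1 LO.
  exists W; split => //; split => // e e0 ev.
  have Ifin := Lp_sphere_ball e0 ev LO.
  have I0 : (0 <= \int[lebesgue]_(x in B1) (`|Omega x| `^ e)%:E)%E.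
    by apply: integral_ge0 => x _; rewrite lee_fin powR_ge0.
  exists (fine (\int[lebesgue]_(x in B1) (`|Omega x| `^ e)%:E) + 1).
    by rewrite ltr_pwDr// fine_ge0.
  move=> s s0.
  have -> : (\int[lebesgue]_(x in (Q balls (0 : Rn) s : set LT)) (W x `^ e)%:E =
      \int[lebesgue]_(x in (Q balls (0 : Rn) s : set LT)) (`|Omega x| `^ e)%:E)%E.
    apply: ge0_ae_eq_integral.
    - exact: mQ.
    - exact: measurable_funTS (mWe _ _ mW).
    - by apply: measurable_funTS; exact: measurable_EFin_powR.
    - by move=> x _; rewrite lee_fin powR_ge0.
    - by move=> x _; rewrite lee_fin powR_ge0.
    - by apply: filterS aeW => x -> _.
  rewrite integral_homogeneous// [X in (_ <= X%:E)%E]mulrC EFinM.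
  rewrite lee_wpmul2l ?lee_fin ?exprn_ge0 ?(ltW s0)//.
  by rewrite EFinD fineK ?ge0_fin_numE// leeDl.
have [M M0 aeM] := Linfty_sphere_bound LO.
have mM : measurable_fun [set: BT] (fun x : BT => Num.min (W x) M).
  by apply: measurable_minr; [exact: mW|exact: measurable_cst].
have WM0 x : 0 <= Num.min (W x) M by rewrite le_min W0 ltW.
exists (fun x => Num.min (W x) M); split; last first.
  by apply: filterS2 aeW aeM => x -> OM; rewrite min_l.
split => //.
- move=> e e0 _; exists (M `^ e * kappa R n balls).
    by rewrite mulr_gt0 ?kappa_gt0// powR_gt0.
  move=> s s0; rewrite -mulrA EFinM -(lebesgue_Q balls (0 : Rn) s0) -integral_cst//.
  apply: ge0_le_integral.
  - exact: mQ.
  - by move=> x _; rewrite lee_fin powR_ge0.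
  - exact: measurable_funTS (mWe _ _ mM).
  - exact: measurable_cst.
  - move=> x _; rewrite lee_fin; apply: ge0_ler_powR; rewrite ?nnegrE ?(ltW e0) ?(ltW M0)//.
    by rewrite ge_min lexx orbT.
- by move=> _; exists M => // x; rewrite ge_min lexx orbT.
Qed.

End homogeneous_functions.

(** * Potentials of measurable densities *)

Lemma le_poweR (R : realType) (q : R) (x y : \bar R) : 0 <= q ->
  (0 <= x -> x <= y -> x `^ q <= y `^ q)%E.
Proof.
move=> q0 x0 xy; apply: gt0_ler_poweR => //; rewrite in_itv /= leey andbT//.
exact: le_trans xy.
Qed.

Section potentials.
Context {R : realType} {n : nat}.
Local Notation Rn := 'rV[R]_n.+1.
Local Notation LT := (lebesgueT R n).
Local Notation BT := (borelT R n).
Implicit Types (K L : BT -> R) (h : LT -> R) (D : set LT).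

Definition potential K h (x : Rn) : \bar R :=
  \int[lebesgue]_y (K (x - (y : Rn)) * `|h y|)%:E.

Lemma potential_ge0 K h x : (forall z, 0 <= K z) -> (0 <= potential K h x)%E.
Proof. by move=> K0; apply: integral_ge0 => y _; rewrite lee_fin mulr_ge0. Qed.

Let measurable_pair K h : measurable_fun [set: BT] K -> measurable_fun [set: LT] h ->
  measurable_fun [set: LT * LT]
    (fun z : LT * LT => K ((z.1 : Rn) - (z.2 : Rn)) * `|h z.2|).
Proof.
move=> mK mh; apply: measurable_funM.
  exact: measurableT_comp mK measurable_borel_sub.
exact: measurableT_comp (measurable_normr_fun mh) measurable_snd.
Qed.

Lemma measurable_convolved K h (x : Rn) : measurable_fun [set: BT] K ->
  measurable_fun [set: LT] h ->
  measurable_fun [set: LT] (fun y : LT => (K (x - (y : Rn)) * `|h y|)%:E).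
Proof.
move=> mK mh; apply/measurable_EFinP; apply: measurable_funM.
  exact: measurableT_comp mK (measurable_borel_subr x).
exact: measurable_normr_fun.
Qed.

Lemma measurable_potential K h : measurable_fun [set: BT] K ->
  (forall z, 0 <= K z) -> measurable_fun [set: LT] h ->
  measurable_fun [set: LT] (potential K h).
Proof.
move=> mK K0 mh.
have mp := measurable_pair mK mh; move/measurable_EFinP in mp.
have p0 (z : LT * LT) : (0 <= (EFin \o (fun z : LT * LT =>
    K ((z.1 : Rn) - (z.2 : Rn)) * `|h z.2|)%R) z)%E by rewrite lee_fin mulr_ge0.
exact: (@measurable_fun_fubini_tonelli_F _ _ LT LT R (lebesgue_sigma R n) _ mp p0).
Qed.

Lemma potential_le K L h (c : R) (x : Rn) :
  measurable_fun [set: BT] K -> measurable_fun [set: BT] L ->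
  (forall z, 0 <= K z) -> (forall z, 0 <= L z) -> measurable_fun [set: LT] h -> 0 <= c ->
  (forall y, h y != 0 -> K (x - y) <= c * L (x - y)) ->
  (potential K h x <= c%:E * potential L h x)%E.
Proof.
move=> mK mL K0 L0 mh c0 KL.
have mLh := measurable_convolved x mL mh.
rewrite /potential -ge0_integralZl_EFin//; last first.
  by move=> y _; rewrite lee_fin mulr_ge0.
apply: ge0_le_integral.
- exact: measurableT.
- by move=> y _; rewrite lee_fin mulr_ge0.
- exact: measurable_convolved.
- exact: measurable_funeM.
- move=> y _; rewrite -EFinM lee_fin mulrA.
  have [->|hy] := eqVneq (h y) 0; first by rewrite normr0 !mulr0.
  by rewrite ler_wpM2r// KL.
Qed.

(** This is Tonelli's theorem. *)
Lemma integral_potential_le K h D (c : R) :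
  measurable_fun [set: BT] K -> (forall z, 0 <= K z) -> measurable_fun [set: LT] h ->
  measurable D -> 0 <= c ->
  (forall y : LT, h y != 0 ->
     (\int[lebesgue]_(x in D) (K ((x : Rn) - (y : Rn)))%:E <= c%:E)%E) ->
  (\int[lebesgue]_(x in D) potential K h x <=
   c%:E * \int[lebesgue]_y `|h y|%:E)%E.
Proof.
move=> mK K0 mh mD c0 Kc.
pose g (z : LT * LT) : \bar R :=
  (\1_D z.1 * (K ((z.1 : Rn) - (z.2 : Rn)) * `|h z.2|))%:E.
have mg : measurable_fun [set: LT * LT] g.
  apply/measurable_EFinP; apply: measurable_funM; last exact: measurable_pair.
  exact: measurableT_comp (measurable_indic mD) measurable_fst.
have g0 z : (0 <= g z)%E by rewrite lee_fin !mulr_ge0.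
have mh1 : measurable_fun [set: LT] (fun y : LT => `|h y|%:E).
  by apply/measurable_EFinP; exact: measurable_normr_fun.
have mKy (y : LT) : measurable_fun [set: LT] (fun x : LT => (K ((x : Rn) - (y : Rn)))%:E).
  apply/measurable_EFinP.
  exact: measurableT_comp mK (measurableT_comp measurable_borel_sub (measurable_pair2 y)).
have -> : (\int[lebesgue]_(x in D) potential K h x =
    \int[lebesgue]_x \int[lebesgue]_(y in [set: LT]) g (x, y))%E.
  rewrite integral_mkcond; apply: eq_integral => x _; rewrite patchE.
  case: ifPn => xD.
    by apply: eq_integral => y _; rewrite /g indicE /= xD mul1r.
  by apply/esym; apply: integral0_eq => y _; rewrite /g indicE /= (negbTE xD) mul0r.
rewrite (@fubini_tonelli _ _ LT LT R (lebesgue_sigma R n) (lebesgue_sigma R n) g mg g0).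
rewrite -ge0_integralZl_EFin//.
apply: ge0_le_integral.
- exact: measurableT.
- by move=> y _; apply: integral_ge0.
- exact: (@measurable_fun_fubini_tonelli_G _ _ LT LT R (lebesgue_sigma R n) g mg g0).
- exact: measurable_funeM.
move=> y _.
have -> : (\int[lebesgue]_x g (x, y) =
    `|h y|%:E * \int[lebesgue]_(x in D) (K ((x : Rn) - (y : Rn)))%:E)%E.
  rewrite [in RHS]integral_mkcond -ge0_integralZl_EFin; last 4 first.
  - exact: measurableT.
  - by move=> x _; rewrite patchE; case: ifPn => _; rewrite ?lee_fin.
  - by apply/(measurable_restrictT _ mD); exact: measurable_funTS.
  - by [].
  apply: eq_integral => x _; rewrite /g patchE indicE /=.
  by case: ifPn => xD; rewrite ?mul1r ?mul0r ?mule0// -EFinM mulrC.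
have [->|hy] := eqVneq (h y) 0; first by rewrite normr0 mul0e mule0.
by rewrite muleC lee_wpmul2r ?lee_fin// Kc.
Qed.

Lemma potential_bounded K h (M : R) (x : Rn) : measurable_fun [set: BT] K ->
  (forall z, 0 <= K z) -> measurable_fun [set: LT] h -> 0 <= M ->
  (forall z, K z <= M) ->
  (potential K h x <= M%:E * \int[lebesgue]_y `|h y|%:E)%E.
Proof.
move=> mK K0 mh M0 KM.
have mh1 : measurable_fun [set: LT] (fun y : LT => `|h y|%:E).
  by apply/measurable_EFinP; exact: measurable_normr_fun.
rewrite -ge0_integralZl_EFin//; apply: ge0_le_integral.
- exact: measurableT.
- by move=> y _; rewrite lee_fin mulr_ge0.
- exact: measurable_convolved.
- exact: measurable_funeM.
- by move=> y _; rewrite -EFinM lee_fin ler_wpM2r.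
Qed.

(** Jensen's inequality for the measure |h| dy, up to the factor 2 ^ q: integrating
    a <= L ^ (1 - q) a ^ q + L at a = K (x - y) bounds the potential for every L > 0,
    and one optimizes over L. The positive e keeps the optimal L positive. *)
Lemma potential_powR_le K h (q m e : R) (x : Rn) :
  measurable_fun [set: BT] K -> (forall z, 0 <= K z) -> measurable_fun [set: LT] h ->
  1 <= q -> 0 < m -> 0 < e ->
  (\int[lebesgue]_y `|h y|%:E <= m%:E)%E ->
  (potential K h x `^ q <=
   (2 `^ q * m `^ (q - 1))%:E * (potential (fun z => (K z `^ q)%R) h x + e%:E))%E.
Proof.
move=> mK K0 mh q1 m0 e0 hm.
have q0 : 0 < q by exact: lt_le_trans q1.
pose Kq : BT -> R := fun z => K z `^ q.
have Kq0 z : 0 <= Kq z by exact: powR_ge0.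
have mKq : measurable_fun [set: BT] Kq by exact: measurableT_comp (measurable_powR q) mK.
rewrite -/Kq; set J := potential Kq h x.
have J0 : (0 <= J)%E by exact: potential_ge0.
have c0 : 0 < 2 `^ q * m `^ (q - 1) by rewrite mulr_gt0 ?powR_gt0.
have mh1 : measurable_fun [set: LT] (fun y : LT => `|h y|%:E).
  by apply/measurable_EFinP; exact: measurable_normr_fun.
have key (L : R) : 0 < L -> (potential K h x <= (L `^ (1 - q))%:E * J + (L * m)%:E)%E.
  move=> L0.
  have mc := measurable_convolved x mKq mh.
  apply: (@le_trans _ _ ((L `^ (1 - q))%:E * J +
      L%:E * \int[lebesgue]_y `|h y|%:E)%E); last first.
    by rewrite leeD2l// EFinM lee_wpmul2l ?lee_fin ?(ltW L0).
  rewrite /J /potential -ge0_integralZl_EFin ?powR_ge0//; last first.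
    by move=> y _; rewrite lee_fin mulr_ge0.
  rewrite -ge0_integralZl_EFin ?(ltW L0)//.
  rewrite -ge0_integralD; last 5 first.
  - exact: measurableT.
  - by move=> y _; rewrite -EFinM lee_fin !mulr_ge0// powR_ge0.
  - exact: measurable_funeM.
  - by move=> y _; rewrite -EFinM lee_fin mulr_ge0// ltW.
  - exact: measurable_funeM.
  apply: ge0_le_integral.
  - exact: measurableT.
  - by move=> y _; rewrite lee_fin mulr_ge0.
  - exact: measurable_convolved.
  - by apply: emeasurable_funD; exact: measurable_funeM.
  - move=> y _; rewrite -!EFinM -EFinD lee_fin mulrA -mulrDl ler_wpM2r//.
    have [KL|LK] := leP (K (x - (y : Rn))) L.
      by rewrite (le_trans KL)// lerDr mulr_ge0 ?powR_ge0.
    rewrite -[leLHS]addr0 lerD ?(ltW L0)// /Kq.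
    have K0' : 0 < K (x - (y : Rn)) by exact: lt_trans LK.
    rewrite -(mulr_powRB1 (K0 _) q0) mulrCA ler_peMr//.
    rewrite -(opprB q 1) powRN mulrC ler_pdivlMr ?powR_gt0// mul1r.
    by rewrite ge0_ler_powR ?nnegrE ?subr_ge0 ?(ltW L0) ?(ltW LK)// ltW.
have [Jy|Jfin] := eqVneq J +oo%E.
  rewrite Jy addye// gt0_muley; last by rewrite lte_fin.
  exact: leey.
have Jr : J \is a fin_num by rewrite ge0_fin_numE// ltey.
pose j := fine J; have JE : J = j%:E by rewrite fineK.
have j0 : 0 <= j by rewrite fine_ge0.
have je : 0 < j + e by rewrite ltr_wpDl.
pose L := ((j + e) / m) `^ q^-1.
have L0 : 0 < L by rewrite powR_gt0// divr_gt0.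
have Lq : L `^ q = (j + e) / m.
  by rewrite -powRrM mulVf ?gt_eqF// powRr1// divr_ge0 ?ltW.
have := key L L0; rewrite JE -EFinM -!EFinD -EFinM => kL.
have {kL} : (potential K h x <= (2 * L * m)%:E)%E.
  apply: le_trans kL _; rewrite lee_fin -mulrA [leRHS]mulr_natl mulr2n lerD2r.
  have -> : L * m = L `^ (1 - q) * (j + e).
    have -> : j + e = L `^ q * m by rewrite Lq divfK// gt_eqF.
    by rewrite mulrA -powRD ?subrK ?powRr1 ?(ltW L0)// (gt_eqF L0) implybT.
  by rewrite ler_wpM2l ?powR_ge0// lerDl ltW.
move/(le_poweR (ltW q0) (potential_ge0 h x K0)).
move/le_trans; apply; rewrite poweR_EFin lee_fin powRM ?mulr_ge0 ?(ltW L0) ?(ltW m0)//.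
rewrite powRM ?(ltW L0)// Lq -!mulrA ler_wpM2l ?powR_ge0//.
by rewrite -(mulr_powRB1 (ltW m0) q0) mulKf ?gt_eqF// mulrC.
Qed.

End potentials.

(** * Convolution with one dyadic shell *)

Section real_powers.
Context {R : realType}.
Implicit Types x y a b : R.

Lemma powRDp x a b : 0 < x -> x `^ (a + b) = x `^ a * x `^ b.
Proof. by move=> x0; rewrite powRD// (gt_eqF x0) implybT. Qed.

Lemma powR_divl x y a : 0 < x -> 0 < y -> (x / y) `^ a = x `^ a / y `^ a.
Proof.
move=> x0 y0; rewrite powRM ?invr_ge0 ?ltW//; congr (_ * _).
by rewrite -(powR_inv1 (ltW y0)) -powRrM mulN1r powRN.
Qed.

Lemma le_powR_neg x y a : 0 < x -> x <= y -> a <= 0 -> y `^ a <= x `^ a.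
Proof.
move=> x0 xy a0; have y0 := lt_le_trans x0 xy.
rewrite -[a]opprK !(powRN _ (- a)) lef_pV2 ?posrE ?powR_gt0//.
by apply: ge0_ler_powR; rewrite ?nnegrE ?oppr_ge0 ?(ltW x0) ?(ltW y0).
Qed.

Lemma le_powR_pos x y a : 0 <= x -> x <= y -> 0 <= a -> x `^ a <= y `^ a.
Proof.
move=> x0 xy a0; apply: ge0_ler_powR => //; rewrite nnegrE//.
exact: le_trans xy.
Qed.

Lemma le_1D_powR x a : 0 <= x -> 1 <= a -> x <= 1 + x `^ a.
Proof.
move=> x0 a1; have [x1|x1] := leP x 1.
  by rewrite (le_trans x1)// lerDl powR_ge0.
by rewrite (le_trans (le1r_powR (ltW x1) a1))// lerDr.
Qed.

Lemma powR_lt1 x a : 0 <= x -> x < 1 -> 0 < a -> x `^ a < 1.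
Proof.
move=> x0 x1 a0; have := @gt0_ltr_powR R a a0 x 1; rewrite powR1.
by apply; rewrite ?nnegrE ?ler01.
Qed.

Lemma powR2_lt1 a : a < 0 -> 2 `^ a < 1.
Proof.
move=> a0; rewrite -[a]opprK powRN invf_lt1 ?powR_gt0//.
have := @gt0_ltr_powR R (- a) _ 1 2; rewrite powR1 oppr_gt0.
by apply; rewrite ?nnegrE ?ltr1n.
Qed.

Lemma le_expr2_bound x : 0 <= x -> x <= 2 ^+ Num.bound x.
Proof.
move=> x0; rewrite (le_trans (ltW (archi_boundP x0)))// -natrX ler_nat ltnW//.
exact: ltn_expl.
Qed.

Lemma exists_dyadic (x y : R) : 0 < x -> x <= y ->
  exists k : nat, 2 ^+ k * x <= y < 2 ^+ k.+1 * x.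
Proof.
move=> x0 xy; have ex : exists k : nat, y < 2 ^+ k * x.
  exists (Num.bound (y / x)).+1; rewrite -ltr_pdivrMr//.
  have q0 : 0 <= y / x by rewrite divr_ge0 ?(le_trans _ xy) ?ltW.
  apply: le_lt_trans (le_expr2_bound q0) _.
  by rewrite exprS ltr_pMl ?exprn_gt0// ltr1n.
case: (ex_minnP ex) => -[|k] yk ymin; first by rewrite expr0 mul1r ltNge xy in yk.
exists k; rewrite yk andbT leNgt; apply/negP => /ymin.
by rewrite ltnn.
Qed.

End real_powers.

Section shell_estimate.
Context {R : realType} {n : nat}.
Local Notation Rn := 'rV[R]_n.+1.
Local Notation LT := (lebesgueT R n).
Local Notation BT := (borelT R n).
Local Notation dR := (n.+1%:R : R).
Implicit Types (h : LT -> R) (x y z : Rn) (sh : Q_shape).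

Lemma ge0_integral_reflect x (D : set LT) (f : LT -> \bar R) : measurable D ->
  measurable_fun D f -> (forall y, D y -> 0 <= f y)%E ->
  (\int[lebesgue]_(y in [set y : LT | D (x - (y : Rn))%R]) f (x - (y : Rn))%R =
   \int[lebesgue]_(y in D) f y)%E.
Proof.
move=> mD mf f0.
have N1 : - 1 != 0 :> R by rewrite oppr_eq0 oner_eq0.
have := ge0_integral_affine x N1 mD mf f0.
rewrite normrN1 expr1n invr1 mul1e => <-.
have e y : x - y = - 1 *: y + x by rewrite scaleN1r addrC.
rewrite (_ : [set y : LT | _] = [set x0 : LT | D (- 1 *: (x0 : Rn) + x)]).
  by apply: eq_integral => y _; rewrite e.
by apply/seteqP; split => y /=; rewrite e.
Qed.

Lemma ge0_integral_translate x (D : set LT) (f : LT -> \bar R) : measurable D ->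
  measurable_fun D f -> (forall y, D y -> 0 <= f y)%E ->
  (\int[lebesgue]_(y in [set y : LT | D ((y : Rn) - x)%R]) f ((y : Rn) - x)%R =
   \int[lebesgue]_(y in D) f y)%E.
Proof.
move=> mD mf f0.
have := ge0_integral_affine (- x) (oner_neq0 R) mD mf f0.
rewrite normr1 expr1n invr1 mul1e => <-.
rewrite (_ : [set y : LT | _] = [set x0 : LT | D (1 *: (x0 : Rn) - x)]).
  by apply: eq_integral => y _; rewrite scale1r.
by apply/seteqP; split => y /=; rewrite scale1r.
Qed.

Lemma Q_sub_radius sh z (s r : R) : 0 < s -> 0 < r -> Q sh z s `<=` Q sh 0 r -> s <= r.
Proof.
move=> s0 r0 sub; have := le_lebesgue_outer sub.
rewrite -[lebesgue_outer (Q sh z s)]/(lebesgue (Q sh z s)).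
rewrite -[lebesgue_outer (Q sh 0 r)]/(lebesgue (Q sh 0 r)).
rewrite !lebesgue_Q// lee_fin ler_pM2l ?kappa_gt0//.
by rewrite ler_pXn2r ?nnegrE ?(ltW s0) ?(ltW r0).
Qed.

(** Seen from the small set Q (0, r), the points of the shell are at distance
    comparable to rho, so that |x - y| ^ (alpha - d) is constant there up to a factor.
    The powers of d come from comparing the Euclidean and the maximum norms. *)
Lemma shell_far sh x y (r rho : R) : Qnorm sh x < r -> rho <= Qnorm sh y < 2 * rho ->
  2 * dR * r <= rho -> rho / (2 * dR) <= enorm (x - y) < 3 * dR * rho.
Proof.
move=> xr /andP[ry yr] drho.
have d1 : 1 <= dR by rewrite ler1n.
have d0 : 0 < dR by [].
have x1 : `|x| < r by exact: le_lt_trans (norm_le_Qnorm sh x) xr.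
have r0 : 0 < r by exact: le_lt_trans x1.
have y1 : `|y| < 2 * rho by exact: le_lt_trans (norm_le_Qnorm sh y) yr.
have y2 : rho / dR <= `|y|.
  by rewrite ler_pdivrMr// mulrC (le_trans ry)// Qnorm_le_norm.
have rr : r <= rho / (2 * dR) by rewrite ler_pdivlMr ?mulr_gt0// mulrC.
have hh : rho / dR = rho / (2 * dR) + rho / (2 * dR) by field; rewrite gt_eqF.
apply/andP; split.
  apply: le_trans (norm_le_enorm _); rewrite distrC.
  have : `|y| - `|x| <= `|y - x| := lerB_dist y x.
  by move: hh y2 rr x1; move: (rho / dR) (rho / (2 * dR)) `|x| `|y| `|y - x| => *; lra.
apply: le_lt_trans (enorm_le_norm _) _; rewrite (mulrC 3) -mulrA ltr_pM2l//.
have rr2 : r <= rho.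
  by rewrite (le_trans _ drho)// ler_peMl ?(ltW r0)// mulr_ege1// ler1n.
have : `|x - y| <= `|x| + `|y| := ler_normB x y.
by move: x1 y1 rr2; move: `|x| `|y| `|x - y| => *; lra.
Qed.

Definition riesz_kernel (W : BT -> R) (alpha : R) : BT -> R :=
  fun z => W z / enorm (z : Rn) `^ (dR - alpha).

Lemma measurable_riesz_kernel W alpha : measurable_fun [set: BT] W ->
  measurable_fun [set: BT] (riesz_kernel W alpha).
Proof.
move=> mW; rewrite (_ : riesz_kernel W alpha =
    (fun z => W z * (Qnorm balls (z : Rn)) `^ (- (dR - alpha)))).
  apply: measurable_funM => //.
  exact: measurableT_comp (measurable_powR _) (measurable_Qnorm_borel balls).
by apply/funext => z; rewrite powRN.
Qed.

Lemma measurable_Q0_borel sh (s : R) : measurable (Q sh 0 s : set BT).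
Proof.
have := @measurable_Qnorm_borel R n sh measurableT _ (measurable_itv `]-oo, s[).
rewrite setTI; congr (measurable _).
by rewrite QE; apply/seteqP; split => y /=; rewrite in_itv /= subr0.
Qed.

Variables (W : BT -> R).
Hypotheses (mW : measurable_fun [set: BT] W) (W0 : forall z, 0 <= W z).
Variables (sh : Q_shape) (p : R).
Hypothesis p1 : 1 <= p.

Let p0 : 0 < p := lt_le_trans ltr01 p1.

(** The number b bounds, up to a constant, the p-mean of h over a shell of radius rho. *)
Definition shell_density (rho b : R) h : Prop := [/\ measurable_fun [set: LT] h,
  (forall y, h y != 0 -> rho <= Qnorm sh (y : Rn) < 2 * rho) &
  (\int[lebesgue]_y (`|h y| `^ p)%:E <= (b `^ p * rho ^+ n.+1)%:E)%E].

Let normalized_le (rho b : R) h : 0 < b -> shell_density rho b h ->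
  (\int[lebesgue]_y ((`|h y| / b) `^ p)%:E <= (rho ^+ n.+1)%:E)%E.
Proof.
move=> b0 [mh _ hp].
have e y : ((`|h y| / b) `^ p)%:E = ((b `^ p)^-1%:E * (`|h y| `^ p)%:E)%E.
  rewrite -EFinM powRM ?invr_ge0 ?(ltW b0)// mulrC; congr (_ * _)%:E.
  by rewrite -(powR_inv1 (ltW b0)) -powRrM mulN1r powRN.
under eq_integral do rewrite e.
rewrite ge0_integralZl_EFin; last 4 first.
- exact: measurableT.
- by move=> y _; rewrite lee_fin powR_ge0.
- exact: measurable_EFin_normr_powR.
- by rewrite invr_ge0 powR_ge0.
by rewrite lee_pdivrMl ?powR_gt0// -EFinM.
Qed.

Let measurable_normalized b h : measurable_fun [set: LT] h ->
  measurable_fun [set: LT] (fun y : LT => ((`|h y| / b) `^ p)%:E).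
Proof.
move=> mh; apply: measurable_EFin_powR; apply: measurable_funM.
  exact: measurable_normr_fun.
exact: measurable_cst.
Qed.

Let mQ (s' : Q_shape) z (s : R) : measurable (Q s' z s : set LT) := measurable_Q s' z s.

(** Integrate t <= 1 + t ^ p over the shell, at t = |h y| / b. *)
Lemma shell_L1_le (rho b : R) h : 0 < rho -> 0 < b -> shell_density rho b h ->
  (\int[lebesgue]_y `|h y|%:E <=
   ((kappa R n sh * 2 ^+ n.+1 + 1) * b * rho ^+ n.+1)%:E)%E.
Proof.
move=> rho0 b0 hh; have [mh hs _] := hh.
have r20 : 0 < 2 * rho by rewrite mulr_gt0.
have mi : measurable_fun [set: LT] (fun y : LT => (\1_(Q sh (0 : Rn) (2 * rho)) y)%:E : \bar R).
  by apply/measurable_EFinP; apply: measurable_indic; exact: mQ.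
have mn := measurable_normalized b mh.
have -> : ((kappa R n sh * 2 ^+ n.+1 + 1) * b * rho ^+ n.+1)%:E =
  (b%:E * ((kappa R n sh * (2 * rho) ^+ n.+1)%:E + (rho ^+ n.+1)%:E))%E.
  by rewrite -EFinD -EFinM exprMn; congr (_%:E); ring.
apply: (@le_trans _ _ (b%:E * \int[lebesgue]_y
   ((\1_(Q sh (0 : Rn) (2 * rho)) y)%:E + ((`|h y| / b) `^ p)%:E))%E).
  rewrite -ge0_integralZl_EFin; last 4 first.
  - exact: measurableT.
  - by move=> y _; rewrite -EFinD lee_fin addr_ge0// powR_ge0.
  - exact: emeasurable_funD.
  - exact: ltW.
  apply: ge0_le_integral.
  - exact: measurableT.
  - by move=> y _; rewrite lee_fin.
  - by apply/measurable_EFinP; exact: measurable_normr_fun.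
  - by apply: measurable_funeM; exact: emeasurable_funD.
  move=> y _; rewrite -EFinD -EFinM lee_fin.
  have [->|hy] := eqVneq (h y) 0.
    by rewrite normr0 mulr_ge0 ?(ltW b0)// addr_ge0 ?powR_ge0.
  rewrite indicE mem_set ?mulr1; last first.
    by rewrite QE /= subr0; have /andP[] := hs y hy.
  rewrite mulrC -ler_pdivrMr//; apply: le_1D_powR => //.
  by rewrite divr_ge0// ltW.
rewrite lee_wpmul2l ?lee_fin ?(ltW b0)//.
rewrite ge0_integralD; last 5 first.
- exact: measurableT.
- by move=> y _; rewrite lee_fin.
- exact: mi.
- by move=> y _; rewrite lee_fin powR_ge0.
- exact: mn.
apply: leeD; last exact: normalized_le.
rewrite integral_indic; [|exact: measurableT|exact: mQ].
by rewrite setIT lebesgue_Q.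
Qed.

(** Integrate Young's inequality u v <= u ^ e + v ^ p at u = W (x - y), v = |h y| / b.
    The normalization by b makes the two terms of the same order rho ^ d. *)
Lemma shell_convolution_young (e I : R) : 0 < e -> p^-1 + e^-1 = 1 -> 0 < I -> moment_bound W e I ->
  exists2 C : R, 0 < C & forall (r rho b : R) h x, 0 < r -> 0 < b ->
    2 * dR * r <= rho -> Qnorm sh x < r -> shell_density rho b h ->
    (potential W h x <= (C * b * rho ^+ n.+1)%:E)%E.
Proof.
move=> e0 pe I0 WI.
exists (I * (3 * dR) ^+ n.+1 + 1); first by rewrite ltr_wpDl// mulr_ge0 ?exprn_ge0 ?mulr_ge0 ?(ltW I0).
move=> r rho b h x r0 b0 drho xr hh; have [mh hs _] := hh.
have rho0 : 0 < rho by rewrite (lt_le_trans _ drho)// !mulr_gt0.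
have rr0 : 0 < 3 * dR * rho by rewrite !mulr_gt0.
pose D : set LT := [set y : LT | Q balls 0 (3 * dR * rho) (x - (y : Rn))].
have mWe : measurable_fun [set: BT] (fun z => (W z `^ e)%:E) by exact: measurable_EFin_powR.
have mWx : measurable_fun [set: LT] (fun y : LT => (W (x - (y : Rn)) `^ e)%:E).
  exact: measurableT_comp mWe (measurable_borel_subr x).
have mD : measurable D.
  have := measurable_borel_subr x measurableT (measurable_Q0_borel balls (3 * dR * rho)).
  by rewrite setTI.
have mi : measurable_fun [set: LT]
    (fun y : LT => (\1_D y * W (x - (y : Rn)) `^ e)%:E : \bar R).
  apply/measurable_EFinP; apply: measurable_funM; first exact: measurable_indic.
  by apply/measurable_EFinP.
have mn := measurable_normalized b mh.
have -> : ((I * (3 * dR) ^+ n.+1 + 1) * b * rho ^+ n.+1)%:E =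
    (b%:E * ((I * (3 * dR * rho) ^+ n.+1)%:E + (rho ^+ n.+1)%:E))%E.
  have -> : (3 * dR * rho) ^+ n.+1 = (3 * dR) ^+ n.+1 * rho ^+ n.+1 by rewrite exprMn.
  rewrite -EFinD -EFinM; congr (_%:E).
  by move: ((3 * dR) ^+ n.+1) (rho ^+ n.+1) => u v; ring.
apply: (@le_trans _ _ (b%:E * \int[lebesgue]_y
   ((\1_D y * W (x - (y : Rn)) `^ e)%:E + ((`|h y| / b) `^ p)%:E))%E).
  rewrite -ge0_integralZl_EFin; last 4 first.
  - exact: measurableT.
  - by move=> y _; rewrite -EFinD lee_fin addr_ge0 ?mulr_ge0 ?powR_ge0.
  - exact: emeasurable_funD.
  - exact: ltW.
  apply: ge0_le_integral.
  - exact: measurableT.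
  - by move=> y _; rewrite lee_fin mulr_ge0.
  - exact: measurable_convolved.
  - by apply: measurable_funeM; exact: emeasurable_funD.
  move=> y _; rewrite -EFinD -EFinM lee_fin.
  have [->|hy] := eqVneq (h y) 0.
    by rewrite normr0 mulr0 mulr_ge0 ?(ltW b0)// addr_ge0 ?mulr_ge0 ?powR_ge0.
  rewrite indicE mem_set ?mul1r; last first.
    rewrite /D QE /= subr0.
    by have /andP[] := shell_far xr (hs y hy) drho.
  have -> : W (x - (y : Rn)) * `|h y| = b * ((`|h y| / b) * W (x - (y : Rn))).
    by rewrite mulrA (mulrCA b) divff ?gt_eqF// mulr1 mulrC.
  rewrite ler_pM2l//.
  have u0 : 0 <= `|h y| / b by rewrite divr_ge0// ltW.
  apply: (le_trans (conjugate_powR u0 (W0 _) p0 e0 pe)); rewrite addrC.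
  have e1 : e^-1 <= 1 by rewrite -pe lerDr invr_ge0 ltW.
  have pV1 : p^-1 <= 1 by rewrite -pe lerDl invr_ge0 ltW.
  by rewrite lerD// ler_piMr ?powR_ge0.
rewrite lee_wpmul2l ?lee_fin ?(ltW b0)//.
rewrite ge0_integralD; last 5 first.
- exact: measurableT.
- by move=> y _; rewrite lee_fin mulr_ge0 ?powR_ge0.
- exact: mi.
- by move=> y _; rewrite lee_fin powR_ge0.
- exact: mn.
apply: leeD; last exact: normalized_le hh.
have -> : (\int[lebesgue]_y (\1_D y * W (x - (y : Rn)) `^ e)%:E =
    \int[lebesgue]_(y in D) (W (x - (y : Rn)) `^ e)%:E)%E.
  rewrite [RHS]integral_mkcond; apply: eq_integral => y _.
  by rewrite patchE indicE; case: ifPn => _; rewrite ?mul1r ?mul0r.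
have mWq : measurable_fun (Q balls (0 : Rn) (3 * dR * rho) : set LT)
    (fun z : LT => (W z `^ e)%:E).
  by apply: measurable_funTS; exact: measurableT_comp mWe borel_lebesgue.
have := @ge0_integral_reflect x _ _ (mQ balls 0 (3 * dR * rho)) mWq
  (fun y _ => powR_ge0 _ _).
by move=> ->; exact: WI.
Qed.

Lemma shell_convolution_bounded (M : R) : 0 < M -> (forall z, W z <= M) ->
  exists2 C : R, 0 < C & forall (rho b : R) h x, 0 < rho -> 0 < b ->
    shell_density rho b h -> (potential W h x <= (C * b * rho ^+ n.+1)%:E)%E.
Proof.
move=> M0 WM.
have k0 := @kappa_gt0 R n sh.
exists (M * (kappa R n sh * 2 ^+ n.+1 + 1)).
  by rewrite mulr_gt0// ltr_wpDl// mulr_ge0 ?exprn_ge0 ?(ltW k0).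
move=> rho b h x rho0 b0 hh; have [mh _ _] := hh.
apply: (le_trans (potential_bounded x mW W0 mh (ltW M0) WM)).
rewrite -!mulrA EFinM lee_wpmul2l ?lee_fin ?(ltW M0)// !mulrA.
exact: shell_L1_le.
Qed.

(** Jensen's inequality moves the power q inside the convolution, Tonelli's theorem
    then reduces the integral in x to the q-th moment of W over translates of
    Q (z, s), and a ^ q <= L ^ q (1 + (a / L) ^ v) with L = (rho / s) ^ (d / v)
    reduces it to the v-th moment over a ball of radius comparable to rho. *)
Lemma shell_convolution_tonelli (q v I : R) : 1 <= q -> q <= v -> 0 < I -> moment_bound W v I ->
  exists2 C : R, 0 < C & forall (r rho b s : R) h z, 0 < r -> 0 < b -> 0 < s ->
    2 * dR * r <= rho -> Q sh z s `<=` Q sh 0 r -> shell_density rho b h ->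
    (\int[lebesgue]_(x in (Q sh z s : set LT)) (potential W h x `^ q) <=
     ((C * b * rho ^+ n.+1 * (rho / s) `^ (dR / v)) `^ q * s ^+ n.+1)%:E)%E.
Proof.
move=> q1 qv I0 WI.
have k0 := @kappa_gt0 R n sh.
have q0 : 0 < q := lt_le_trans ltr01 q1.
have v0 : 0 < v := lt_le_trans q0 qv.
pose c1 := kappa R n sh * 2 ^+ n.+1 + 1.
have c10 : 0 < c1 by rewrite ltr_wpDl// mulr_ge0 ?exprn_ge0 ?(ltW k0).
pose c2 := kappa R n sh + I * (3 * dR) ^+ n.+1.
have c20 : 0 < c2 by rewrite ltr_pwDl// mulr_ge0 ?exprn_ge0 ?mulr_ge0// ltW.
pose c3 := c2 + kappa R n sh.
have c30 : 0 < c3 by rewrite addr_gt0.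
exists (2 * c1 * c3 `^ q^-1); first by rewrite !mulr_gt0 ?powR_gt0.
move=> r rho b s h z r0 b0 s0 drho sub hh; have [mh hs _] := hh.
have rho0 : 0 < rho by rewrite (lt_le_trans _ drho)// !mulr_gt0.
have rs0 : 0 < rho / s by rewrite divr_gt0.
have rr0 : 0 < 3 * dR * rho by rewrite !mulr_gt0.
pose m0 := c1 * b * rho ^+ n.+1.
have m00 : 0 < m0 by rewrite !mulr_gt0// exprn_gt0.
pose L := (rho / s) `^ (dR / v).
have L0 : 0 < L by rewrite powR_gt0.
have Lv : L `^ v = (rho / s) ^+ n.+1.
  by rewrite -powRrM divfK ?gt_eqF// powR_mulrn// ltW.
have hm : (\int[lebesgue]_y `|h y|%:E <= m0%:E)%E by exact: shell_L1_le.
(* eps has the order of the mean of potential Wq h over Q (z, s), so it is harmless *)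
pose eps := m0 * L `^ q.
have eps0 : 0 < eps by rewrite mulr_gt0 ?powR_gt0.
pose Wq : BT -> R := fun t => W t `^ q.
have Wq0 t : 0 <= Wq t by exact: powR_ge0.
have mWq : measurable_fun [set: BT] Wq by exact: measurableT_comp (measurable_powR q) mW.
have mD := mQ sh z s.
have mPq := measurable_potential mWq Wq0 mh.
have mP := measurable_potential mW W0 mh.
(* in w ^ q <= L ^ q + L ^ (q - v) w ^ v both terms have integrals of order L ^ q s ^ d *)
have inner (y : LT) : h y != 0 ->
    (\int[lebesgue]_(x in (Q sh z s : set LT)) (Wq ((x : Rn) - (y : Rn)))%:E <=
     (c2 * L `^ q * s ^+ n.+1)%:E)%E.
  move=> hy.
  have mv : measurable_fun [set: LT] (fun x : LT => (W ((x : Rn) - (y : Rn)) `^ v)%:E).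
    apply: measurable_EFin_powR.
    exact: measurableT_comp mW (measurableT_comp measurable_borel_sub (measurable_pair2 y)).
  have mq : measurable_fun [set: LT] (fun x : LT => (Wq ((x : Rn) - (y : Rn)))%:E).
    apply: measurable_EFin_powR.
    exact: measurableT_comp mW (measurableT_comp measurable_borel_sub (measurable_pair2 y)).
  apply: (@le_trans _ _ (\int[lebesgue]_(x in (Q sh z s : set LT))
      (cst (L `^ q)%:E x + (L `^ q / L `^ v)%:E * (W ((x : Rn) - (y : Rn)) `^ v)%:E))%E).
    apply: ge0_le_integral.
    - exact: mD.
    - by move=> x _; rewrite lee_fin.
    - exact: measurable_funTS.
    - apply: emeasurable_funD; first exact: measurable_cst.
      by apply: measurable_funeM; exact: measurable_funTS.
    move=> x _; rewrite -EFinM -EFinD lee_fin /Wq.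
    set w := W _; have w0 : 0 <= w by exact: W0.
    have [wL|Lw] := leP w L.
      rewrite (le_trans (le_powR_pos w0 wL (ltW q0)))// lerDl.
      by rewrite mulr_ge0 ?divr_ge0 ?powR_ge0.
    rewrite -[leLHS]add0r lerD ?powR_ge0// mulrAC ler_pdivlMr ?powR_gt0//.
    have w1 : 0 < w by exact: lt_trans Lw.
    have -> : L `^ v = L `^ (v - q) * L `^ q by rewrite -powRDp// subrK.
    have -> : w `^ v = w `^ (v - q) * w `^ q by rewrite -powRDp// subrK.
    have Lw' : L `^ (v - q) <= w `^ (v - q).
      by apply: le_powR_pos; rewrite ?subr_ge0// ltW.
    have -> : w `^ q * (L `^ (v - q) * L `^ q) = L `^ (v - q) * (L `^ q * w `^ q) by ring.
    have -> : L `^ q * (w `^ (v - q) * w `^ q) = w `^ (v - q) * (L `^ q * w `^ q) by ring.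
    by rewrite ler_wpM2r// mulr_ge0 ?powR_ge0.
  rewrite ge0_integralD; last 5 first.
  - exact: mD.
  - by move=> x _; rewrite lee_fin powR_ge0.
  - exact: measurable_cst.
  - by move=> x _; rewrite -EFinM lee_fin mulr_ge0 ?divr_ge0 ?powR_ge0.
  - by apply: measurable_funeM; exact: measurable_funTS.
  rewrite integral_cst; last exact: mD.
  rewrite lebesgue_Q//.
  rewrite ge0_integralZl_EFin; last 4 first.
  - exact: mD.
  - by move=> x _; rewrite lee_fin powR_ge0.
  - exact: measurable_funTS.
  - by rewrite divr_ge0 ?powR_ge0.
  pose E : set LT := [set x : LT | Q balls 0 (3 * dR * rho) ((x : Rn) - (y : Rn))].
  have mE : measurable E.
    have := (measurableT_comp measurable_borel_sub (measurable_pair2 y)) measurableT _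
      (measurable_Q0_borel balls (3 * dR * rho)).
    by rewrite setTI.
  have DE : (Q sh z s : set LT) `<=` E.
    move=> x /sub; rewrite QE /= subr0 => xr; rewrite /E QE /= subr0.
    by have /andP[] := shell_far xr (hs y hy) drho.
  have bd : (\int[lebesgue]_(x in (Q sh z s : set LT)) (W ((x : Rn) - (y : Rn)) `^ v)%:E <=
      (I * (3 * dR * rho) ^+ n.+1)%:E)%E.
    apply: (@le_trans _ _ (\int[lebesgue]_(x in E) (W ((x : Rn) - (y : Rn)) `^ v)%:E)%E).
      apply: ge0_subset_integral; [exact: mD|exact: mE|exact: measurable_funTS| |exact: DE].
      by move=> x _; rewrite lee_fin powR_ge0.
    have mWq' : measurable_fun (Q balls (0 : Rn) (3 * dR * rho) : set LT)
        (fun z : LT => (W z `^ v)%:E).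
      by apply: measurable_funTS; apply: measurable_EFin_powR; exact: measurableT_comp mW borel_lebesgue.
    have := @ge0_integral_translate (y : Rn) _ _ (mQ balls 0 (3 * dR * rho)) mWq'
      (fun y _ => powR_ge0 _ _).
    by move=> ->; exact: WI.
  apply: le_trans (leeD (le_refl _) (lee_wpmul2l _ bd)) _.
    by rewrite lee_fin divr_ge0 ?powR_ge0.
  rewrite -!EFinM -EFinD lee_fin Lv expr_div_n.
  have -> : (3 * dR * rho) ^+ n.+1 = (3 * dR) ^+ n.+1 * rho ^+ n.+1 by rewrite exprMn.
  rewrite /c2 le_eqVlt; apply/orP; left; apply/eqP.
  have : s ^+ n.+1 != 0 by rewrite expf_neq0// gt_eqF.
  have : rho ^+ n.+1 != 0 by rewrite expf_neq0// gt_eqF.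
  by move: (s ^+ n.+1) (rho ^+ n.+1) ((3 * dR) ^+ n.+1) => u u' u'' *; field; apply/andP; split.
have hc : 0 <= 2 `^ q * m0 `^ (q - 1) by rewrite mulr_ge0 ?powR_ge0.
apply: (@le_trans _ _ (\int[lebesgue]_(x in (Q sh z s : set LT))
   ((2 `^ q * m0 `^ (q - 1))%:E * (potential Wq h x + cst eps%:E x)))%E).
  apply: ge0_le_integral.
  - exact: mD.
  - by move=> x _; exact: poweR_ge0.
  - apply: measurable_funTS.
    exact: measurableT_comp (measurable_poweR q) mP.
  - apply: measurable_funeM; apply: emeasurable_funD; last exact: measurable_cst.
    exact: measurable_funTS.
  - by move=> x _; exact: potential_powR_le.
rewrite ge0_integralZl_EFin; last 4 first.
- exact: mD.
- by move=> x _; rewrite adde_ge0 ?potential_ge0// lee_fin ltW.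
- by apply: emeasurable_funD; [exact: measurable_funTS|exact: measurable_cst].
- exact: hc.
rewrite ge0_integralD; last 5 first.
- exact: mD.
- by move=> x _; exact: potential_ge0.
- exact: measurable_funTS.
- by move=> x _; rewrite lee_fin ltW.
- exact: measurable_cst.
rewrite integral_cst; last exact: mD.
rewrite lebesgue_Q//.
have c2s0 : 0 <= c2 * L `^ q * s ^+ n.+1.
  by rewrite !mulr_ge0 ?powR_ge0 ?exprn_ge0 ?(ltW c20) ?(ltW s0).
have b1 : (\int[lebesgue]_(x in (Q sh z s : set LT)) potential Wq h x <=
    (c2 * L `^ q * s ^+ n.+1 * m0)%:E)%E.
  apply: (le_trans (integral_potential_le mWq Wq0 mh mD c2s0 inner)).
  by rewrite [leRHS]EFinM lee_wpmul2l ?lee_fin.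
apply: (@le_trans _ _ ((2 `^ q * m0 `^ (q - 1))%:E *
   ((c2 * L `^ q * s ^+ n.+1 * m0)%:E + eps%:E * (kappa R n sh * s ^+ n.+1)%:E))%E).
  by rewrite lee_wpmul2l ?lee_fin// leeD2r.
rewrite -[X in (_ + X)%E]EFinM -EFinD -EFinM lee_fin le_eqVlt; apply/orP; left.
apply/eqP; have -> : 2 * c1 * c3 `^ q^-1 * b * rho ^+ n.+1 * (rho / s) `^ (dR / v) =
    2 * m0 * (c3 `^ q^-1 * L) by rewrite /m0 -/L; ring.
have PM (t u w : R) : 0 <= t -> 0 <= u -> 0 <= w ->
    (2 * t * (u * w)) `^ q = 2 `^ q * t `^ q * (u `^ q * w `^ q).
  by move=> t0 u0 w0; rewrite !powRM ?mulr_ge0.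
rewrite (PM _ _ _ (ltW m00) (powR_ge0 _ _) (ltW L0)).
rewrite -powRrM mulVf ?gt_eqF// powRr1 ?(ltW c30)//.
by rewrite -(mulr_powRB1 (ltW m00) q0) /eps /c3; ring.
Qed.

End shell_estimate.

(** * Sums of dyadic pieces *)

Section nneseries_powers.
Context {R : realType}.
Local Open Scope ereal_scope.
Implicit Types (u : nat -> \bar R).

Lemma nneseries_term_le u (j : nat) : (forall i, 0 <= u i) -> u j <= \sum_(i <oo) u i.
Proof.
move=> u0; have := @nneseries_lim_ge R u xpredT 0 j.+1 (fun i _ _ => u0 i).
by apply: le_trans; rewrite big_nat_recr//= leeDr// sume_ge0.
Qed.

Lemma nneseries_le_partial u (M : \bar R) : (forall i, 0 <= u i) ->
  (forall k, \sum_(0 <= i < k) u i <= M) -> \sum_(i <oo) u i <= M.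
Proof.
move=> u0 uM; apply: lime_le; first by apply: is_cvg_nneseries => i _ _; exact: u0.
by apply: nearW => k; exact: uM.
Qed.

Lemma nneseries_geometric_le (a : R) : (0 < a < 1)%R ->
  \sum_(j <oo) (a ^+ j)%:E <= ((1 - a)^-1)%:E.
Proof.
move=> /andP[a0 a1]; have a10 : (0 < 1 - a)%R by rewrite subr_gt0.
apply: nneseries_le_partial => [i|k]; first by rewrite lee_fin exprn_ge0// ltW.
rewrite sumEFin lee_fin -[leRHS]mul1r ler_pdivlMr//.
suff -> : ((\sum_(0 <= i < k) a ^+ i) * (1 - a) = 1 - a ^+ k)%R.
  by rewrite gerBl exprn_ge0// ltW.
elim: k => [|k IH]; first by rewrite big_nil mul0r expr0 subrr.
by rewrite big_nat_recr//= mulrDl IH exprS; ring.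
Qed.

(** Each term u j is at most a ^ j times the power 1 / q of the series on the right,
    and the series of the a ^ j converges. This takes the place of the triangle
    inequality in L^q for sums that decay geometrically. *)
Lemma poweR_nneseries_le u (a q : R) : (0 < a < 1)%R -> (0 < q)%R ->
  (forall i, 0 <= u i) ->
  (\sum_(j <oo) u j) `^ q <=
  (((1 - a)^-1) `^ q)%:E * \sum_(j <oo) ((a ^- j)%:E * u j) `^ q.
Proof.
move=> a01 q0 u0; have /andP[a0 a1] := a01.
have a10 : (0 < (1 - a)^-1)%R by rewrite invr_gt0 subr_gt0.
have aj0 j : (0 < a ^- j)%R by rewrite invr_gt0 exprn_gt0.
set v := fun j => ((a ^- j)%:E * u j) `^ q.
have v0 j : 0 <= v j by exact: poweR_ge0.
set S := \sum_(j <oo) v j.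
have S0 : 0 <= S by exact: nneseries_ge0.
have uS j : u j <= S `^ q^-1 * (a ^+ j)%:E.
  have : v j `^ q^-1 <= S `^ q^-1.
    by apply: le_poweR => //; [rewrite invr_ge0 ltW|exact: nneseries_term_le].
  rewrite /v -poweRrM divff ?gt_eqF// poweRe1 ?mule_ge0 ?lee_fin ?(ltW (aj0 _))//.
  by rewrite lee_pdivrMl ?exprn_gt0// muleC.
have : \sum_(j <oo) u j <= S `^ q^-1 * ((1 - a)^-1)%:E.
  apply: le_trans (lee_nneseries _ (fun j _ => uS j)) _ => //.
  have [Sy|Sfin] := eqVneq S +oo.
    by rewrite Sy poweRyr ?invr_eq0 ?gt_eqF// gt0_mulye ?lte_fin// leey.
  have Sf : S `^ q^-1 \is a fin_num by rewrite fin_num_poweR// ge0_fin_numE// ltey.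
  rewrite -(fineK Sf) nneseriesZl; last first.
    by move=> j _; rewrite lee_fin exprn_ge0// ltW.
  by rewrite lee_wpmul2l ?nneseries_geometric_le// lee_fin fine_ge0// poweR_ge0.
move/(le_poweR (ltW q0) (nneseries_ge0 (fun j _ _ => u0 j))) => /le_trans; apply.
rewrite poweRM ?poweR_ge0 ?lee_fin ?(ltW a10)// -poweRrM mulVf ?gt_eqF//.
by rewrite poweRe1// poweR_EFin muleC.
Qed.

(** Of the decay a ^ (2 j), one factor a ^ j is spent on the sum inside the power and
    the other one makes the sum of the integrals converge. *)
Lemma integral_poweR_nneseries_le d (T : measurableType d)
    (mu : {measure set T -> \bar R}) (D : set T) (f : nat -> T -> \bar R)
    (a q A V : R) : (0 < a < 1)%R -> (0 < q)%R -> (0 <= A)%R -> (0 <= V)%R ->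
  measurable D -> (forall j, measurable_fun D (f j)) -> (forall j x, 0 <= f j x) ->
  (forall j, \int[mu]_(x in D) (f j x `^ q) <=
     ((A * a ^+ j.*2) `^ q * V)%:E) ->
  \int[mu]_(x in D) ((\sum_(j <oo) f j x) `^ q) <=
    (((1 - a)^-1 * (1 - a `^ q)^-1 `^ q^-1 * A) `^ q * V)%:E.
Proof.
move=> a01 q0 A0 V0 mD mf f0 fj; have /andP[a0 a1] := a01.
have a10 : (0 < (1 - a)^-1)%R by rewrite invr_gt0 subr_gt0.
have aj0 j : (0 < a ^- j)%R by rewrite invr_gt0 exprn_gt0.
have aq01 : (0 < a `^ q < 1)%R.
  rewrite powR_gt0//= -(powRr0 a) /powR gt_eqF// ltr_expR mul0r.
  by rewrite pmulr_rlt0// ln_lt0.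
have mS : measurable_fun D (fun x => \sum_(j <oo) f j x).
  by apply: ge0_emeasurable_sum => [j x _ _|j _]; [exact: f0|exact: mf].
have mg j : measurable_fun D (fun x => ((a ^- j)%:E * f j x) `^ q).
  apply: (measurableT_comp (measurable_poweR q)); exact: measurable_funeM.
apply: (@le_trans _ _ (\int[mu]_(x in D) ((((1 - a)^-1) `^ q)%:E *
    \sum_(j <oo) ((a ^- j)%:E * f j x) `^ q))).
  apply: ge0_le_integral.
  - exact: mD.
  - by move=> x _; exact: poweR_ge0.
  - exact: measurableT_comp (measurable_poweR q) mS.
  - apply: measurable_funeM; apply: ge0_emeasurable_sum => [j x _ _|j _].
      exact: poweR_ge0.
    exact: mg.
  - by move=> x _; exact: poweR_nneseries_le.
rewrite ge0_integralZl_EFin; last 4 first.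
- exact: mD.
- by move=> x _; apply: nneseries_ge0 => j _ _; exact: poweR_ge0.
- apply: ge0_emeasurable_sum => [j x _ _|j _]; first exact: poweR_ge0.
  exact: mg.
- exact: powR_ge0.
rewrite integral_nneseries; [|exact: mD|exact: mg|by move=> *; exact: poweR_ge0].
have term j : \int[mu]_(x in D) ((a ^- j)%:E * f j x) `^ q <=
    (A `^ q * V)%:E * ((a `^ q) ^+ j)%:E.
  have -> : \int[mu]_(x in D) ((a ^- j)%:E * f j x) `^ q =
      \int[mu]_(x in D) (((a ^- j) `^ q)%:E * (f j x `^ q)).
    apply: eq_integral => x _; rewrite poweRM ?poweR_EFin// lee_fin.
    exact: ltW.
  rewrite ge0_integralZl_EFin; last 4 first.
  - exact: mD.
  - by move=> x _; exact: poweR_ge0.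
  - exact: measurableT_comp (measurable_poweR q) (mf j).
  - exact: powR_ge0.
  apply: (le_trans (lee_wpmul2l _ (fj j))); first by rewrite lee_fin powR_ge0.
  have ja0 : (0 <= a ^+ j)%R by rewrite exprn_ge0// ltW.
  rewrite -!EFinM lee_fin le_eqVlt; apply/orP; left; apply/eqP.
  rewrite -addnn exprD powRM ?mulr_ge0// powRM//.
  have -> : ((a `^ q) ^+ j = (a ^+ j) `^ q)%R.
    rewrite -(powR_mulrn j (powR_ge0 a q)) -(powR_mulrn j (ltW a0)).
    exact: powRAC.
  have e : ((a ^- j) `^ q * (a ^+ j) `^ q = 1)%R.
    rewrite -powRM ?(ltW (aj0 _))// mulVf ?powR1//.
    by rewrite expf_neq0// gt_eqF.
  move: e; move: ((a ^- j) `^ q)%R ((a ^+ j) `^ q)%R (A `^ q)%R => X Y Z e.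
  have -> : (X * (Z * (Y * Y) * V) = (X * Y) * (Z * V * Y))%R by ring.
  by rewrite e mul1r.
apply: (@le_trans _ _ ((((1 - a)^-1) `^ q)%:E * ((A `^ q * V)%:E * ((1 - a `^ q)^-1)%:E))).
  rewrite lee_wpmul2l ?lee_fin ?powR_ge0//.
  apply: (le_trans (lee_nneseries _ (fun j _ => term j))).
    by move=> j _ _; apply: integral_ge0 => x _; exact: poweR_ge0.
  rewrite nneseriesZl; last by move=> j _; rewrite lee_fin exprn_ge0// powR_ge0.
  by rewrite lee_wpmul2l ?nneseries_geometric_le// lee_fin mulr_ge0// powR_ge0.
have q10 : (0 < (1 - a `^ q)^-1)%R by have /andP[_ h] := aq01; rewrite invr_gt0 subr_gt0.
rewrite -!EFinM lee_fin !powRM ?mulr_ge0 ?powR_ge0 ?(ltW a10)//.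
rewrite -(powRrM _ q^-1 q) mulVf ?gt_eqF// powRr1 ?(ltW q10)//.
by rewrite le_eqVlt; apply/orP; left; apply/eqP; ring.
Qed.

End nneseries_powers.

(** * The tail of the potential *)

Lemma powR_expn (R : realType) (x c : R) (k : nat) : (x `^ c) ^+ k = x `^ (c * k%:R).
Proof. by rewrite powRrM powR_mulrn// powR_ge0. Qed.

Section tail_estimate.
Context {R : realType} {n : nat}.
Local Notation Rn := 'rV[R]_n.+1.
Local Notation LT := (lebesgueT R n).
Local Notation BT := (borelT R n).
Local Notation dR := (n.+1%:R : R).
Implicit Types (f h : LT -> R) (x y z : Rn) (sh : Q_shape).

Lemma riesz_potential_le (W : BT -> R) (alpha : R) sh p (r rho b : R) h x :
  measurable_fun [set: BT] W -> (forall z, 0 <= W z) -> alpha < dR ->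
  0 < r -> 2 * dR * r <= rho -> Qnorm sh x < r -> shell_density sh p rho b h ->
  (potential (riesz_kernel W alpha) h x <=
   ((rho / (2 * dR)) `^ (alpha - dR))%:E * potential W h x)%E.
Proof.
move=> mW W0 ad r0 drho xr [mh hs _].
have rho0 : 0 < rho by rewrite (lt_le_trans _ drho)// !mulr_gt0.
have q0 : 0 < rho / (2 * dR) by rewrite divr_gt0// mulr_gt0.
apply: potential_le => //.
- exact: measurable_riesz_kernel.
- by move=> z; rewrite divr_ge0// powR_ge0.
- exact: powR_ge0.
move=> y hy; rewrite /riesz_kernel mulrC ler_wpM2r// -powRN opprB.
have /andP[far _] := shell_far xr (hs y hy) drho.
by apply: le_powR_neg => //; rewrite subr_le0 ltW.
Qed.

Variables (pt : \bar R) (W : BT -> R) (sh : Q_shape).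
Variables (p q lambda mu sigma alpha : R).
Hypotheses (pW : profile pt W) (p1 : 1 <= p) (q1 : 1 <= q) (mu0 : mu < 0).
Hypotheses (sigma0 : 0 < sigma) (alphad : 0 <= alpha < dR) (pt1 : (1 <= pt)%E).
Hypothesis cond :
  [/\ mu = lambda + alpha, (hoelder_conjugate p%:E <= pt)%E &
      sigma + lambda + alpha < 0] \/
  [/\ mu = lambda + alpha, (q%:E <= pt)%E &
      (sigma%:E + lambda%:E + n.+1%:R%:E / pt + alpha%:E < 0)%E].

Local Notation K := (riesz_kernel W alpha).

Let mW : measurable_fun [set: BT] W. Proof. by case: pW. Qed.
Let W0 z : 0 <= W z. Proof. by case: pW. Qed.
Let q0 : 0 < q := lt_le_trans ltr01 q1.
Let ad : alpha < dR. Proof. by have /andP[] := alphad. Qed.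
Let mlambda : mu = lambda + alpha. Proof. by case: cond => -[]. Qed.

Lemma measurable_riesz_potential h : measurable_fun [set: LT] h ->
  measurable_fun [set: LT] (potential K h).
Proof.
move=> mh; apply: measurable_potential => //; first exact: measurable_riesz_kernel.
by move=> z; rewrite divr_ge0// powR_ge0.
Qed.

Lemma riesz_potential_ge0 h x : (0 <= potential K h x)%E.
Proof. by apply: potential_ge0 => z; rewrite divr_ge0// powR_ge0. Qed.

(** The exponent beta is the rate at which the contribution of a shell decays with the
    ratio of its radius to the radius of the set where it is observed. *)
Definition shell_bound (beta : R) : Prop := exists2 C : R, 0 < C &
  forall (r rho B s : R) h z, 0 < r -> 0 < s -> 0 < B -> 2 * dR * r <= rho ->
    Q sh z s `<=` Q sh 0 r -> shell_density sh p rho (B * rho `^ lambda) h ->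
    (\int[lebesgue]_(x in (Q sh z s : set LT)) (potential K h x `^ q) <=
     ((C * (rho / r) `^ beta * B * s `^ mu) `^ q * s ^+ n.+1)%:E)%E.

(** The kernel, the density and the volume of the shell contribute the exponents
    alpha - d, lambda and d, whose sum is mu. *)
Let scale_mu (rho B : R) : 0 < rho ->
  (rho / (2 * dR)) `^ (alpha - dR) * (B * rho `^ lambda) * rho ^+ n.+1 =
  (2 * dR) `^ (dR - alpha) * B * rho `^ mu.
Proof.
move=> rho0; have d0 : 0 < 2 * dR by rewrite mulr_gt0.
have -> : (2 * dR) `^ (dR - alpha) = ((2 * dR) `^ (alpha - dR))^-1.
  by rewrite -powRN opprB.
rewrite powR_divl// -(powR_mulrn n.+1 (ltW rho0)) mlambda.
have -> : rho `^ (lambda + alpha) = rho `^ (alpha - dR) * rho `^ lambda * rho `^ dR.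
  by rewrite -!powRDp//; congr (_ `^ _); ring.
by ring.
Qed.

(** A pointwise bound by rho ^ mu suffices: rho ^ mu <= (rho / r) ^ mu s ^ mu, since
    s <= r and mu < 0. *)
Let bounded_case : (exists2 C : R, 0 < C & forall (r rho b : R) h x, 0 < r -> 0 < b ->
    2 * dR * r <= rho -> Qnorm sh x < r -> shell_density sh p rho b h ->
    (potential W h x <= (C * b * rho ^+ n.+1)%:E)%E) -> shell_bound mu.
Proof.
move=> [C C0 CH].
pose k := Num.max 1 (kappa R n sh).
have k1 : 1 <= k by rewrite le_max lexx.
pose c := (2 * dR) `^ (dR - alpha).
have c0 : 0 < c by rewrite powR_gt0// mulr_gt0.
exists (c * C * k); first by rewrite !mulr_gt0// (lt_le_trans ltr01).
move=> r rho B s h z r0 s0 B0 drho sub hh; have [mh _ _] := hh.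
have rho0 : 0 < rho by rewrite (lt_le_trans _ drho)// !mulr_gt0.
have b0 : 0 < B * rho `^ lambda by rewrite mulr_gt0// powR_gt0.
have sr := Q_sub_radius s0 r0 sub.
pose A := c * C * B * rho `^ mu.
have A0 : 0 <= A by rewrite !mulr_ge0 ?powR_ge0 ?(ltW C0) ?(ltW B0).
have mQ := measurable_Q sh z s.
apply: (@le_trans _ _ (\int[lebesgue]_(x in (Q sh z s : set LT)) cst (A `^ q)%:E x)%E).
  apply: ge0_le_integral.
  - exact: mQ.
  - by move=> x _; exact: poweR_ge0.
  - apply: measurable_funTS.
    exact: measurableT_comp (measurable_poweR q) (measurable_riesz_potential mh).
  - exact: measurable_cst.
  move=> x /sub; rewrite QE /= subr0 => xr; rewrite -poweR_EFin.
  apply: le_poweR; [exact: ltW|exact: riesz_potential_ge0|].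
  apply: (le_trans (riesz_potential_le mW W0 ad r0 drho xr hh)).
  apply: (le_trans (lee_wpmul2l _ (CH r rho _ h x r0 b0 drho xr hh))).
    by rewrite lee_fin powR_ge0.
  rewrite -EFinM lee_fin le_eqVlt; apply/orP; left; apply/eqP.
  have := scale_mu B rho0; rewrite -/c => E.
  have -> : A = C * (c * B * rho `^ mu) by rewrite /A; ring.
  by rewrite -E; ring.
rewrite integral_cst; last exact: mQ.
rewrite (lebesgue_Q sh z s0) -EFinM lee_fin [leLHS]mulrA.
apply: ler_wpM2r; first by rewrite exprn_ge0// ltW.
apply: (@le_trans _ _ (A `^ q * k `^ q)).
  rewrite ler_wpM2l ?powR_ge0// (@le_trans _ _ k)//; first by rewrite le_max lexx orbT.
  exact: le1r_powR.
rewrite -powRM ?A0 ?(le_trans ler01 k1)//; apply: le_powR_pos; last exact: ltW.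
  by rewrite mulr_ge0// (le_trans ler01 k1).
have -> : c * C * k * (rho / r) `^ mu * B * s `^ mu =
    c * C * B * ((rho / r) `^ mu * s `^ mu) * k by ring.
rewrite ler_wpM2r ?(le_trans ler01 k1)// /A ler_wpM2l ?mulr_ge0 ?(ltW C0) ?(ltW B0) ?(ltW c0)//.
rewrite powR_divl// -mulrA ler_peMr ?powR_ge0//.
by rewrite mulrC ler_pdivlMr ?powR_gt0// mul1r le_powR_neg// ltW.
Qed.

(** The factor (rho / s) ^ (d / v) raises the rate from mu to mu + d / v; it is still
    negative, hence (rho / s) ^ beta <= (rho / r) ^ beta as s <= r. *)
Let tonelli_case (v : R) : pt = v%:E -> q <= v -> mu + dR / v < 0 ->
  shell_bound (mu + dR / v).
Proof.
move=> ptv qv beta0.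
have v0 : 0 < v := lt_le_trans q0 qv.
have [_ _ moments _] := pW.
have vpt : (v%:E <= pt)%E by rewrite ptv.
have [I I0 WI] := moments v v0 vpt.
have [C C0 CH] := shell_convolution_tonelli mW W0 sh p1 q1 qv I0 WI.
pose c := (2 * dR) `^ (dR - alpha).
have c0 : 0 < c by rewrite powR_gt0// mulr_gt0.
exists (c * C); first by rewrite mulr_gt0.
move=> r rho B s h z r0 s0 B0 drho sub hh; have [mh _ _] := hh.
have rho0 : 0 < rho by rewrite (lt_le_trans _ drho)// !mulr_gt0.
have b0 : 0 < B * rho `^ lambda by rewrite mulr_gt0// powR_gt0.
have sr := Q_sub_radius s0 r0 sub.
have mQ := measurable_Q sh z s.
pose e := (rho / (2 * dR)) `^ (alpha - dR).
have e0 : 0 <= e by exact: powR_ge0.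
have mP : measurable_fun [set: LT] (fun x : LT => potential W h x `^ q)%E.
  exact: measurableT_comp (measurable_poweR q) (measurable_potential mW W0 mh).
apply: (@le_trans _ _ ((e `^ q)%:E *
    \int[lebesgue]_(x in (Q sh z s : set LT)) (potential W h x `^ q))%E).
  rewrite -ge0_integralZl_EFin; last 4 first.
  - exact: mQ.
  - by move=> x _; exact: poweR_ge0.
  - exact: measurable_funTS.
  - exact: powR_ge0.
  apply: ge0_le_integral.
  - exact: mQ.
  - by move=> x _; exact: poweR_ge0.
  - apply: measurable_funTS.
    exact: measurableT_comp (measurable_poweR q) (measurable_riesz_potential mh).
  - by apply: measurable_funeM; exact: measurable_funTS.
  move=> x /sub; rewrite QE /= subr0 => xr.
  rewrite -poweR_EFin -poweRM ?lee_fin ?potential_ge0//.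
  apply: le_poweR; [exact: ltW|exact: riesz_potential_ge0|].
  exact: (riesz_potential_le mW W0 ad r0 drho xr hh).
apply: (le_trans (lee_wpmul2l _ (CH r rho _ s h z r0 b0 s0 drho sub hh))).
  by rewrite lee_fin powR_ge0.
rewrite -EFinM lee_fin [leLHS]mulrA.
apply: ler_wpM2r; first by rewrite exprn_ge0// ltW.
have D0 : 0 <= C * (B * rho `^ lambda) * rho ^+ n.+1 * (rho / s) `^ (dR / v).
  by rewrite !mulr_ge0 ?powR_ge0 ?exprn_ge0 ?(ltW C0) ?(ltW B0) ?(ltW rho0).
rewrite -powRM//; apply: le_powR_pos; [exact: mulr_ge0| |exact: ltW].
have -> : e * (C * (B * rho `^ lambda) * rho ^+ n.+1 * (rho / s) `^ (dR / v)) =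
    C * (e * (B * rho `^ lambda) * rho ^+ n.+1) * (rho / s) `^ (dR / v) by ring.
rewrite scale_mu// -/c.
have -> : C * (c * B * rho `^ mu) * (rho / s) `^ (dR / v) =
    c * C * B * (rho `^ mu * (rho / s) `^ (dR / v)) by ring.
have -> : c * C * (rho / r) `^ (mu + dR / v) * B * s `^ mu =
    c * C * B * ((rho / r) `^ (mu + dR / v) * s `^ mu) by ring.
rewrite ler_wpM2l ?mulr_ge0 ?(ltW C0) ?(ltW B0) ?(ltW c0)//.
have -> : rho `^ mu * (rho / s) `^ (dR / v) = (rho / s) `^ (mu + dR / v) * s `^ mu.
  have rs0 : 0 < rho / s by rewrite divr_gt0.
  have -> : rho `^ mu = (rho / s) `^ mu * s `^ mu.
    by rewrite -powRM ?(ltW rs0) ?(ltW s0)// divfK// gt_eqF.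
  by rewrite (powRDp _ _ rs0); ring.
rewrite ler_wpM2r ?powR_ge0//; apply: le_powR_neg; [by rewrite divr_gt0| |exact: ltW].
by rewrite ler_wpM2l ?(ltW rho0)// lef_pV2.
Qed.

(** If Omega has moments of order p', the potential is bounded pointwise, by Young's
    inequality (or directly when p = 1), with rate mu. Otherwise the moment of order
    pt >= q is used after integration in x, with rate mu + d / pt. The assumptions on
    sigma say that sigma plus the rate is negative. *)
Lemma shell_estimate : exists2 beta : R, sigma + beta < 0 & shell_bound beta.
Proof.
have [_ _ moments bounded] := pW.
have young : (hoelder_conjugate p%:E <= pt)%E -> sigma + lambda + alpha < 0 ->
    exists2 beta : R, sigma + beta < 0 & shell_bound beta.
  move=> ppt slt; exists mu; first by rewrite mlambda addrA.
  apply: bounded_case; move: p1; rewrite le_eqVlt => /predU1P[p1E|p1'].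
    have pty : pt = +oo%E.
      by move: ppt; rewrite -p1E hoelder_conjugate1 leye_eq => /eqP.
    have [M M0 WM] := bounded pty.
    have [C C0 CH] := shell_convolution_bounded mW W0 sh p1 M0 WM.
    exists C => // r rho b h x r0 b0 drho _ hh; apply: CH => //.
    by rewrite (lt_le_trans _ drho)// !mulr_gt0.
  have pm : 0 < p - 1 by rewrite subr_gt0.
  pose e := p / (p - 1).
  have pp : 0 < p := lt_trans ltr01 p1'.
  have e0 : 0 < e by rewrite divr_gt0.
  have pe : p^-1 + e^-1 = 1 by rewrite /e; field; rewrite !gt_eqF.
  have [] := moments e e0.
    move: ppt; rewrite /hoelder_conjugate/= eqe gt_eqF// -EFinB inver.
    by rewrite gt_eqF// -EFinM.
  move=> I I0 WI.
  have [C C0 CH] := shell_convolution_young mW W0 sh p1 e0 pe I0 WI.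
  by exists C.
case: cond => -[_ ppt slt]; first exact: young.
have [pty|ptNy] := eqVneq pt +oo%E.
  apply: young; first by rewrite pty leey.
  by move: slt; rewrite pty invey mule0 adde0 -!EFinD lte_fin.
have ptf : pt \is a fin_num.
  by rewrite ge0_fin_numE ?ltey// (le_trans _ pt1)// lee_fin.
have ptv : pt = (fine pt)%:E by rewrite fineK.
have qv : q <= fine pt by rewrite -lee_fin -ptv.
have v0 : 0 < fine pt by exact: lt_le_trans qv.
have slt' : sigma + (mu + dR / fine pt) < 0.
  move: slt; rewrite {1}ptv inver (gt_eqF v0) -EFinM -!EFinD lte_fin mlambda.
  by apply: le_lt_trans; rewrite le_eqVlt; apply/orP; left; apply/eqP; ring.
exists (mu + dR / fine pt) => //; apply: tonelli_case => //.
by apply: le_lt_trans slt'; rewrite lerDr ltW.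
Qed.

Definition dyadic_shell (R' : R) (j : nat) : set LT :=
  Q sh (0 : Rn) (2 ^+ j.+1 * R') `\` Q sh 0 (2 ^+ j * R').

(** The potential of f outside Q (0, R'), cut into shells to which shell_bound applies. *)
Definition tail_potential f (R' : R) x : \bar R :=
  (\sum_(j <oo) potential K (fun y => f y * \1_(dyadic_shell R' j) y)%R x)%E.

Lemma measurable_dyadic_shell R' j : measurable (dyadic_shell R' j).
Proof. by apply: measurableD; exact: measurable_Q. Qed.

Let measurable_shell_fun f R' j : measurable_fun [set: LT] f ->
  measurable_fun [set: LT] (fun y => f y * \1_(dyadic_shell R' j) y).
Proof.
move=> mf; apply: measurable_funM; [exact: mf|apply: measurable_indic].
exact: measurable_dyadic_shell.
Qed.

Lemma measurable_tail_potential f R' : measurable_fun [set: LT] f ->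
  measurable_fun [set: LT] (tail_potential f R').
Proof.
move=> mf; apply: ge0_emeasurable_sum => [j x _ _|j _].
  exact: riesz_potential_ge0.
by apply: measurable_riesz_potential; exact: measurable_shell_fun.
Qed.

Lemma tail_potential_ge0 f R' x : (0 <= tail_potential f R' x)%E.
Proof. by apply: nneseries_ge0 => j _ _; exact: riesz_potential_ge0. Qed.

(** The exponent gamma is taken halfway between beta and - sigma. The gap beta - gamma
    makes the contributions of the shells decay geometrically. *)
Lemma tail_estimate : exists beta gamma C : R,
  [/\ sigma + beta < 0, beta < gamma, sigma + gamma < 0, 0 < C &
  forall (r R' M s : R) f z, 0 < r -> 0 < s -> 0 < M -> 2 * dR * r <= R' ->
    Q sh z s `<=` Q sh 0 r -> measurable_fun [set: LT] f ->
    (forall j : nat, (\int[lebesgue]_(y in (Q sh (0 : Rn) (2 ^+ j.+1 * R') : set LT))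
       (`|f y| `^ p)%:E <= ((M * (2 ^+ j) `^ (- gamma) * (2 ^+ j * R') `^ lambda) `^ p *
         (2 ^+ j * R') ^+ n.+1)%:E)%E) ->
    (\int[lebesgue]_(x in (Q sh z s : set LT)) (tail_potential f R' x `^ q) <=
     ((C * (R' / r) `^ beta * M * s `^ mu) `^ q * s ^+ n.+1)%:E)%E].
Proof.
have [beta sb [C C0 CH]] := shell_estimate.
pose gamma := (beta - sigma) / 2.
have bg : beta < gamma by rewrite ltr_pdivlMr//; lra.
have sg : sigma + gamma < 0 by rewrite /gamma; lra.
(* a ^ 2 is the ratio of the contributions of two consecutive shells *)
pose a : R := 2 `^ ((beta - gamma) / 2).
have a01 : 0 < a < 1.
  rewrite powR_gt0//= /a /powR pnatr_eq0/= -[ltRHS]expR0 ltr_expR.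
  by rewrite pmulr_llt0 ?ln_gt0 ?ltr1n// pmulr_llt0 ?invr_gt0// subr_lt0.
have /andP[a0 a1] := a01.
have aj (j : nat) : (2 ^+ j : R) `^ beta * (2 ^+ j) `^ (- gamma) = a ^+ j.*2.
  have -> : (2 ^+ j : R) = 2 `^ j%:R by rewrite powR_mulrn.
  rewrite -powRDp ?powR_gt0// -powRrM -[RHS]/((2 `^ ((beta - gamma) / 2)) ^+ j.*2).
  by rewrite powR_expn; congr (_ `^ _); rewrite -muln2 natrM; field.
have ca0 : 0 < (1 - a)^-1 * (1 - a `^ q)^-1 `^ q^-1.
  rewrite mulr_gt0 ?invr_gt0 ?subr_gt0// powR_gt0// invr_gt0 subr_gt0.
  exact: powR_lt1 (ltW a0) a1 q0.
exists beta, gamma, ((1 - a)^-1 * (1 - a `^ q)^-1 `^ q^-1 * C); split => //.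
  exact: mulr_gt0.
move=> r R' M s f z r0 s0 M0 drR sub mf fM.
have R0 : 0 < R' by rewrite (lt_le_trans _ drR)// !mulr_gt0.
have j0 (j : nat) : 0 < (2 ^+ j : R) by rewrite exprn_gt0.
pose A := C * (R' / r) `^ beta * M * s `^ mu.
have A0 : 0 <= A by rewrite !mulr_ge0 ?powR_ge0 ?(ltW C0) ?(ltW M0).
have -> : (1 - a)^-1 * (1 - a `^ q)^-1 `^ q^-1 * C * (R' / r) `^ beta * M * s `^ mu =
   (1 - a)^-1 * (1 - a `^ q)^-1 `^ q^-1 * A by rewrite /A; ring.
have s00 : 0 <= s ^+ n.+1 by rewrite exprn_ge0// ltW.
have mQ := measurable_Q sh z s.
have mt (j : nat) : measurable_fun (Q sh z s : set LT)
    (potential K (fun y => f y * \1_(dyadic_shell R' j) y)).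
  apply: measurable_funTS; apply: measurable_riesz_potential.
  exact: measurable_shell_fun.
apply: (integral_poweR_nneseries_le a01 q0 A0 s00 mQ mt) => [j x|j].
  exact: riesz_potential_ge0.
set h := fun y => _.
have hh : shell_density sh p (2 ^+ j * R')
    (M * (2 ^+ j) `^ (- gamma) * (2 ^+ j * R') `^ lambda) h.
  split; first exact: measurable_shell_fun.
    move=> y; rewrite /h indicE; have [/set_mem[]|_] := boolP (y \in _); last first.
      by rewrite mulr0 eqxx.
    rewrite !QE /= !subr0 => y1 /negP; rewrite -leNgt => y2 _.
    by rewrite y2 mulrA -exprS.
  have -> : (\int[lebesgue]_y (`|h y| `^ p)%:E =
      \int[lebesgue]_(y in dyadic_shell R' j) (`|f y| `^ p)%:E)%E.
    rewrite [RHS]integral_mkcond; apply: eq_integral => y _; rewrite patchE /h indicE.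
    by case: ifPn => _; rewrite ?mulr1// mulr0 normr0 powR0// gt_eqF// (lt_le_trans ltr01).
  apply: le_trans (fM j).
  apply: ge0_subset_integral.
  - exact: measurable_dyadic_shell.
  - exact: measurable_Q.
  - by apply: measurable_funTS; exact: measurable_EFin_normr_powR.
  - by move=> y _; rewrite lee_fin powR_ge0.
  - exact: subDsetl.
have Rj : 2 * dR * r <= 2 ^+ j * R'.
  by rewrite (le_trans drR)// ler_peMl ?(ltW R0)// exprn_ege1// ler1n.
have Bj : 0 < M * (2 ^+ j) `^ (- gamma) by rewrite mulr_gt0// powR_gt0.
apply: (le_trans (CH r _ _ s h z r0 s0 Bj Rj sub hh)).
rewrite lee_fin le_eqVlt; apply/orP; left; apply/eqP; congr (_ `^ _ * _).
have -> : (2 ^+ j * R' / r) `^ beta = (2 ^+ j) `^ beta * (R' / r) `^ beta.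
  by rewrite -mulrA powRM ?(ltW (j0 j))// divr_ge0 ?(ltW R0) ?(ltW r0).
by rewrite -(aj j) /A; ring.
Qed.

End tail_estimate.

(** * Averaged norms *)

Section averaged_norms.
Context {R : realType} {n : nat}.
Local Notation Rn := 'rV[R]_n.+1.
Local Notation LT := (lebesgueT R n).
Local Notation dR := (n.+1%:R : R).
Implicit Types (J : set LT -> (LT -> R) -> \bar R) (g : LT -> R) (H : LT -> \bar R).
Implicit Types (U : set LT) (sh : Q_shape).

Local Open Scope ereal_scope.

(** The strong and the weak Morrey norms are averages over Q (x, s) of a functional
    J, and the two are treated at once through the property quasi_additive below. *)
Definition averaged_norm J sh (q mu : R) U g : \bar R :=
  ereal_sup [set ((z.2 `^ mu)^-1)%:E *
      ((lebesgue (Q sh z.1 z.2))^-1 * J (Q sh z.1 z.2) g) `^ q^-1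
    | z in [set z : Rn * R | (0 < z.2)%R /\ Q sh z.1 z.2 `<=` U]].

Definition strong_integral (q : R) U g : \bar R :=
  \int[lebesgue]_(y in U) (`|g y| `^ q)%:E.

(** The error term H is measured in L^q also when J is the weak functional; this is how
    the tail of the operator, which satisfies a strong estimate, enters both norms. *)
Definition quasi_additive (q : R) J : Prop := (forall U g, 0 <= J U g) /\
  forall U g g0 H, measurable U -> measurable_fun [set: LT] g ->
    measurable_fun [set: LT] g0 -> measurable_fun [set: LT] H -> (forall x, 0 <= H x) ->
    {ae lebesgue, forall x : LT, U x -> `|g x|%:E <= `|g0 x|%:E + H x} ->
    J U g <= (2 `^ q)%:E * (J U g0 + \int[lebesgue]_(x in U) (H x `^ q)).

Lemma le_averaged_term (c k q B : R) (j : \bar R) : (0 < c)%R -> (0 < k)%R ->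
  (0 < q)%R -> (0 <= B)%R -> 0 <= j ->
  ((c^-1)%:E * ((k^-1)%:E * j) `^ q^-1 <= (B * k `^ (- q^-1))%:E) =
  (j <= ((B * c) `^ q)%:E).
Proof.
move=> c0 k0 q0 B0 j0; rewrite poweRM ?lee_fin ?invr_ge0 ?(ltW k0)//.
have -> : ((k^-1)%:E `^ q^-1 : \bar R) = (k `^ (- q^-1))%:E.
  by rewrite poweR_EFin -(powR_inv1 (ltW k0)) -powRrM mulN1r.
have kq : (0 < k `^ (- q^-1))%R by rewrite powR_gt0.
rewrite lee_pdivrMl//.
have -> : (c%:E * (B * k `^ (- q^-1))%:E = (k `^ (- q^-1))%:E * (B * c)%:E).
  by rewrite -!EFinM; congr (_%:E); ring.
rewrite lee_pmul2l ?lte_fin// ?fin_numE//.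
have Bc : (0 <= B * c)%R by rewrite mulr_ge0 ?(ltW c0).
apply/idP/idP => [|jB].
  move/(le_poweR (ltW q0) (poweR_ge0 _ _)); rewrite -poweRrM mulVf ?gt_eqF//.
  by rewrite poweRe1// poweR_EFin.
have qV : (0 <= q^-1)%R by rewrite invr_ge0 ltW.
apply: (le_trans (le_poweR qV j0 jB)).
by rewrite poweR_EFin -powRrM divff ?gt_eqF// powRr1.
Qed.

(** Multiplying out the volume of Q (z, s), a multiple of s ^ d, turns a bound of the
    norm into bounds of J. *)
Lemma averaged_normP J sh (q mu B : R) U g : (0 < q)%R -> (0 <= B)%R ->
  (forall V g', 0 <= J V g') ->
  averaged_norm J sh q mu U g <= (B * kappa R n sh `^ (- q^-1))%:E <->
  (forall z (s : R), (0 < s)%R -> Q sh z s `<=` U ->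
     J (Q sh z s) g <= ((B * s `^ mu) `^ q * s ^+ n.+1)%:E).
Proof.
move=> q0 B0 J0; have k0 := @kappa_gt0 R n sh.
have term z (s : R) : (0 < s)%R ->
   (((s `^ mu)^-1)%:E * ((lebesgue (Q sh z s))^-1 * J (Q sh z s) g) `^ q^-1 <=
     (B * kappa R n sh `^ (- q^-1))%:E) =
   (J (Q sh z s) g <= ((B * s `^ mu) `^ q * s ^+ n.+1)%:E).
  move=> s0; have sn0 : (0 < s ^+ n.+1)%R by rewrite exprn_gt0.
  have sm : (0 < s `^ mu)%R by rewrite powR_gt0.
  rewrite lebesgue_Q// inver gt_eqF ?mulr_gt0//.
  have -> : (((kappa R n sh * s ^+ n.+1)^-1)%:E * J (Q sh z s) g =
      ((kappa R n sh)^-1)%:E * (((s ^+ n.+1)^-1)%:E * J (Q sh z s) g)).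
    by rewrite muleA -EFinM invfM.
  rewrite le_averaged_term//; last by rewrite mule_ge0// lee_fin invr_ge0 ltW.
  by rewrite lee_pdivrMl// -EFinM mulrC.
split=> [H z s s0 zsU|H].
  rewrite -term//; apply: le_trans H; apply: ereal_sup_ubound.
  by exists (z, s).
by apply: ge_ereal_sup => _ [[z s] [/= s0 zsU] <-]; rewrite term//; exact: H.
Qed.

Lemma poweR_add_le (a b : \bar R) (q : R) : (0 < q)%R -> 0 <= a -> 0 <= b ->
  (a + b) `^ q <= (2 `^ q)%:E * (a `^ q + b `^ q).
Proof.
move=> q0 a0 b0.
wlog ab : a b a0 b0 / a <= b => [W|].
  have [ab|/ltW ba] := leP a b; first exact: W.
  by rewrite addeC [X in _ * X]addeC; exact: W.
have h : (a + b) `^ q <= (2%:E * b) `^ q.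
  apply: le_poweR; [exact: ltW|exact: adde_ge0|].
  have -> : (2%:E : \bar R) = 1%:E + 1%:E by rewrite -EFinD.
  by rewrite ge0_muleDl// !mul1e leeD2r.
apply: (le_trans h); rewrite poweRM ?lee_fin// poweR_EFin.
by rewrite lee_wpmul2l ?lee_fin ?powR_ge0// leeDr// poweR_ge0.
Qed.

Lemma strong_quasi_additive (q : R) : (0 < q)%R ->
  quasi_additive q (strong_integral q).
Proof.
move=> q0; split=> [U g|U g g0 H mU mg mg0 mH H0 gH].
  by apply: integral_ge0 => y _; rewrite lee_fin powR_ge0.
have mHq : measurable_fun [set: LT] (fun x => H x `^ q).
  exact: measurableT_comp (measurable_poweR q) mH.
have mgq : measurable_fun U (fun x => (`|g x| `^ q)%:E).
  by apply: measurable_funTS; exact: measurable_EFin_normr_powR.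
have mg0q : measurable_fun U (fun x => (`|g0 x| `^ q)%:E).
  by apply: measurable_funTS; exact: measurable_EFin_normr_powR.
rewrite /strong_integral -ge0_integralD; last 5 first.
- exact: mU.
- by move=> x _; rewrite lee_fin powR_ge0.
- exact: mg0q.
- by move=> x _; exact: poweR_ge0.
- exact: measurable_funTS.
have mS : measurable_fun U (fun x => (`|g0 x| `^ q)%:E + H x `^ q).
  by apply: emeasurable_funD; [exact: mg0q|exact: measurable_funTS].
rewrite -ge0_integralZl_EFin; last 4 first.
- exact: mU.
- by move=> x _; rewrite adde_ge0 ?poweR_ge0// lee_fin powR_ge0.
- exact: mS.
- exact: powR_ge0.
apply: ae_ge0_le_integral.
- exact: mU.
- by move=> x _; rewrite lee_fin powR_ge0.
- exact: mgq.
- by move=> x _; rewrite mule_ge0 ?adde_ge0 ?poweR_ge0 ?lee_fin ?powR_ge0.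
- exact: measurable_funeM.
apply: filterS gH => x gx Ux; rewrite -!poweR_EFin.
apply: le_trans (poweR_add_le q0 _ (H0 x)); last by rewrite lee_fin.
by apply: le_poweR; [exact: ltW|rewrite lee_fin|exact: gx].
Qed.

(** Where |g| > t, either |g0| > t / 2 or H > t / 2; Chebyshev's inequality bounds the
    measure of the latter set. *)
Lemma weak_quasi_additive (q : R) : (0 < q)%R ->
  quasi_additive q (fun U g => weak_integral q (U : set Rn) g).
Proof.
move=> q0; split=> [U g|U g g0 H mU mg mg0 mH H0 gH].
  apply: (@le_trans _ _ ((1 `^ q)%:E * lebesgue (U `&` [set y | (1 < `|g y|)%R]))).
    by rewrite mule_ge0// lee_fin powR_ge0.
  by apply: ereal_sup_ubound; exists 1%R => //=; rewrite ltr01.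
apply: ge_ereal_sup => _ [t /= t0 <-].
have t20 : (0 < t / 2)%R by rewrite divr_gt0.
pose A : set LT := U `&` [set y | (t < `|g y|)%R].
pose A0 : set LT := U `&` [set y | (t / 2 < `|g0 y|)%R].
pose AH : set LT := U `&` [set y | (t / 2)%:E < H y].
have mset (f : LT -> R) (c : R) : measurable_fun [set: LT] f ->
    measurable (U `&` [set y | (c < `|f y|)%R] : set LT).
  move=> mf; apply: measurableI => //.
  have := measurable_normr_fun mf measurableT (measurable_itv `]c, +oo[).
  rewrite setTI; congr (measurable _).
  by apply/seteqP; split => y /=; rewrite in_itv /= andbT.
have mA : measurable A by exact: mset.
have mA0 : measurable A0 by exact: mset.
have mAH : measurable AH.
  by apply: emeasurable_fun_o_infty => //; exact: measurable_funTS.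
have [N [mN N0 NP]] := gH.
have sub : A `<=` N `|` (A0 `|` AH).
  move=> x [Ux tx]; have [Nx|nNx] := pselect (N x); [by left|right].
  have := NP; move=> /subsetCl/(_ _ nNx)/(_ Ux) gx.
  have [hx|hx] := ltP (t / 2)%R `|g0 x|%R; [by left|right; split => //=].
  rewrite ltNge; apply/negP => Hx.
  have : (`|g x|%:E <= t%:E).
    apply: (le_trans gx); have -> : t%:E = (t / 2)%:E + (t / 2)%:E.
      by rewrite -EFinD; congr (_%:E); field.
    by apply: leeD => //; rewrite lee_fin.
  by rewrite lee_fin leNgt tx.
have lA : lebesgue A <= lebesgue A0 + lebesgue AH.
  apply: (@le_trans _ _ (lebesgue (N `|` (A0 `|` AH)))).
    by apply: le_measure => //; rewrite inE//; do 2 apply: measurableU => //.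
  have mB : measurable (A0 `|` AH) by exact: measurableU.
  have e1 : lebesgue (N `|` (A0 `|` AH)) <= lebesgue N + lebesgue (A0 `|` AH).
    exact: measureU2.
  have e2 : lebesgue (A0 `|` AH) <= lebesgue A0 + lebesgue AH by exact: measureU2.
  have e3 : lebesgue N = 0 by exact: N0.
  by apply: (le_trans e1); rewrite e3 add0e.
have tq : ((t `^ q) = 2 `^ q * (t / 2) `^ q)%R.
  by rewrite -powRM ?(ltW t20)// mulrC divfK.
rewrite -/A tq EFinM -muleA lee_wpmul2l ?lee_fin ?powR_ge0//.
apply: (le_trans (lee_wpmul2l _ lA)); first by rewrite lee_fin powR_ge0.
rewrite muleDr ?ge0_adde_def ?inE//; apply: leeD.
  by apply: ereal_sup_ubound; exists (t / 2)%R.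
have mHq : measurable_fun [set: LT] (fun x => H x `^ q).
  exact: measurableT_comp (measurable_poweR q) mH.
apply: (@le_trans _ _ (\int[lebesgue]_(x in AH) (H x `^ q))); last first.
  apply: ge0_subset_integral; [exact: mAH|exact: mU|exact: measurable_funTS| |].
    by move=> x _; exact: poweR_ge0.
  exact: subIsetl.
rewrite -(integral_cst _ mAH); apply: ge0_le_integral.
- exact: mAH.
- by move=> x _; rewrite lee_fin powR_ge0.
- exact: measurable_cst.
- exact: measurable_funTS.
- move=> x [_ /ltW hx]; rewrite -poweR_EFin; apply: le_poweR; [exact: ltW| |exact: hx].
  by rewrite lee_fin ltW.
Qed.

End averaged_norms.

(** * Cutoffs of functions of finite Morrey norm *)

Section cutoffs.
Context {R : realType} {n : nat}.
Local Notation Rn := 'rV[R]_n.+1.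
Local Notation LT := (lebesgueT R n).
Local Notation dR := (n.+1%:R : R).
Implicit Types (f g : LT -> R) (sh : Q_shape).

Lemma closed_supp (f : Rn -> R) : closed (supp f).
Proof.
move=> x clx V Vx; have [y [fy Vy]] := clx _ (nbhs_interior Vx).
exact: fy.
Qed.

Lemma L1comp_bounded f (rho : R) :
  lebesgue.-integrable [set: LT] (EFin \o f) ->
  (forall y : Rn, rho < `|y| -> f y = 0) -> L1comp f.
Proof.
move=> intf f0; split => //; apply: bounded_closed_compact; last exact: closed_supp.
exists rho; split; first exact: num_real.
move=> M rM x sx; rewrite /= leNgt; apply/negP => Mx.
have rx : rho < `|x| by exact: lt_trans Mx.
have V : nbhs x [set y : Rn | rho < `|y|].
  have e0 : 0 < `|x| - rho by rewrite subr_gt0.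
  apply/nbhs_ballP; exists (`|x| - rho) => // y; rewrite -ball_normE /= => xy.
  have : `|x| - `|y| <= `|x - y| := lerB_dist x y.
  by move: xy; move: `|x - y| `|x| `|y| => *; lra.
by apply: (sx _ V); apply: aeW => y /=; exact: f0.
Qed.

Lemma cutoffE sh f (r : R) y :
  (f \* \1_(Q sh (0 : Rn) r))%R y = if y \in Q sh (0 : Rn) r then f y else 0.
Proof. by rewrite /= indicE; case: ifPn => _; rewrite ?mulr1 ?mulr0. Qed.

Lemma measurable_cutoff sh f (r : R) : measurable_fun [set: LT] f ->
  measurable_fun [set: LT] (f \* \1_(Q sh (0 : Rn) r))%R.
Proof.
move=> mf; apply: measurable_funM; [exact: mf|apply: measurable_indic].
exact: measurable_Q.
Qed.

Lemma cutoff_far sh f (r : R) (y : Rn) : r < `|y| -> (f \* \1_(Q sh (0 : Rn) r))%R y = 0.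
Proof.
move=> ry; rewrite cutoffE memNset// QE /= subr0 => yr.
by have := lt_trans (le_lt_trans (norm_le_Qnorm sh y) yr) ry; rewrite ltxx.
Qed.

Lemma integrable_cutoff sh f (p r : R) : measurable_fun [set: LT] f -> 1 <= p -> 0 < r ->
  (\int[lebesgue]_(y in (Q sh (0 : Rn) r : set LT)) (`|f y| `^ p)%:E < +oo)%E ->
  lebesgue.-integrable [set: LT] (EFin \o (f \* \1_(Q sh (0 : Rn) r))%R).
Proof.
move=> mf p1 r0 fp; have mQ := measurable_Q sh (0 : Rn) r.
apply/integrableP; split; first by apply/measurable_EFinP; exact: measurable_cutoff.
have mfp : measurable_fun (Q sh (0 : Rn) r : set LT) (fun y => (`|f y| `^ p)%:E).
  by apply: measurable_funTS; exact: measurable_EFin_normr_powR.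
have -> : (\int[lebesgue]_(y in [set: LT])
      `|(EFin \o (f \* \1_(Q sh (0 : Rn) r))%R) y| =
    \int[lebesgue]_(y in (Q sh (0 : Rn) r : set LT)) `|f y|%:E)%E.
  rewrite [RHS]integral_mkcond; apply: eq_integral => y _.
  by rewrite patchE /comp cutoffE; case: ifPn => _ //=; rewrite normr0.
apply: (@le_lt_trans _ _ (\int[lebesgue]_(y in (Q sh (0 : Rn) r : set LT))
    (cst 1%:E y + (`|f y| `^ p)%:E))%E).
  apply: ge0_le_integral.
  - exact: mQ.
  - by move=> y _; rewrite lee_fin.
  - by apply: measurable_funTS; apply/measurable_EFinP; exact: measurable_normr_fun.
  - by apply: emeasurable_funD; [exact: measurable_cst|exact: mfp].
  - by move=> y _; rewrite -EFinD lee_fin le_1D_powR.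
rewrite ge0_integralD; last 5 first.
- exact: mQ.
- by move=> y _; rewrite lee_fin.
- exact: measurable_cst.
- by move=> y _; rewrite lee_fin powR_ge0.
- exact: mfp.
rewrite integral_cst; last exact: mQ.
by rewrite mul1e (lebesgue_Q sh 0 r0); apply: lte_add_pinfty => //; rewrite ltry.
Qed.

Lemma L1comp_cutoff sh f (p r : R) : measurable_fun [set: LT] f -> 1 <= p -> 0 < r ->
  (\int[lebesgue]_(y in (Q sh (0 : Rn) r : set LT)) (`|f y| `^ p)%:E < +oo)%E ->
  L1comp (f \* \1_(Q sh (0 : Rn) r))%R.
Proof.
move=> mf p1 r0 fp; apply: (@L1comp_bounded _ r); first exact: integrable_cutoff fp.
by move=> y; exact: cutoff_far.
Qed.

Lemma L1compB f g : L1comp f -> L1comp g -> (exists rho : R, forall y : Rn, rho < `|y| ->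
  f y = 0 /\ g y = 0) -> L1comp (f \- g)%R.
Proof.
move=> [If _] [Ig _] [rho H]; apply: (@L1comp_bounded _ rho).
  rewrite (_ : EFin \o _ = (EFin \o f) \- (EFin \o g))%E; first exact: integrableB.
  by apply/funext => y; rewrite /= EFinB.
by move=> y /H[fy gy]; rewrite /= fy gy subrr.
Qed.

(** If s >= r, the integral is at most the one over Q (0, r), and lambda p + d >= 0
    gives r ^ (lambda p + d) <= s ^ (lambda p + d). If s < r, then Q (z, s) either is
    disjoint from Q (0, r) or lies in Q (0, 3 d r). *)
Lemma cutoff_strong_le sh f (p lambda r B : R) : measurable_fun [set: LT] f ->
  1 <= p -> 0 < r -> 0 <= B -> - (dR / p) <= lambda ->
  (forall (z : Rn) s, 0 < s -> Q sh z s `<=` Q sh 0 (3 * dR * r) ->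
    (strong_integral p (Q sh z s) f <= ((B * s `^ lambda) `^ p * s ^+ n.+1)%:E)%E) ->
  forall (z : Rn) s, 0 < s ->
    (strong_integral p (Q sh z s) (f \* \1_(Q sh (0 : Rn) r))%R <=
     ((B * s `^ lambda) `^ p * s ^+ n.+1)%:E)%E.
Proof.
move=> mf p1 r0 B0 pl H z s s0.
have p0 : 0 < p := lt_le_trans ltr01 p1.
have rd : r <= 3 * dR * r by rewrite ler_peMl ?(ltW r0)// mulr_ege1// ler1n.
have mQ (z' : Rn) (s' : R) := measurable_Q sh z' s'.
have mfp : measurable_fun [set: LT] (fun y => (`|f y| `^ p)%:E).
  exact: measurable_EFin_normr_powR.
have E (U : set LT) : measurable U ->
    (strong_integral p U (f \* \1_(Q sh (0 : Rn) r))%R =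
     strong_integral p (U `&` Q sh (0 : Rn) r) f)%E.
  move=> mU; rewrite /strong_integral [RHS]integral_mkcondr; apply: eq_integral => y _.
  rewrite patchE cutoffE; case: ifPn => _ //.
  by rewrite normr0 powR0// gt_eqF.
have mono (U V : set LT) : measurable U -> measurable V -> U `<=` V ->
    (strong_integral p U f <= strong_integral p V f)%E.
  move=> mU mV UV; apply: ge0_subset_integral; [exact: mU|exact: mV| | |exact: UV].
    exact: measurable_funTS.
  by move=> y _; rewrite lee_fin powR_ge0.
rewrite E; last exact: mQ.
have mI : measurable (Q sh z s `&` Q sh (0 : Rn) r : set LT) by exact: measurableI.
have [rs|sr] := leP r s.
  apply: (le_trans (mono _ _ mI (mQ 0 r) (@subIsetr _ _ _))).
  apply: (le_trans (H 0 r r0 _)).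
    by move=> y; rewrite !QE /= subr0 => /lt_le_trans; apply.
  rewrite lee_fin !powRM ?powR_ge0// -!powRrM -!mulrA ler_wpM2l ?powR_ge0//.
  rewrite -!powR_mulrn ?(ltW r0) ?(ltW s0)// -!powRDp//.
  apply: le_powR_pos => //; first exact: ltW.
  by move: pl; rewrite lerNl -subr_ge0 -(pmulr_lge0 _ p0) opprK mulrDl divfK ?gt_eqF// addrC.
have [I0|/set0P[w [zw rw]]] := eqVneq (Q sh z s `&` Q sh (0 : Rn) r) set0.
  rewrite /strong_integral I0 integral_set0 lee_fin mulr_ge0 ?powR_ge0// exprn_ge0//.
  exact: ltW.
have sub : Q sh z s `<=` Q sh 0 (3 * dR * r).
  move=> x; rewrite QE /= => xs; move: zw rw; rewrite !QE /= !subr0 => ws wr.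
  apply: le_lt_trans (Qnorm_le_norm sh x) _; rewrite (mulrC 3) -mulrA ltr_pM2l//.
  have h1 := le_lt_trans (norm_le_Qnorm sh _) xs.
  have h2 := le_lt_trans (norm_le_Qnorm sh _) ws.
  have h3 := le_lt_trans (norm_le_Qnorm sh _) wr.
  have -> : x = (x - z) + (- (w - z) + w) by rewrite opprB !subrK.
  have t1 : `|(x - z) + (- (w - z) + w)| <= `|x - z| + `|- (w - z) + w| := ler_normD _ _.
  have t2 : `|- (w - z) + w| <= `|w - z| + `|w|.
    by rewrite -[`|w - z|]normrN; exact: ler_normD.
  move: h1 h2 h3 t1 t2; move: `|x - z| `|w - z| `|w| `|- (w - z) + w| `|x - z + (- (w - z) + w)|.
  by move=> *; lra.
by apply: (le_trans (mono _ _ mI (mQ z s) (@subIsetl _ _ _))); exact: H.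
Qed.

End cutoffs.

(** * The operator far from the support *)

Section dyadic_shells.
Context {R : realType} {n : nat}.
Local Notation Rn := 'rV[R]_n.+1.
Local Notation LT := (lebesgueT R n).
Implicit Types (sh : Q_shape) (x y : Rn).

Lemma ae_reflect (P : Rn -> Prop) x : {ae lebesgue, forall y : LT, P y} ->
  {ae lebesgue, forall y : LT, P (x - (y : Rn))}.
Proof.
move=> [N [mN N0 NP]].
have N1 : - 1 != 0 :> R by rewrite oppr_eq0 oner_eq0.
exists [set y : LT | N (- 1 *: (y : Rn) + x)]; split.
- by have := measurable_affine x N1 measurableT mN; rewrite setTI.
- by have := lebesgue_affine x N N1; rewrite N0 mule0.
- by move=> y /= H; apply: NP => /=; rewrite scaleN1r addrC.
Qed.

Lemma exists_dyadic_shell sh (R' : R) y : 0 < R' -> R' <= Qnorm sh y ->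
  exists j, dyadic_shell sh R' j y.
Proof.
move=> R0 Ry; have [j /andP[j1 j2]] := exists_dyadic R0 Ry; exists j.
rewrite /dyadic_shell !QE; split; rewrite /= subr0//.
by apply/negP; rewrite -leNgt.
Qed.

Lemma dyadic_shell_shift sh (R' : R) (a j : nat) :
  dyadic_shell sh (2 ^+ a * R' : R) j = dyadic_shell (n := n) sh R' (j + a).
Proof.
by rewrite /dyadic_shell !mulrA -!exprD addSn.
Qed.

End dyadic_shells.

Section operator.
Context {R : realType} {n : nat}.
Local Notation Rn := 'rV[R]_n.+1.
Local Notation LT := (lebesgueT R n).
Local Notation BT := (borelT R n).
Local Notation dR := (n.+1%:R : R).
Implicit Types (f g : LT -> R) (x y : Rn).

Variables (sh : Q_shape) (T : (Rn -> R) -> Rn -> R) (pt : \bar R) (Omega : Rn -> R).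
Variables (alpha : R) (W : BT -> R).
Hypotheses (hdef : defined_on_L1comp T) (hdiff : diff_bounded T).
Hypothesis hsize : size_condition T Omega alpha.
Hypotheses (mOmega : measurable_fun [set: LT] Omega) (pW : profile pt W).
Hypothesis aeW : {ae lebesgue, forall x : LT, W x = `|Omega x|}.

Local Notation K := (riesz_kernel W alpha).
Local Notation cutoff f r := (f \* \1_(Q sh (0 : Rn) r))%R.
Local Notation tail := (tail_potential W sh alpha).

Let mK : measurable_fun [set: BT] K.
Proof. by case: pW => mW _ _ _; exact: measurable_riesz_kernel. Qed.

Let K0 z : 0 <= K z.
Proof. by case: pW => _ W0 _ _; rewrite divr_ge0// powR_ge0. Qed.

(** W may replace |Omega| in the size condition, because y |-> x - y preserves null
    sets. *)
Lemma size_integralE g x : measurable_fun [set: LT] g ->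
  (\int[lebesgue]_y (`|Omega (x - y : Rn)| /
     enorm (x - y : Rn) `^ (n.+1%:R - alpha) * `|g y|)%:E = potential K g x)%E.
Proof.
move=> mg; apply: ge0_ae_eq_integral.
- exact: measurableT.
- apply/measurable_EFinP; apply: measurable_funM; last exact: measurable_normr_fun.
  rewrite (_ : (fun _ => _) = (fun y : LT => `|Omega (x - (y : Rn))| *
      Qnorm balls (x - (y : Rn)) `^ (- (dR - alpha)))); last first.
    by apply/funext => y; rewrite powRN.
  apply: measurable_funM.
    have N1 : - 1 != 0 :> R by rewrite oppr_eq0 oner_eq0.
    have := measurableT_comp (measurable_normr_fun mOmega) (measurable_affine x N1).
    congr (measurable_fun _ _); apply/funext => y /=.
    by rewrite scaleN1r addrC.
  apply: (measurableT_comp (measurable_powR _)).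
  exact: measurableT_comp (measurable_Qnorm_borel balls) (measurable_borel_subr x).
- exact: measurable_convolved.
- by move=> y _; rewrite lee_fin mulr_ge0// divr_ge0// powR_ge0.
- by move=> y _; rewrite lee_fin mulr_ge0.
- by apply: filterS (ae_reflect x aeW) => y /= We _; rewrite /riesz_kernel We.
Qed.

Lemma potential_le_tail f g (R' : R) x : 0 < R' -> measurable_fun [set: LT] f ->
  measurable_fun [set: LT] g -> (forall y, Q sh 0 R' y -> g y = 0) ->
  (forall y, `|g y| <= `|f y|) -> (potential K g x <= tail f R' x)%E.
Proof.
move=> R0 mf mg g0 gf.
have msh (j : nat) : measurable_fun [set: LT]
    (fun y : LT => (K (x - (y : Rn)) * `|f y * \1_(dyadic_shell sh R' j) y|)%:E).
  apply: measurable_convolved; first exact: mK.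
  apply: measurable_funM; first exact: mf.
  by apply: measurable_indic; exact: measurable_dyadic_shell.
have t0 (j : nat) (y : LT) :
    (0 <= (K (x - (y : Rn)) * `|f y * \1_(dyadic_shell sh R' j) y|)%:E)%E.
  by rewrite lee_fin mulr_ge0.
rewrite /tail_potential /potential -integral_nneseries; last 3 first.
- exact: measurableT.
- exact: msh.
- by move=> j y _; exact: t0.
apply: ge0_le_integral.
- exact: measurableT.
- by move=> y _; rewrite lee_fin mulr_ge0.
- exact: measurable_convolved.
- by apply: ge0_emeasurable_sum => [j y _ _|j _]; [exact: t0|exact: msh].
move=> y _; have [Ry|yR] := leP R' (Qnorm sh (y : Rn)).
  have [j yj] := exists_dyadic_shell R0 Ry.
  apply: le_trans (nneseries_term_le j (fun i => t0 i y)).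
  by rewrite lee_fin indicE mem_set// mulr1 ler_wpM2l.
by rewrite g0 ?normr0 ?mulr0 ?QE /= ?subr0// nneseries_ge0.
Qed.

(** The difference of the two cutoffs vanishes on Q (0, R1), so that the points of
    Q (0, r) are outside its support and the size condition applies to it there. *)
Lemma cutoff_difference_tail : exists2 C : R, 0 < C & forall f (r R1 R2 : R),
  measurable_fun [set: LT] f -> L1comp (cutoff f R1) -> L1comp (cutoff f R2) ->
  0 < r -> 2 * dR * r <= R1 -> R1 <= R2 ->
  {ae lebesgue, forall x : LT, Q sh 0 r x ->
    (`|T (cutoff f R2) x - T (cutoff f R1) x|%:E <= C%:E * tail f R1 x)%E}.
Proof.
have [C1 C10 H1] := hdiff; have [C2 C20 H2] := hsize.
exists (C1 * C2); first exact: mulr_gt0.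
move=> f r R1 R2 mf L1 L2 r0 dr R12.
have R10 : 0 < R1 by rewrite (lt_le_trans _ dr)// !mulr_gt0.
have Lg : L1comp (cutoff f R2 \- cutoff f R1)%R.
  apply: L1compB => //; exists R2 => y yR2; rewrite !cutoff_far//.
  exact: le_lt_trans yR2.
have mg : measurable_fun [set: LT] (cutoff f R2 \- cutoff f R1)%R.
  by apply: measurable_funB; exact: measurable_cutoff.
have g0 y : Q sh 0 R1 y -> (cutoff f R2 \- cutoff f R1)%R y = 0.
  move=> yR1; have yR2 : Q sh 0 R2 y.
    by move: yR1; rewrite !QE /= => /lt_le_trans; apply.
  by rewrite /= !indicE !mem_set// subrr.
have gf y : `|(cutoff f R2 \- cutoff f R1)%R y| <= `|f y|.
  rewrite /= !indicE; have [y1|y1] := boolP (y \in Q sh (0 : Rn) R1).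
    have -> : y \in Q sh (0 : Rn) R2.
      apply/mem_set; move/set_mem: y1; rewrite !QE /= => /lt_le_trans; exact.
    by rewrite subrr normr0.
  by rewrite mulr0 subr0; case: (_ \in _); rewrite ?mulr1// mulr0 normr0.
apply: filterS2 (H1 _ _ L2 L1) (H2 _ Lg) => x Tx Sx xr.
have nsupp : ~ supp (cutoff f R2 \- cutoff f R1)%R x.
  move=> sx; have Vx : nbhs (x : Rn) [set y : Rn | Q sh 0 R1 y].
    move: xr; rewrite QE /= subr0 => /(le_lt_trans (norm_le_Qnorm sh _)) xr.
    apply/nbhs_ballP; exists r => // y; rewrite -ball_normE /= => xy.
    rewrite QE /= subr0; apply: le_lt_trans (Qnorm_le_norm sh y) _.
    apply: lt_le_trans dr; rewrite (mulrC 2) -mulrA ltr_pM2l//.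
    have : `|x - (x - y)| <= `|x : Rn| + `|x - y : Rn| := ler_normB _ _.
    rewrite subKr; move: xr xy; move: `|x : Rn| `|x - y : Rn| `|y : Rn| => *; lra.
  apply: (sx _ Vx).
  by apply: (@filterE _ (almost_everywhere lebesgue)) => y; exact: g0.
have := Sx nsupp; rewrite size_integralE// => Sx'.
apply: (@le_trans _ _ (C1%:E * `|T (cutoff f R2 \- cutoff f R1)%R x|%:E)%E).
  by rewrite -EFinM lee_fin.
rewrite EFinM -muleA lee_wpmul2l ?lee_fin ?(ltW C10)//.
apply: (le_trans Sx'); rewrite lee_wpmul2l ?lee_fin ?(ltW C20)//.
exact: potential_le_tail.
Qed.

Lemma tail_potential_shift f (R' : R) (a : nat) x :
  tail f (2 ^+ a * R') x =
  (\sum_(a <= j <oo) potential K (fun y => f y * \1_(dyadic_shell sh R' j) y)%R x)%E.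
Proof.
rewrite -(@nneseries_addn R _ a) => [|i]; last exact: riesz_potential_ge0 pW _ _.
rewrite /tail_potential; apply: eq_eseriesr => j _.
by rewrite dyadic_shell_shift.
Qed.

End operator.

(** * The limit along dyadic cutoffs *)

Section dyadic_limit.
Context {R : realType} {n : nat}.
Local Notation Rn := 'rV[R]_n.+1.
Local Notation LT := (lebesgueT R n).
Local Notation BT := (borelT R n).
Local Notation dR := (n.+1%:R : R).

(** An upper limit of measurable functions is measurable whether they converge or not;
    under the assumptions below it is almost everywhere a limit. *)
Definition dyadic_limit sh (T : (Rn -> R) -> Rn -> R) (f : Rn -> R) (x : Rn) : R :=
  fine (limn_esup (fun k : nat => (T (f \* \1_(Q sh (0 : Rn) (2 ^+ k)))%R x)%:E)).

Lemma cvg_tail_bound (t : nat -> R) (k0 : nat) (e : nat -> \bar R) :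
  (forall k l, (k0 <= k <= l)%N -> (`|t l - t k|%:E <= e k)%E) ->
  e @ \oo --> 0%E -> cvgn t.
Proof.
move=> te e0; apply: cauchy_cvg; apply: cauchy_exP => eps eps0.
have [N _ Ne] : \forall k \near \oo, (e k < eps%:E)%E.
  exact: (e0 _ (@nbhs_open_ereal_lt R 0 (fun=> eps) eps0)).
exists (t (maxn N k0)); exists (maxn N k0) => // l /= Nl.
rewrite -ball_normE /= distrC -lte_fin.
apply: le_lt_trans (te _ _ _) (Ne _ _); first by rewrite leq_maxr.
exact: leq_maxl.
Qed.

Variables (sh : Q_shape) (T : (Rn -> R) -> Rn -> R) (pt : \bar R) (alpha : R).
Variables (W : BT -> R).
Hypotheses (hdef : defined_on_L1comp T) (pW : profile pt W).
Local Notation cutoff f r := (f \* \1_(Q sh (0 : Rn) r))%R.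
Local Notation tail := (tail_potential W sh alpha).

Variable C : R.
Hypothesis C0 : 0 < C.
Hypothesis difference : forall (f : LT -> R) (r R1 R2 : R),
  measurable_fun [set: LT] f -> L1comp (cutoff f R1) -> L1comp (cutoff f R2) ->
  0 < r -> 2 * dR * r <= R1 -> R1 <= R2 ->
  {ae lebesgue, forall x : LT, Q sh 0 r x ->
    (`|T (cutoff f R2) x - T (cutoff f R1) x|%:E <= C%:E * tail f R1 x)%E}.

Variables (f : LT -> R) (q : R).
Hypotheses (mf : measurable_fun [set: LT] f) (q0 : 0 < q).
Hypothesis Lf : forall r, 0 < r -> L1comp (cutoff f r).
Hypothesis tail_fin : forall r R', 0 < r -> 2 * dR * r <= R' -> 1 <= R' ->
  (\int[lebesgue]_(x in (Q sh (0 : Rn) r : set LT)) (tail f R' x `^ q) < +oo)%E.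

Local Notation t k := (T (cutoff f (2 ^+ k))).

Let pow0 (k : nat) : 0 < 2 ^+ k :> R. Proof. by rewrite exprn_gt0. Qed.

Lemma measurable_dyadic_limit : measurable_fun [set: LT] (dyadic_limit sh T f).
Proof.
apply: measurableT_comp; first exact: fine_measurable.
apply: measurable_fun_limn_esup => k; apply/measurable_EFinP.
by apply: hdef; exact: Lf.
Qed.

Let tail_ae_fin r R' : 0 < r -> 2 * dR * r <= R' -> 1 <= R' ->
  {ae lebesgue, forall x : LT, Q sh 0 r x -> (tail f R' x < +oo)%E}.
Proof.
move=> r0 dr R1; have mt := measurable_tail_potential sh alpha pW R' mf.
have mQ := measurable_Q sh (0 : Rn) r.
have it : lebesgue.-integrable (Q sh (0 : Rn) r : set LT) (fun x => tail f R' x `^ q)%E.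
  apply/integrableP; split.
    by apply: measurable_funTS; exact: measurableT_comp (measurable_poweR q) mt.
  under eq_integral do rewrite gee0_abs ?poweR_ge0//.
  exact: tail_fin.
apply: filterS (integrable_ae mQ it) => x H xr.
have := H xr; rewrite ge0_fin_numE ?poweR_ge0//; apply: lty_poweRy.
by rewrite gt_eqF.
Qed.

(** For x in Q (0, m + 1), the comparison of cutoffs needs radii at least
    2 d (m + 1), hence the radii 2 ^ k with k >= level m. *)
Let level (m : nat) : nat := (2 * n.+1 * m.+1)%N.

Let level_le m : 2 * dR * m.+1%:R <= 2 ^+ level m.
Proof. by rewrite -natrX -!natrM ler_nat ltnW// ltn_expl. Qed.

(** The tails at the radii 2 ^ k are remainders of one series over dyadic shells, which
    converges almost everywhere because its q-th power is locally integrable. *)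
Let dyadic_cvg : {ae lebesgue, forall x : LT, cvgn (fun k => t k x)}.
Proof.
have D1 : {ae lebesgue, forall x : LT, forall k l m : nat, (level m <= k <= l)%N ->
    Q sh 0 m.+1%:R x -> (`|t l x - t k x|%:E <= C%:E * tail f (2 ^+ k) x)%E}.
  apply: ae_foralln => k; apply: ae_foralln => l; apply: ae_foralln => m.
  have [/andP[mk kl]|nk] := boolP (level m <= k <= l)%N; last first.
    by apply: (@filterE _ (almost_everywhere lebesgue)) => x.
  have m1 : 0 < m.+1%:R :> R by [].
  have le1 : 2 * dR * m.+1%:R <= 2 ^+ k.
    by rewrite (le_trans (level_le m))// ler_weXn2l// ler1n.
  have le2 : 2 ^+ k <= 2 ^+ l :> R by rewrite ler_weXn2l// ler1n.
  apply: filterS (difference mf (Lf (pow0 k)) (Lf (pow0 l)) m1 le1 le2) => x H _.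
  exact: H.
have D2 : {ae lebesgue, forall x : LT, forall m : nat, Q sh 0 m.+1%:R x ->
    (tail f (2 ^+ level m) x < +oo)%E}.
  apply: ae_foralln => m; apply: tail_ae_fin => //.
  by rewrite exprn_ege1// ler1n.
apply: filterS2 D1 D2 => x H1 H2.
have [m xm] := Q_nat_cover sh (x : Rn).
pose k0 := level m.
pose u (j : nat) : \bar R :=
  potential (riesz_kernel W alpha) (fun y => f y * \1_(dyadic_shell sh (2 ^+ k0) j) y) x.
have u0 j : (0 <= u j)%E by exact: riesz_potential_ge0 pW _ _.
have tailE (a : nat) : tail f (2 ^+ (a + k0)) x = (\sum_(a <= j <oo) u j)%E.
  by rewrite exprD (tail_potential_shift sh alpha pW).
apply: (@cvg_tail_bound _ k0 (fun k => (C%:E * tail f (2 ^+ k) x)%E)).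
  by move=> k l kl; exact: (H1 k l m).
rewrite -(@cvg_shiftn k0).
have -> : (fun a => C%:E * tail f (2 ^+ (a + k0)) x)%E =
    (fun a => C%:E * \sum_(a <= j <oo) u j)%E by apply/funext => a; rewrite tailE.
have utail : (fun a => \sum_(a <= j <oo) u j)%E @ \oo --> 0%E.
  apply: nneseries_tail_cvg => [|j _]; last exact: u0.
  by have := H2 m xm; rewrite -[level m]add0n tailE.
have Cfin : C%:E \is a fin_num by [].
by have := cvgeZl Cfin utail; rewrite mule0.
Qed.

Lemma dyadic_limit_cvg :
  {ae lebesgue, forall x : LT, t k x @[k --> \oo] --> dyadic_limit sh T f x}.
Proof.
apply: filterS dyadic_cvg => x /cvg_ex[l tl].
rewrite /dyadic_limit.
have : (t k x)%:E @[k --> \oo] --> l%:E by apply: cvg_EFin => //; exact: nearW.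
by move/cvg_limn_einf_sup => [_ ->].
Qed.

(** Let R2 tend to infinity along the powers of 2 in the comparison of the cutoffs at
    R' and R2. *)
Lemma dyadic_limit_close r R' : 0 < r -> 2 * dR * r <= R' ->
  {ae lebesgue, forall x : LT, Q sh 0 r x ->
    (`|dyadic_limit sh T f x|%:E <= `|T (cutoff f R') x|%:E + C%:E * tail f R' x)%E /\
    (`|T (cutoff f R') x - dyadic_limit sh T f x|%:E <= C%:E * tail f R' x)%E}.
Proof.
move=> r0 dr.
have R0 : 0 < R' by rewrite (lt_le_trans _ dr)// !mulr_gt0.
have D : {ae lebesgue, forall x : LT, forall l : nat, R' <= 2 ^+ l -> Q sh 0 r x ->
    (`|t l x - T (cutoff f R') x|%:E <= C%:E * tail f R' x)%E}.
  apply: ae_foralln => l; have [Rl|lR] := leP R' (2 ^+ l); last first.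
    by apply: (@filterE _ (almost_everywhere lebesgue)) => x.
  apply: filterS (difference mf (Lf R0) (Lf (pow0 l)) r0 dr Rl) => x H _.
  exact: H.
apply: filterS2 D dyadic_limit_cvg => x H tl xr.
set b := T (cutoff f R') x; set d := dyadic_limit sh T f x.
have close : (`|b - d|%:E <= C%:E * tail f R' x)%E.
  have [c_fin|] := boolP ((C%:E * tail f R' x)%E \is a fin_num); last first.
    rewrite ge0_fin_numE ?mule_ge0 ?lee_fin ?(ltW C0) ?(tail_potential_ge0 sh alpha pW)//.
    by rewrite ltey negbK => /eqP ->; rewrite leey.
  rewrite -(fineK c_fin) lee_fin distrC.
  have cv : `|t l x - b| @[l --> \oo] --> `|d - b|.
    by apply: cvg_norm; apply: cvgB => //; exact: cvg_cst.
  have cv' : cvgn (fun l => `|t l x - b|) by apply/cvg_ex; exists `|d - b|.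
  rewrite -(cvg_lim (@Rhausdorff R) cv); apply: limr_le => //.
  have [k Rk] : exists k : nat, R' <= 2 ^+ k.
    by exists (Num.bound R'); exact: le_expr2_bound (ltW R0).
  exists k => // l /= kl; rewrite -lee_fin fineK//; apply: H => //.
  by rewrite (le_trans Rk)// ler_weXn2l// ler1n.
split; last exact: close.
apply: le_trans (leeD2l _ close); rewrite -EFinD lee_fin.
by have := ler_normB b (b - d); rewrite subKr.
Qed.

End dyadic_limit.

(** * Integrals of functions that need not be measurable *)

Import HBNNSimple.

Section lower_integrals.
Context d {T : measurableType d} {R : realType}.
Variable mu : {measure set T -> \bar R}.
Local Open Scope ereal_scope.
Implicit Types (f g : T -> \bar R) (D : set T).

(** The integral of a nonnegative function is the supremum of the integrals of the
    simple functions below it, which is monotone for all functions. *)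
Lemma le_lower_integral D f g : (forall x, D x -> 0 <= f x) ->
  (forall x, D x -> f x <= g x) ->
  \int[mu]_(x in D) f x <= \int[mu]_(x in D) g x.
Proof.
move=> f0 fg; rewrite (integral_mkcond D f) (integral_mkcond D g).
have F0 x : 0 <= (f \_ D) x by apply: erestrict_ge0.
have FG x : (f \_ D) x <= (g \_ D) x by apply: lee_restrict.
rewrite !ge0_integralTE//; last by move=> x; exact: le_trans (FG x).
apply: ereal_sup_le => _ [h /= hf <-]; exists h => //= x.
exact: le_trans (hf x) (FG x).
Qed.

Lemma lower_integral_subset D E g : D `<=` E -> (forall x, E x -> 0 <= g x) ->
  \int[mu]_(x in D) g x <= \int[mu]_(x in E) g x.
Proof.
move=> DE g0; rewrite (integral_mkcond D) (integral_mkcond E).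
apply: le_lower_integral => x _.
  by apply: erestrict_ge0 => y /DE; exact: g0.
rewrite !patchE; case: ifPn => [/set_mem/DE Ex|_]; first by rewrite mem_set.
by case: ifPn => // /set_mem/g0.
Qed.

(** A simple function below g obeys the bound on each D k, and monotone convergence
    carries the bound to the union. *)
Lemma lower_integral_bigcup_le (D : nat -> set T) g (M : \bar R) :
  (forall k, measurable (D k)) -> nondecreasing_seq D ->
  (forall x, (\bigcup_k D k) x -> 0 <= g x) ->
  (forall k, \int[mu]_(x in D k) g x <= M) ->
  \int[mu]_(x in \bigcup_k D k) g x <= M.
Proof.
move=> mD ndD g0 gM.
set U := \bigcup_k D k.
rewrite integral_mkcond ge0_integralTE; last by move=> x; exact: erestrict_ge0.
apply: ge_ereal_sup => _ [h /= hg <-].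
have h0 x : 0 <= (h x)%:E by rewrite lee_fin.
have mh (V : set T) : measurable_fun V (EFin \o h) by apply: measurable_funTS; apply/measurable_EFinP.
rewrite -integralT_nnsfun.
have -> : \int[mu]_x (h x)%:E = \int[mu]_(x in U) (h x)%:E.
  rewrite [RHS]integral_mkcond; apply: eq_integral => x _.
  rewrite patchE; case: ifPn => // xU.
  apply/eqP; rewrite eq_le h0 andbT; have := hg x.
  by rewrite patchE (negbTE xU).
have cv := @ge0_nondecreasing_set_cvg_integral _ _ _ D _ mu ndD mD (fun i => mh (D i)) (fun i x _ => h0 x).
rewrite -(cvg_lim _ cv)//; apply: lime_le; first by apply/cvg_ex; eexists; exact: cv.
apply: nearW => k; apply: le_trans (gM k).
apply: le_lower_integral => [x _|x Dx]; first exact: h0.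
have := hg x; rewrite patchE mem_set//; by exists k.
Qed.

Section steps.
Variables (B : nat -> set T) (c : nat -> \bar R).
Hypotheses (mB : forall k, measurable (B k)) (c0 : forall k, 0 <= c k).

Let step x := \sum_(k <oo) (cst (c k) \_ (B k)) x.

Let term_ge0 k x : 0 <= (cst (c k) \_ (B k)) x.
Proof. by apply: erestrict_ge0 => y _; exact: c0. Qed.

Let integral_step : \int[mu]_x step x = \sum_(k <oo) (c k * mu (B k)).
Proof.
rewrite /step integral_nneseries; last 3 first.
- exact: measurableT.
- by move=> k; apply/(measurable_restrictT _ (mB k)); exact: measurable_cst.
- by move=> k x _; exact: term_ge0.
by apply: eq_eseriesr => k _; rewrite -integral_mkcond integral_cst.
Qed.

(** Comparison with step functions takes the place of additivity, which fails for
    integrands that are not measurable. *)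
Lemma lower_integral_le_step g : (forall x, (\bigcup_k B k) x -> 0 <= g x) ->
  (forall k x, B k x -> g x <= c k) ->
  \int[mu]_(x in \bigcup_k B k) g x <= \sum_(k <oo) (c k * mu (B k)).
Proof.
move=> g0 gc; rewrite -integral_step integral_mkcond.
apply: le_lower_integral => x _; first exact: erestrict_ge0.
rewrite patchE; case: ifPn => [/set_mem[k _ Bx]|_]; last exact: nneseries_ge0.
apply: le_trans (gc _ _ Bx) _.
have := @nneseries_term_le R (fun k => (cst (c k) \_ (B k)) x) k (term_ge0 ^~ x).
by rewrite patchE mem_set.
Qed.

Lemma step_le_lower_integral g : trivIset setT B ->
  (forall x, (\bigcup_k B k) x -> 0 <= g x) ->
  (forall k x, B k x -> c k <= g x) ->
  \sum_(k <oo) (c k * mu (B k)) <= \int[mu]_(x in \bigcup_k B k) g x.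
Proof.
move=> tB g0 gc; rewrite -integral_step [leRHS]integral_mkcond.
apply: le_lower_integral => x _; first exact: nneseries_ge0.
rewrite patchE; case: ifPn => [/set_mem[k _ Bx]|xU].
  rewrite /step (@nneseriesD1 _ _ k xpredT)//.
  rewrite [X in _ + X](_ : _ = 0) ?adde0; last first.
    apply: eseries0 => i _ /=; rewrite patchE => ik; case: ifPn => // /set_mem Bi.
    by rewrite (tB i k I I) ?eqxx// in ik; exists x.
  by rewrite patchE mem_set//; exact: gc.
rewrite /step eseries0// => k _ _ /=; rewrite patchE; case: ifPn => // /set_mem Bx.
by case/negP: xU; apply: mem_set; exists k.
Qed.

End steps.

End lower_integrals.

(** * Norms in L^u (I, dr/r) of increasing functions multiplied by a weight *)

(** Explicit constants, so that they are seen to depend on the weight and not on F. *)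
Definition Lu_growth_const (R : realType) (k1 : R) (u : \bar R) : R :=
  if u is v%:E then k1 * 2 `^ v^-1 else k1.

Definition Lu_bound_const (R : realType) (k k1 a : R) (u : \bar R) : R :=
  if u is v%:E then k * k1 * (2 / (1 - a `^ v)) `^ v^-1 else k * k1.

Lemma Lu_bound_const_gt0 (R : realType) (k k1 a : R) (u : \bar R) : 0 < k -> 0 < k1 -> 0 < a < 1 ->
  (0 < u)%E -> 0 < Lu_bound_const k k1 a u.
Proof.
move=> k0 k10 /andP[a0 a1]; case: u => [v v0|_|//]; last exact: mulr_gt0.
have v0' : 0 < v by [].
rewrite /= mulr_gt0 ?mulr_gt0// powR_gt0// divr_gt0// subr_gt0.
exact: powR_lt1 (ltW a0) a1 v0'.
Qed.

Section dyadic_weights.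
Context {R : realType}.
Variables (w : R -> R) (F FY : R -> \bar R) (sigma gamma D C c0 : R).
Hypotheses (w0 : forall r : R, 0 < r -> 0 < w r) (D0 : 0 < D) (sigma0 : 0 < sigma).
Hypothesis wD : forall r x : R, 0 < r -> 1 <= x -> w r <= D * x `^ sigma * w (x * r).
Hypotheses (sg : sigma + gamma < 0) (c01 : 1 <= c0) (C0 : 0 < C).
Hypotheses (F0 : forall r : R, 0 < r -> (0 <= F r)%E)
  (FY0 : forall r : R, 0 < r -> (0 <= FY r)%E).
Hypothesis Fmono : forall r t : R, 0 < r -> r <= t -> (F r <= F t)%E.
Hypothesis FYle : forall r M : R, 0 < r -> 0 < M ->
  (forall j : nat, F (c0 * (2 ^+ j * r))%R <= (M * (2 ^+ j) `^ (- gamma))%:E)%E ->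
  (FY r <= (C * M)%:E)%E.

Local Notation h := (fun r => (w r)%:E * F r)%E.
Local Notation hY := (fun r => (w r)%:E * FY r)%E.

Let h0 (r : R) : 0 < r -> (0 <= h r)%E.
Proof. by move=> r0; rewrite mule_ge0 ?F0// lee_fin ltW ?w0. Qed.

Let hY0 (r : R) : 0 < r -> (0 <= hY r)%E.
Proof. by move=> r0; rewrite mule_ge0 ?FY0// lee_fin ltW ?w0. Qed.

Let w_le (r t : R) : 0 < r -> r <= t -> w r <= D * (t / r) `^ sigma * w t.
Proof.
move=> r0 rt; have := @wD r (t / r) r0; rewrite divfK ?gt_eqF//; apply.
by rewrite ler_pdivlMr// mul1r.
Qed.

Let h_le (r t x : R) : 0 < r -> r <= t -> t <= x * r -> (h r <= (D * x `^ sigma)%:E * h t)%E.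
Proof.
move=> r0 rt tx; have t0 : 0 < t := lt_le_trans r0 rt.
rewrite muleA -EFinM; apply: lee_pmul; [by rewrite lee_fin ltW ?w0|exact: F0| |exact: Fmono].
rewrite lee_fin; apply: le_trans (w_le r0 rt) _.
apply: ler_wpM2r; first by rewrite ltW ?w0.
apply: ler_wpM2l; first exact: ltW.
apply: le_powR_pos; last exact: ltW.
- by rewrite divr_ge0 ?ltW.
- by rewrite ler_pdivrMr.
Qed.

(** In terms of h, the premise of FYle asks for a bound of a ^ j h (2 ^ j r). *)
Let a := 2 `^ (sigma + gamma).

Let a_gt0 : 0 < a. Proof. exact: powR_gt0. Qed.

Let a_lt1 : a < 1. Proof. exact: powR2_lt1. Qed.

(** At a radius at most 2 r0, dilation by c0 stays below 2 ^ m r0. *)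
Let m := Num.bound (2 * c0).

Let c0m : 2 * c0 <= 2 ^+ m.
Proof.
apply: le_expr2_bound; rewrite mulr_ge0//; exact: le_trans ler01 c01.
Qed.

Let kap := C * D * (2 ^+ m) `^ sigma.

Let kap0 : 0 < kap.
Proof. by rewrite /kap !mulr_gt0// powR_gt0// exprn_gt0. Qed.

(** The weight at r is at most D (2 ^ (j + m)) ^ sigma times the weight at
    2 ^ (j + m) r0, and F increases, so a bound of a ^ j h (2 ^ (j + m) r0) uniform in j
    gives the hypothesis of FYle with M of the order of S / w r. *)
Let hY_le_fin (r0 r S : R) : 0 < r0 -> r0 <= r -> r <= 2 * r0 -> 0 < S ->
  (forall j, (a ^+ j)%:E * h (2 ^+ (j + m) * r0)%R <= S%:E)%E ->
  (hY r <= (kap * S)%:E)%E.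
Proof.
move=> r00 r0r r2 S0 bS; have r_gt0 : 0 < r := lt_le_trans r00 r0r.
have wr := w0 r_gt0.
pose M := D * (2 ^+ m) `^ sigma * S / w r.
have M0 : 0 < M by rewrite /M !mulr_gt0 ?invr_gt0// powR_gt0// exprn_gt0.
have : (FY r <= (C * M)%:E)%E.
  apply: FYle => // j.
  pose t := 2 ^+ (j + m) * r0.
  have t0 : 0 < t by rewrite mulr_gt0 ?exprn_gt0.
  have cr : c0 * (2 ^+ j * r) <= t.
    have -> : t = 2 ^+ m * (2 ^+ j * r0) by rewrite /t exprD mulrA [_ * 2 ^+ m]mulrC.
    apply: (@le_trans _ _ (c0 * (2 ^+ j * (2 * r0)))).
      apply: ler_wpM2l; first exact: le_trans ler01 c01.
      by apply: ler_wpM2l; first exact: exprn_ge0.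
    have -> : c0 * (2 ^+ j * (2 * r0)) = 2 * c0 * (2 ^+ j * r0) by ring.
    by apply: ler_wpM2r => //; rewrite mulr_ge0 ?exprn_ge0 ?ltW.
  have c0r : 0 < c0 * (2 ^+ j * r).
    by rewrite mulr_gt0 ?(lt_le_trans ltr01 c01)// mulr_gt0 ?exprn_gt0.
  have rt : r <= t.
    apply: le_trans cr; apply: (@le_trans _ _ (2 ^+ j * r)).
      by apply: ler_peMl; [exact: ltW|rewrite exprn_ege1// ler1n].
    by apply: ler_peMl => //; rewrite mulr_ge0 ?exprn_ge0 ?ltW.
  apply: le_trans (Fmono c0r cr) _.
  have tr : t <= 2 ^+ (j + m) * r by apply: ler_wpM2l => //; exact: exprn_ge0.
  have aj0 : 0 < a ^+ j by exact: exprn_gt0.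
  rewrite -(@lee_pmul2l _ (w r)%:E)// ?lte_fin//.
  have e : (w r * (M * (2 ^+ j) `^ (- gamma)) =
     D * (2 ^+ (j + m)) `^ sigma * (S / a ^+ j)).
    have p2 k (x : R) : (2 ^+ k) `^ x = 2 `^ (k%:R * x) by rewrite -powR_mulrn// powRrM.
    have -> : w r * (M * (2 ^+ j) `^ (- gamma)) = D * (2 ^+ m) `^ sigma * S * (2 ^+ j) `^ (- gamma).
      by rewrite /M; move: wr => /gt_eqF/negbT wr'; field.
    have -> : (a ^+ j)^-1 = 2 `^ (- (j%:R * (sigma + gamma))).
      by rewrite /a -[X in X^-1]powR_mulrn ?powR_ge0// -powRrM powRN mulrC.
    rewrite !p2 natrD.
    have -> : (j%:R + m%:R) * sigma = m%:R * sigma + j%:R * sigma by ring.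
    have -> : - (j%:R * (sigma + gamma)) = - (j%:R * sigma) + j%:R * - gamma by ring.
    rewrite !powRDp// powRN.
    by field.
  rewrite -[leRHS]EFinM e.
  have hr : ((w r)%:E * F t <= (D * (2 ^+ (j + m)) `^ sigma)%:E * h t)%E.
    rewrite muleA -EFinM; apply: lee_wpmul2r; first exact: F0.
    rewrite lee_fin; apply: le_trans (w_le r_gt0 rt) _.
    apply: ler_wpM2r; first by rewrite ltW ?w0.
    apply: ler_wpM2l; first exact: ltW.
    apply: le_powR_pos; last exact: ltW.
    - by rewrite divr_ge0 ?ltW.
    - by rewrite ler_pdivrMr.
  apply: (le_trans hr); rewrite [leRHS]EFinM.
  apply: lee_wpmul2l; first by rewrite lee_fin mulr_ge0 ?powR_ge0 ?ltW.
  have := bS j; rewrite -/t => bj.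
  rewrite -(@lee_pmul2l _ (a ^+ j)%:E)// ?lte_fin// -[leRHS]EFinM.
  by rewrite [(a ^+ j * _)%R]mulrC divfK// gt_eqF.
move=> FYM; apply: le_trans (lee_wpmul2l _ FYM) _; first by rewrite lee_fin ltW.
rewrite -EFinM lee_fin le_eqVlt; apply/orP; left; apply/eqP.
by rewrite /kap /M; move: wr => /gt_eqF/negbT wr'; field.
Qed.

Let hY_le (r0 r : R) (S : \bar R) : 0 < r0 -> r0 <= r -> r <= 2 * r0 -> (0 <= S)%E ->
  (forall j, (a ^+ j)%:E * h (2 ^+ (j + m) * r0)%R <= S)%E ->
  (hY r <= kap%:E * S)%E.
Proof.
move=> r00 r0r r2; case: S => [S S0 bS|_ _|//]; last first.
  by rewrite gt0_muley ?lte_fin ?leey.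
apply/lee_addgt0Pr => e e0; rewrite -EFinM -EFinD.
have -> : kap * S + e = kap * (S + e / kap).
  by rewrite mulrDr [kap * (e / kap)]mulrC divfK ?gt_eqF.
have Se : 0 < S + e / kap by rewrite ltr_wpDl// divr_gt0.
apply: hY_le_fin r00 r0r r2 Se _ => j; apply: le_trans (bS j) _.
by rewrite lee_fin lerDl ltW// divr_gt0.
Qed.

Let B (r0 : R) (k : nat) := `[2 ^+ k * r0, 2 ^+ k.+1 * r0[%classic.

Let measurable_B (r0 : R) k : measurable (B r0 k).
Proof. exact: measurable_itv. Qed.

Let measure_B (r0 : R) k : 0 < r0 -> lebesgue_measure (B r0 k) = (2 ^+ k * r0)%:E.
Proof.
move=> r00; have p0 : 0 < 2 ^+ k * r0 by rewrite mulr_gt0// exprn_gt0.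
rewrite lebesgue_measure_itv /= lte_fin.
have -> : 2 ^+ k.+1 * r0 = 2 * (2 ^+ k * r0) by rewrite exprS mulrA.
rewrite ifT; last by rewrite ltr_pMl// ltr1n.
by rewrite -EFinD; congr (_%:E); ring.
Qed.

Let B_cover (r0 : R) : 0 < r0 -> `[r0, +oo[%classic = \bigcup_k B r0 k.
Proof.
move=> r00; apply/seteqP; split => [r|r [k _]]; rewrite /B /= !in_itv /= ?andbT.
  move=> r0r; have [k kr] := exists_dyadic r00 r0r.
  by exists k; rewrite //= in_itv.
move=> /andP[kr _]; apply: le_trans kr; apply: ler_peMl; first exact: ltW.
by rewrite exprn_ege1// ler1n.
Qed.

Let B_triv (r0 : R) : 0 < r0 -> trivIset setT (B r0).
Proof.
move=> r00 i j _ _ [r []]; rewrite /B /= !in_itv /= => /andP[i1 i2] /andP[j1 j2].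
have key k l : 2 ^+ k * r0 <= r -> r < 2 ^+ l.+1 * r0 -> (k <= l)%N.
  move=> kr rl; rewrite -ltnS; have := le_lt_trans kr rl.
  by rewrite ltr_pM2r// ltr_eXn2l// ltr1n.
by apply/eqP; rewrite eqn_leq key// key.
Qed.

Let kap1 := D * 2 `^ sigma.

Let kap10 : 0 < kap1.
Proof. by rewrite mulr_gt0// powR_gt0. Qed.

Section finite_exponent.
Variable v : R.
Hypothesis v0 : 0 < v.
Local Open Scope ereal_scope.

Let vn0 : v != 0%R. Proof. by rewrite gt_eqF. Qed.

Let poweRK (x : \bar R) : 0 <= x -> (x `^ v^-1) `^ v = x.
Proof. by move=> x0; rewrite -poweRrM mulVf// poweRe1. Qed.

Let poweRVK (x : \bar R) : 0 <= x -> (x `^ v) `^ v^-1 = x.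
Proof. by move=> x0; rewrite -poweRrM mulfV// poweRe1. Qed.

Let b (r0 : R) (k : nat) := h (2 ^+ k * r0)%R `^ v.

Let b_ge0 r0 k : 0 <= b r0 k. Proof. exact: poweR_ge0. Qed.

Let integrand_ge0 (G : R -> \bar R) (r : R) : (0 < r)%R -> 0 <= G r `^ v * (r^-1)%:E.
Proof. by move=> r0; rewrite mule_ge0 ?poweR_ge0// lee_fin invr_ge0 ltW. Qed.

Let itv_gt0 (r0 r : R) : (0 < r0)%R -> (\bigcup_k B r0 k) r -> (0 < r)%R.
Proof. by move=> r00; rewrite -B_cover//= in_itv/= andbT; exact: lt_le_trans. Qed.

Let B_bounds (r0 : R) k r : (0 < r0)%R -> B r0 k r ->
  [/\ (0 < 2 ^+ k * r0)%R, (0 < r)%R, (2 ^+ k * r0 <= r)%R & (r < 2 * (2 ^+ k * r0))%R].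
Proof.
move=> r00; rewrite /B /= in_itv /= exprS -mulrA => /andP[kr rk].
have p0 : (0 < 2 ^+ k * r0)%R by rewrite mulr_gt0// exprn_gt0.
by split => //; exact: lt_le_trans kr.
Qed.

(** On the block B r0 k, of measure 2 ^ k r0, h is at least its value at the left end
    divided by kap1, and 1 / r is at least 1 / (2 ^ (k + 1) r0). *)
Let sum_le (r0 : R) : (0 < r0)%R ->
  \sum_(k <oo) b r0 k <= (2 * kap1 `^ v)%:E *
    \int[lebesgue_measure]_(r in `[r0, +oo[) (h r `^ v * (r^-1)%:E).
Proof.
move=> r00; rewrite B_cover//.
pose c k := b r0 k * ((kap1 `^ v)^-1 * (2 * (2 ^+ k * r0))^-1)%:E.
have k1v : (0 < kap1 `^ v)%R by rewrite powR_gt0.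
have c_ge0 k : 0 <= c k.
  rewrite mule_ge0// lee_fin mulr_ge0 ?invr_ge0 ?powR_ge0// mulr_ge0//.
  by rewrite mulr_ge0 ?exprn_ge0// ltW.
have -> : \sum_(k <oo) b r0 k =
    (2 * kap1 `^ v)%:E * \sum_(k <oo) (c k * lebesgue_measure (B r0 k)).
  rewrite -nneseriesZl; last by move=> k _; rewrite mule_ge0.
  apply: eq_eseriesr => k _; rewrite /c measure_B// -muleA -EFinM muleC -muleA -EFinM.
  rewrite [X in _ * X%:E](_ : _ = 1%R) ?mule1//.
  have p0 : (2 ^+ k * r0 != 0)%R by rewrite gt_eqF// mulr_gt0// exprn_gt0.
  have p1 : (kap1 `^ v != 0)%R by rewrite gt_eqF.
  by move: (2 ^+ k * r0)%R p0 => P P0; field; rewrite P0 p1.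
apply: lee_wpmul2l; first by rewrite lee_fin mulr_ge0// ltW.
apply: step_le_lower_integral => //; [exact: measurable_B|exact: B_triv| |].
  by move=> r /(itv_gt0 r00); exact: (integrand_ge0 h).
move=> k r /(B_bounds r00)[p0 r_gt0 pr rp].
rewrite /c EFinM muleA; apply: lee_pmul.
- by rewrite mule_ge0// lee_fin invr_ge0 powR_ge0.
- by rewrite lee_fin invr_ge0 mulr_ge0// ltW.
- rewrite muleC -(@lee_pmul2l _ (kap1 `^ v)%:E)// ?lte_fin// muleA -EFinM.
  rewrite mulfV ?gt_eqF// mul1e /b -poweR_EFin -poweRM ?lee_fin ?h0 ?(ltW kap10)//.
  apply: le_poweR; [exact: ltW|exact: h0|].
  by apply: h_le => //; exact: ltW.
- by rewrite lee_fin lef_pV2 ?posrE ?mulr_gt0//; exact: ltW.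
Qed.

(** On the block B r0 k, hY is bounded by the supremum over j of the
    a ^ j h (2 ^ (j + m + k) r0), hence its power v by the sum over j of their powers.
    Summing over k first leaves a geometric series in j. *)
Let integral_hY_le (r0 : R) : (0 < r0)%R ->
  \int[lebesgue_measure]_(r in `[r0, +oo[) (hY r `^ v * (r^-1)%:E) <=
  (kap `^ v * (1 - a `^ v)^-1)%:E * \sum_(k <oo) b r0 k.
Proof.
move=> r00; rewrite B_cover//.
pose s k := \sum_(j <oo) (((a `^ v) ^+ j)%:E * b r0 (j + (m + k))%N).
have av0 : (0 < a `^ v)%R by rewrite powR_gt0.
have sj0 k j : 0 <= ((a `^ v) ^+ j)%:E * b r0 (j + (m + k))%N.
  by rewrite mule_ge0// lee_fin exprn_ge0// ltW.
have s0 k : 0 <= s k by apply: nneseries_ge0.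
pose c k := (kap `^ v)%:E * s k * ((2 ^+ k * r0)^-1)%:E.
have kv0 : (0 <= kap `^ v)%R by rewrite powR_ge0.
have c_ge0 k : 0 <= c k.
  rewrite mule_ge0 ?mule_ge0 ?lee_fin// invr_ge0.
  by rewrite mulr_ge0 ?exprn_ge0// ltW.
apply: (@le_trans _ _ (\sum_(k <oo) (c k * lebesgue_measure (B r0 k)))).
  apply: lower_integral_le_step => //; first exact: measurable_B.
    by move=> r /(itv_gt0 r00); exact: (integrand_ge0 hY).
  move=> k r /(B_bounds r00)[p0 r_gt0 pr rp]; apply: lee_pmul.
  - exact: poweR_ge0.
  - by rewrite lee_fin invr_ge0 ltW.
  - have := @hY_le _ _ (s k `^ v^-1) p0 pr (ltW rp) (poweR_ge0 _ _).
    move=> hYk; have {}hYk := le_poweR (ltW v0) (hY0 r_gt0) (hYk _).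
    apply: le_trans (hYk _) _; last first.
      by rewrite poweRM ?poweR_ge0 ?lee_fin ?(ltW kap0)// poweR_EFin poweRK.
    move=> j; rewrite -[leLHS]poweRVK; last first.
      rewrite mule_ge0 ?lee_fin ?exprn_ge0 ?(ltW a_gt0)// h0//.
      by rewrite mulr_gt0 ?exprn_gt0.
    apply: le_poweR; [by rewrite invr_ge0 ltW|exact: poweR_ge0|].
    rewrite poweRM ?lee_fin ?exprn_ge0 ?(ltW a_gt0)//; last first.
      by rewrite h0// mulr_gt0 ?exprn_gt0.
    rewrite poweR_EFin -[X in (X `^ v)%R](powR_mulrn j (ltW a_gt0)) powRAC.
    rewrite powR_mulrn ?powR_ge0//.
    have -> : (2 ^+ (j + m) * (2 ^+ k * r0) = 2 ^+ (j + (m + k)) * r0)%R.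
      by rewrite mulrA -exprD addnA.
    exact: (nneseries_term_le j (sj0 k)).
  - by rewrite lee_fin lef_pV2.
rewrite [leLHS](_ : _ = (kap `^ v)%:E * \sum_(k <oo) s k); last first.
  rewrite -nneseriesZl//; apply: eq_eseriesr => k _.
  rewrite measure_B// /c -muleA -EFinM mulVf ?mule1//.
  by rewrite gt_eqF// mulr_gt0// exprn_gt0.
rewrite EFinM -muleA; apply: lee_wpmul2l; first by rewrite lee_fin.
rewrite /s nneseries_interchange//.
have av1 : (a `^ v < 1)%R by exact: powR_lt1 (ltW a_gt0) a_lt1 v0.
have B0 : 0 <= \sum_(k <oo) b r0 k by apply: nneseries_ge0.
apply: (@le_trans _ _ (\sum_(j <oo) (((a `^ v) ^+ j)%:E * \sum_(k <oo) b r0 k))).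
  apply: lee_nneseries => [j _ _|j _]; first by apply: nneseries_ge0.
  rewrite nneseriesZl//; apply: lee_wpmul2l; first by rewrite lee_fin exprn_ge0// ltW.
  rewrite (eq_eseriesr (g := fun k => b r0 (k + (j + m))%N)); last first.
    by move=> k _; rewrite addnA addnC.
  rewrite nneseries_addn// [leRHS](@nneseries_split _ _ 0 (j + m))// add0n.
  by rewrite leeDr// sume_ge0.
have av01 : (0 < a `^ v < 1)%R by rewrite av0.
have geo := nneseries_geometric_le av01.
case: (\sum_(k <oo) b r0 k) B0 => [x x0|_|//].
  under eq_eseriesr do rewrite muleC.
  rewrite nneseriesZl; last by move=> i _; rewrite lee_fin exprn_ge0// ltW.
  by rewrite muleC lee_wpmul2r.
by rewrite gt0_muley ?leey// lte_fin invr_gt0 subr_gt0.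
Qed.

Variables (I : set R) (rho : nat -> R).
Hypotheses (rho0 : forall N, (0 < rho N)%R)
  (ndI : nondecreasing_seq (fun N => `[rho N, +oo[%classic))
  (IE : I = \bigcup_N `[rho N, +oo[%classic).

Let I_up (r : R) : I r -> (0 < r)%R /\ `[r, +oo[ `<=` I.
Proof.
rewrite IE => -[N _]; rewrite /= in_itv/= andbT => Nr.
split=> [|t]; first exact: lt_le_trans Nr.
by rewrite /= in_itv/= andbT => rt; exists N; rewrite //= in_itv/= andbT (le_trans Nr).
Qed.

Let sum_le_I (r0 : R) : I r0 ->
  \sum_(k <oo) b r0 k <= (2 * kap1 `^ v)%:E *
    \int[lebesgue_measure]_(r in I) (h r `^ v * (r^-1)%:E).
Proof.
move=> /I_up[r00 sub]; apply: le_trans (sum_le r00) _.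
apply: lee_wpmul2l; first by rewrite lee_fin mulr_ge0 ?powR_ge0.
apply: lower_integral_subset => // r /I_up[rr _]; exact: (integrand_ge0 h).
Qed.

Let int_ge0 : 0 <= \int[lebesgue_measure]_(r in I) (h r `^ v * (r^-1)%:E).
Proof. by apply: integral_ge0 => r /I_up[rr _]; exact: (integrand_ge0 h). Qed.

Let rootM (x y : R) (z : \bar R) : (0 <= x)%R -> (0 <= y)%R -> 0 <= z ->
  ((y `^ v * x)%:E * z) `^ v^-1 = (y * x `^ v^-1)%:E * z `^ v^-1.
Proof.
move=> x0 y0 z0; rewrite poweRM ?lee_fin ?mulr_ge0 ?powR_ge0// poweR_EFin.
by rewrite powRM ?powR_ge0// -powRrM mulfV// powRr1.
Qed.

Lemma finite_Lu_growth (r : R) : I r ->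
  h r <= (Lu_growth_const kap1 v%:E)%:E * Lu_norm v%:E I h.
Proof.
move=> Ir; have [r0 _] := I_up Ir.
rewrite /= -rootM ?(ltW kap10)// -[leLHS](poweRVK (h0 r0)).
apply: le_poweR; [by rewrite invr_ge0 ltW|exact: poweR_ge0|].
rewrite [(kap1 `^ v * 2)%R]mulrC; apply: le_trans (sum_le_I Ir).
by have := @nneseries_term_le R (b r) 0 (b_ge0 r); rewrite /b expr0 mul1r.
Qed.

Lemma finite_Lu_bound :
  Lu_norm v%:E I hY <= (Lu_bound_const kap kap1 a v%:E)%:E * Lu_norm v%:E I h.
Proof.
have av1 : (a `^ v < 1)%R by exact: powR_lt1 (ltW a_gt0) a_lt1 v0.
have av10 : (0 <= (1 - a `^ v)^-1)%R by rewrite invr_ge0 subr_ge0 ltW.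
have av20 : (0 <= 2 / (1 - a `^ v))%R by exact: mulr_ge0.
rewrite /= -(rootM av20 (mulr_ge0 (ltW kap0) (ltW kap10)) int_ge0).
apply: le_poweR; first by rewrite invr_ge0 ltW.
  by apply: integral_ge0 => r /I_up[rr _]; exact: (integrand_ge0 hY).
rewrite {1}IE; apply: lower_integral_bigcup_le => // [r|N].
- by rewrite -IE => /I_up[rr _]; exact: (integrand_ge0 hY).
apply: le_trans (integral_hY_le (rho0 N)) _.
have IN : I (rho N) by rewrite IE; exists N; rewrite //= in_itv/= lexx.
apply: le_trans (lee_wpmul2l _ (sum_le_I IN)) _.
  by rewrite lee_fin mulr_ge0 ?powR_ge0.
rewrite muleA -EFinM [in leRHS](powRM v (ltW kap0) (ltW kap10)).
have -> : (kap `^ v / (1 - a `^ v) * (2 * kap1 `^ v) =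
  kap `^ v * kap1 `^ v * (2 / (1 - a `^ v)))%R.
  by move: (kap `^ v)%R (kap1 `^ v)%R ((1 - a `^ v)^-1)%R => x y z; ring.
exact: lexx.
Qed.

End finite_exponent.

Section all_exponents.
Variables (I : set R) (rho : nat -> R).
Hypotheses (rho0 : forall N, 0 < rho N)
  (ndI : nondecreasing_seq (fun N => `[rho N, +oo[%classic))
  (IE : I = \bigcup_N `[rho N, +oo[%classic).
Local Open Scope ereal_scope.

Let I_up (r t : R) : I r -> (r <= t)%R -> I t /\ (0 < r)%R.
Proof.
rewrite IE => -[N _]; rewrite /= in_itv/= andbT => Nr rt.
split; last exact: lt_le_trans Nr.
by exists N; rewrite //= in_itv/= andbT (le_trans Nr).
Qed.

(** The interval [r, 2 r[ has positive measure, so it contains a point where h is at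
    most its essential supremum; h r is at most kap1 times the value there. *)
Let infinite_growth (r : R) : I r ->
  h r <= kap1%:E * ess_sup lebesgue_measure (h \_ I) /\
  0 <= ess_sup lebesgue_measure (h \_ I).
Proof.
move=> Ir; have [_ r0] := I_up Ir (lexx r).
set N := ess_sup _ _.
have aeN : {ae lebesgue_measure, forall x, (h \_ I) x <= N} := ess_sup_ge _ _.
have [t [rt tr tN]] : exists t : R, [/\ (r <= t)%R, (t <= 2 * r)%R & (h \_ I) t <= N].
  apply: contrapT => /forallNP no.
  case: aeN => A [mA A0 subA].
  have BA : B r 0 `<=` A.
    move=> t; rewrite /B /= in_itv /= expr0 mul1r expr1 => /andP[rt tr].
    by apply: subA => /= tN; apply: (no t); split => //; exact: ltW.
  have : lebesgue_measure (B r 0) <= lebesgue_measure A.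
    by apply: le_measure; rewrite ?inE//; exact: measurable_B.
  by rewrite measure_B// A0 expr0 mul1r lee_fin leNgt r0.
have [It _] := I_up Ir rt; have t0 := lt_le_trans r0 rt.
move: tN; rewrite patchE mem_set// => tN; split.
  apply: le_trans (h_le r0 rt tr) _.
  by apply: lee_wpmul2l => //; rewrite lee_fin ltW.
exact: le_trans (h0 t0) tN.
Qed.

Lemma Lu_growth (u : \bar R) (r : R) : 0 < u -> I r ->
  h r <= (Lu_growth_const kap1 u)%:E * Lu_norm u I h.
Proof.
case: u => [v v0|_|//] Ir; first exact: (finite_Lu_growth v0 rho0 IE).
exact: (infinite_growth Ir).1.
Qed.

Lemma Lu_bound (u : \bar R) : 0 < u ->
  Lu_norm u I hY <= (Lu_bound_const kap kap1 a u)%:E * Lu_norm u I h.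
Proof.
case: u => [v v0|_|//]; first exact: (finite_Lu_bound v0 rho0 ndI IE).
rewrite /=; apply/ess_supP; apply: aeW => r.
have I0 : I (rho 0) by rewrite IE; exists 0%N; rewrite //= in_itv/= lexx.
have [_ N0] := infinite_growth I0.
rewrite patchE; case: ifPn => [/set_mem Ir|_]; last first.
  by rewrite mule_ge0// lee_fin mulr_ge0 ?ltW.
have [_ r0] := I_up Ir (lexx r).
rewrite EFinM -muleA; apply: (@hY_le r) => //.
- by rewrite ler_peMl ?ltW// ltr1n.
- by rewrite mule_ge0// lee_fin ltW.
move=> j; have tr : (r <= 2 ^+ (j + m) * r)%R.
  by apply: ler_peMl; [exact: ltW|rewrite exprn_ege1// ler1n].
have [It _] := I_up Ir tr; have [ht _] := infinite_growth It.
apply: le_trans ht; apply: gee_pMl => //.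
- by rewrite h0// (lt_le_trans r0).
- by rewrite lee_fin exprn_ile1 ?ltW.
Qed.

End all_exponents.

End dyadic_weights.

(** * The extension and its local bound *)

Section extension_limits.
Context {R : realType} {n : nat}.
Local Notation Rn := 'rV[R]_n.+1.
Local Notation LT := (lebesgueT R n).

Lemma powR_cvg_pinfty (a : R) : 0 < a -> r `^ (- a) @[r --> +oo] --> (0 : R).
Proof.
move=> a0; apply/cvgr0Pnorm_le => e e0.
have b0 : 0 < e `^ (- a^-1) by rewrite powR_gt0.
exists (e `^ (- a^-1)); split; first exact: num_real.
move=> r br; rewrite ger0_norm ?powR_ge0//.
apply: (@le_trans _ _ ((e `^ (- a^-1)) `^ (- a))).
  by apply: le_powR_neg; rewrite ?oppr_le0 ?ltW.
by rewrite -powRrM mulrNN mulVf ?gt_eqF// powRr1 ?lexx// ltW.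
Qed.

(** When g vanishes outside some Q (0, R0), its cutoffs are eventually g itself, so
    that every extension of T has the value T g at g. *)
Lemma extension_limit_eq sh (q R0 : R) (T : (Rn -> R) -> Rn -> R) (g g' : LT -> R) :
  0 < q -> measurable_fun [set: LT] (T g) -> measurable_fun [set: LT] g' ->
  (forall r, R0 <= r -> g \* \1_(Q sh (0 : Rn) r) = g)%R ->
  extension_limit sh q T g g' -> {ae lebesgue, forall x : LT, g' x = T g x}.
Proof.
move=> q0 mT mg' gE.
have nearE : \forall r \near +oo, (g \* \1_(Q sh (0 : Rn) r) = g)%R.
  by exists R0; split => [|r /ltW]; [exact: num_real|exact: gE].
case=> [lim|lim].
  apply: filterS lim => x gx.
  have gx' : T (g \* \1_(Q sh (0 : Rn) r))%R x @[r --> +oo%R] --> T g x.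
    apply: cvg_near_cst; apply: filterS nearE => r -> //.
  exact: (cvg_unique (@Rhausdorff R) gx gx').
have mD : measurable_fun [set: LT] (fun y => (`|T g y - g' y| `^ q)%:E).
  by apply: measurable_EFin_normr_powR; exact: measurable_funB.
have H (m : nat) : {ae lebesgue, forall x : LT, Q sh 0 m.+1%:R x -> g' x = T g x}.
  have m0 : 0 < m.+1%:R :> R by [].
  set c := (\int[lebesgue]_(y in (Q sh (0 : Rn) m.+1%:R : set LT))
    (`|T g y - g' y| `^ q)%:E)%E.
  have c0 : c = 0%E.
    apply: (cvg_unique (@ereal_hausdorff R) _ (lim _ m0)).
    by apply: cvg_near_cst; apply: filterS nearE => r ->.
  have mQ := measurable_Q sh (0 : Rn) m.+1%:R.
  have : ae_eq lebesgue (Q sh (0 : Rn) m.+1%:R : set LT)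
      (fun y => (`|T g y - g' y| `^ q)%:E) (cst 0%E).
    apply/(ae_eq_integral_abs lebesgue mQ (measurable_funTS mD)).
    by rewrite -[RHS]c0; apply: eq_integral => y _; rewrite gee0_abs// lee_fin powR_ge0.
  apply: filterS => x H xm; have [/powR_eq0_eq0/eqP] := H xm.
  by rewrite normr_eq0 subr_eq0 => /eqP ->.
apply: filterS (ae_foralln H) => x Hx.
by have [m xm] := Q_nat_cover sh (x : Rn); exact: Hx xm.
Qed.

End extension_limits.

Section extension.
Context {R : realType} {n : nat}.
Local Notation Rn := 'rV[R]_n.+1.
Local Notation LT := (lebesgueT R n).
Local Notation BT := (borelT R n).
Local Notation dR := (n.+1%:R : R).
Local Notation kap sh p := (kappa R n sh `^ (p^-1)).

Lemma morrey_norm_mono sh (p lambda r1 r2 : R) (f : Rn -> R) : r1 <= r2 ->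
  (morrey_norm sh p lambda (Q sh 0 r1) f <= morrey_norm sh p lambda (Q sh 0 r2) f)%E.
Proof.
move=> r12; apply: le_ereal_sup => _ [[z s] [/= s0 sub] <-]; exists (z, s) => //.
by split => // x /sub; rewrite !QE /= => /lt_le_trans; apply.
Qed.

Lemma averaged_norm_ge0 (J : set LT -> (LT -> R) -> \bar R) sh (q mu r : R) (f : LT -> R) :
  0 < r -> (0 <= averaged_norm J sh q mu (Q sh 0 r) f)%E.
Proof.
move=> r0; apply: (@le_trans _ _ (((r `^ mu)^-1)%:E *
    ((lebesgue (Q sh (0 : Rn) r))^-1 * J (Q sh (0 : Rn) r) f) `^ q^-1)%E).
  by rewrite mule_ge0 ?poweR_ge0// lee_fin invr_ge0 powR_ge0.
apply: ereal_sup_ubound; exists (0, r); last by [].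
by split; [exact: r0|exact: subset_refl].
Qed.

Lemma morrey_norm_ge0 sh (p lambda r : R) (f : Rn -> R) : 0 < r ->
  (0 <= morrey_norm sh p lambda (Q sh 0 r) f)%E.
Proof. exact: (@averaged_norm_ge0 (strong_integral p)). Qed.

Lemma morrey_norm_le_integral sh (p lambda N : R) (U : set Rn) (f : LT -> R) :
  0 < p -> 0 <= N -> (morrey_norm sh p lambda U f <= N%:E)%E ->
  forall z (s : R), 0 < s -> Q sh z s `<=` U ->
    (strong_integral p (Q sh z s) f <=
     ((N * kap sh p * s `^ lambda) `^ p * s ^+ n.+1)%:E)%E.
Proof.
move=> p0 N0 H; have k0 := @kappa_gt0 R n sh.
have B0 : 0 <= N * kap sh p by rewrite mulr_ge0// powR_ge0.
apply/(@averaged_normP R n (strong_integral p) sh p lambda _ U f p0 B0) => //.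
  by move=> V g'; apply: integral_ge0 => y _; rewrite lee_fin powR_ge0.
rewrite -mulrA -powRDp// subrr powRr0 mulr1; exact: H.
Qed.

(** This provides the hypothesis on shells of the tail estimate. *)
Lemma morrey_norm_shell sh (p lambda N rho : R) (f : LT -> R) : 1 <= p ->
  lambda <= 0 -> 0 <= N -> 0 < rho ->
  (morrey_norm sh p lambda (Q sh 0 (2 * rho)) f <= N%:E)%E ->
  (\int[lebesgue]_(y in (Q sh (0 : Rn) (2 * rho) : set LT)) (`|f y| `^ p)%:E <=
   ((2 ^+ n.+1 * kap sh p * N * rho `^ lambda) `^ p * rho ^+ n.+1)%:E)%E.
Proof.
move=> p1 l0 N0 rho0 H; have p0 : 0 < p := lt_le_trans ltr01 p1.
have r20 : 0 < 2 * rho by rewrite mulr_gt0.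
apply: (le_trans (morrey_norm_le_integral p0 N0 H r20 (@subset_refl _ _))).
have -> : (2 * rho) ^+ n.+1 = 2 ^+ n.+1 * rho ^+ n.+1 by rewrite exprMn.
rewrite lee_fin [leLHS]mulrA.
rewrite ler_wpM2r ?exprn_ge0 ?(ltW rho0)//.
have e2 : (1 : R) <= 2 ^+ n.+1 by rewrite exprn_ege1// ler1n.
have k0 : 0 <= kap sh p by exact: powR_ge0.
apply: (@le_trans _ _ ((N * kap sh p * rho `^ lambda) `^ p * (2 ^+ n.+1) `^ p)).
  apply: ler_pM; [exact: powR_ge0|exact: exprn_ge0| |exact: le1r_powR].
  apply: le_powR_pos; rewrite ?mulr_ge0 ?powR_ge0// ?(ltW p0)//.
  rewrite ler_wpM2l ?mulr_ge0//; apply: le_powR_neg => //.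
  by rewrite ler_peMl ?(ltW rho0)// ler1n.
rewrite -powRM ?mulr_ge0 ?powR_ge0 ?exprn_ge0//.
by rewrite le_eqVlt; apply/orP; left; apply/eqP; congr (_ `^ _); ring.
Qed.

Variables (sh : Q_shape) (T : (Rn -> R) -> Rn -> R) (pt : \bar R) (Omega : Rn -> R).
Variables (p q lambda mu sigma alpha : R).
Hypotheses (p1 : 1 <= p) (q1 : 1 <= q).
Hypotheses (lambda0 : - (dR / p) <= lambda < 0) (mu0 : mu < 0) (sigma0 : 0 < sigma).
Hypotheses (hdef : defined_on_L1comp T) (hdiff : diff_bounded T).
Hypotheses (alphad : 0 <= alpha < dR) (pt1 : (1 <= pt)%E).
Hypotheses (hOmega : homogeneous0 Omega) (LOmega : in_Lp_sphere pt Omega).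
Hypothesis hsize : size_condition T Omega alpha.
Hypothesis cond :
  [/\ mu = lambda + alpha, (hoelder_conjugate p%:E <= pt)%E &
      sigma + lambda + alpha < 0] \/
  [/\ mu = lambda + alpha, (q%:E <= pt)%E &
      (sigma%:E + lambda%:E + n.+1%:R%:E / pt + alpha%:E < 0)%E].
Local Notation F f r := (morrey_norm sh p lambda (Q sh (0 : Rn) r) f).

Section fixed_bound.
Variables (J : set LT -> (LT -> R) -> \bar R) (T0 : (Rn -> R) -> Rn -> R) (C0 : R).
Hypotheses (hJ : quasi_additive q J) (C00 : 0 < C0).
Hypothesis hT0 : forall g, mem_fspace (morrey sh p lambda setT) g ->
  [/\ extension_limit sh q T g (T0 g), measurable_fun [set: LT] (T0 g) &
      (averaged_norm J sh q mu setT (T0 g) <=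
       C0%:E * morrey_norm sh p lambda setT g)%E].

Local Notation cutoff f r := (f \* \1_(Q sh (0 : Rn) r))%R.
Local Notation c0 := (6 * dR * dR).

Let p0 : 0 < p := lt_le_trans ltr01 p1.
Let q0 : 0 < q := lt_le_trans ltr01 q1.
Let d1 : 1 <= dR. Proof. by rewrite ler1n. Qed.
Let l0 : lambda <= 0. Proof. by have /andP[_ /ltW] := lambda0. Qed.

(** Let R' = 2 d r and let g be the cutoff of f at R'. On Q (0, r) the limit differs
    from T g = T0 g by at most a tail at radius R'. The first term is estimated by the
    bound of T on the whole space, where the norm of g is at most the norm of f on
    Q (0, 3 d R') = Q (0, c0 r); the second one by the tail estimate. *)
Lemma dyadic_extension : exists gamma C : R, [/\ sigma + gamma < 0, 0 < C &
  forall (f : LT -> R) (A : R), measurable_fun [set: LT] f ->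
    (forall r, 0 < r -> (F f r < +oo)%E) -> 0 < A ->
    (forall r, 1 <= r -> (F f r <= (A * r `^ sigma)%:E)%E) ->
    [/\ measurable_fun [set: LT] (dyadic_limit sh T f),
        extension_limit sh q T f (dyadic_limit sh T f) &
        forall r M, 0 < r -> 0 < M ->
          (forall j : nat, F f (c0 * (2 ^+ j * r)) <= (M * (2 ^+ j) `^ (- gamma))%:E)%E ->
          (averaged_norm J sh q mu (Q sh 0 r) (dyadic_limit sh T f) <= (C * M)%:E)%E]].
Proof.
have [W [pW aeW]] := homogeneous_borel_representative hOmega pt1 LOmega.
have [mW W0 _ _] := pW.
have mOmega := measurable_homogeneous hOmega LOmega.1.
have [beta [gamma [C [sb bg sg CC0 tailH]]]] :=
  tail_estimate sh pW p1 q1 mu0 sigma0 alphad pt1 cond.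
have [C3 C30 diffH] := cutoff_difference_tail sh hdiff hsize mOmega pW aeW.
have g0 : gamma < 0 by move: sg sigma0; lra.
have kp0 : 0 < kap sh p by rewrite powR_gt0// kappa_gt0.
have kq0 : 0 < kap sh q by rewrite powR_gt0// kappa_gt0.
pose cp := 2 ^+ n.+1 * kap sh p.
have cp0 : 0 < cp by rewrite mulr_gt0// exprn_gt0.
pose a := C0 * kap sh q.
have a0 : 0 < a by rewrite mulr_gt0.
pose b := C3 * (C * (2 * dR) `^ beta * cp).
have bb0 : 0 < b by rewrite !mulr_gt0// powR_gt0// mulr_gt0.
exists gamma, (4 * (a + b) * kappa R n sh `^ (- q^-1)); split; [exact: sg| |].
  by rewrite !mulr_gt0// ?addr_gt0// powR_gt0// kappa_gt0.
move=> f A mf Ffin A0 FA.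
have mtail R' := measurable_tail_potential sh alpha pW R' mf.
have pow0 (j : nat) : 0 < 2 ^+ j :> R by rewrite exprn_gt0.
have pow1 (j : nat) : 1 <= 2 ^+ j :> R by rewrite exprn_ege1// ler1n.
have tailF (r R' M s : R) (z : Rn) : 0 < r -> 0 < s -> 0 < M -> 2 * dR * r <= R' ->
    Q sh z s `<=` Q sh 0 r ->
    (forall j : nat, (F f (2 ^+ j.+1 * R') <= (M * (2 ^+ j) `^ (- gamma))%:E)%E) ->
    (\int[lebesgue]_(x in (Q sh z s : set LT))
        (tail_potential W sh alpha f R' x `^ q) <=
     ((C * (R' / r) `^ beta * (cp * M) * s `^ mu) `^ q * s ^+ n.+1)%:E)%E.
  move=> r0 s0 M0 dr sub FM.
  have R0 : 0 < R' by rewrite (lt_le_trans _ dr)// !mulr_gt0.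
  apply: tailH => // [|j]; first exact: mulr_gt0.
  have N0 : 0 <= M * (2 ^+ j) `^ (- gamma) by rewrite mulr_ge0 ?powR_ge0 ?(ltW M0).
  have rj0 : 0 < 2 ^+ j * R' by rewrite mulr_gt0.
  have := FM j; rewrite exprS -mulrA => FMj.
  have := morrey_norm_shell p1 l0 N0 rj0 FMj.
  by rewrite -/cp !mulrA.
(* as sigma < - gamma, growth of order sigma makes the tails converge *)
have growth (R' : R) (j : nat) : 1 <= R' ->
    (F f (2 ^+ j.+1 * R') <= (A * 2 `^ sigma * R' `^ sigma * (2 ^+ j) `^ (- gamma))%:E)%E.
  move=> R1; have R0 : 0 < R' := lt_le_trans ltr01 R1.
  apply: (le_trans (FA _ _)); first by rewrite mulr_ege1.
  rewrite lee_fin exprS -!mulrA ler_wpM2l ?(ltW A0)//.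
  rewrite !powRM ?mulr_ge0 ?(ltW R0)// ?(ltW (pow0 _))//.
  rewrite ler_wpM2l ?powR_ge0// mulrC ler_wpM2l ?powR_ge0//.
  by apply: ler_powR => //; move: sg; lra.
have Lf r : 0 < r -> L1comp (cutoff f r).
  move=> r0; apply: (L1comp_cutoff mf p1 r0).
  have Fr : F f r \is a fin_num by rewrite ge0_fin_numE ?Ffin// morrey_norm_ge0.
  have F0 : 0 <= fine (F f r) by rewrite fine_ge0// morrey_norm_ge0.
  have FN : (F f r <= (fine (F f r))%:E)%E by rewrite fineK.
  apply: le_lt_trans (morrey_norm_le_integral p0 F0 FN r0 (@subset_refl _ _)) _.
  by rewrite ltry.
have A20 (R' : R) : 0 < R' -> 0 < A * 2 `^ sigma * R' `^ sigma.
  by move=> R0; rewrite !mulr_gt0// powR_gt0.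
have tail_fin r R' : 0 < r -> 2 * dR * r <= R' -> 1 <= R' ->
    (\int[lebesgue]_(x in (Q sh (0 : Rn) r : set LT))
       (tail_potential W sh alpha f R' x `^ q) < +oo)%E.
  move=> r0 dr R1; have R0 : 0 < R' := lt_le_trans ltr01 R1.
  apply: le_lt_trans (tailF r R' _ r 0 r0 r0 (A20 _ R0) dr (@subset_refl _ _) _) _.
    by move=> j; exact: growth.
  by rewrite ltry.
have close := @dyadic_limit_close R n sh T pt alpha W pW C3 C30 diffH f q mf q0 Lf tail_fin.
have mlim : measurable_fun [set: LT] (dyadic_limit sh T f).
  exact: (measurable_dyadic_limit hdef Lf).
have mH R' : measurable_fun [set: LT] (fun x => C3%:E * tail_potential W sh alpha f R' x)%E.
  exact: measurable_funeM.
have H0 R' x : (0 <= C3%:E * tail_potential W sh alpha f R' x)%E.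
  by rewrite mule_ge0 ?lee_fin ?(ltW C30)// (tail_potential_ge0 sh alpha pW).
have mHq R' : measurable_fun [set: LT]
    (fun x => (C3%:E * tail_potential W sh alpha f R' x) `^ q)%E.
  exact: measurableT_comp (measurable_poweR q) (mH R').
have intH (U : set LT) R' : measurable U ->
    (\int[lebesgue]_(x in U) ((C3%:E * tail_potential W sh alpha f R' x) `^ q) =
     (C3 `^ q)%:E * \int[lebesgue]_(x in U) (tail_potential W sh alpha f R' x `^ q))%E.
  move=> mU; rewrite -ge0_integralZl_EFin; last 4 first.
  - exact: mU.
  - by move=> x _; exact: poweR_ge0.
  - by apply: measurable_funTS; exact: measurableT_comp (measurable_poweR q) (mtail R').
  - exact: powR_ge0.
  apply: eq_integral => x _; rewrite poweRM ?poweR_EFin//.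
    by rewrite lee_fin ltW.
  exact: (tail_potential_ge0 sh alpha pW).
split; [exact: mlim| |].
  (* the limit holds in L^q_loc: the tail at radius r decays like r ^ (beta + sigma) *)
  right=> s s0; have mQ := measurable_Q sh (0 : Rn) s.
  pose E := C * s `^ (- beta) * cp * (A * 2 `^ sigma) * s `^ mu.
  have E0 : 0 <= E by rewrite !mulr_ge0 ?powR_ge0 ?(ltW CC0) ?(ltW cp0) ?(ltW A0).
  pose del := - (beta + sigma) * q.
  have del0 : 0 < del by rewrite mulr_gt0// oppr_gt0 addrC.
  have lim0 : ((C3 `^ q * (E `^ q * s ^+ n.+1)) * r `^ (- del))%:E @[r --> +oo] --> 0%E.
    apply: cvg_EFin; first exact: nearW.
    rewrite -[X in _ --> X](mulr0 (C3 `^ q * (E `^ q * s ^+ n.+1))).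
    by apply: cvgMr; exact: powR_cvg_pinfty.
  apply: (squeeze_cvge (f := fun=> 0%E) _ _ lim0); last exact: cvg_cst.
  exists (Num.max 1 (2 * dR * s)); split; first exact: num_real.
  move=> r; rewrite gt_max => /andP[/ltW r1 /ltW dr].
  have r0 : 0 < r := lt_le_trans ltr01 r1.
  apply/andP; split; first by apply: integral_ge0 => x _; rewrite lee_fin powR_ge0.
  apply: (@le_trans _ _ (\int[lebesgue]_(x in (Q sh (0 : Rn) s : set LT))
      ((C3%:E * tail_potential W sh alpha f r x) `^ q))%E).
    apply: ae_ge0_le_integral.
    - exact: mQ.
    - by move=> x _; rewrite lee_fin powR_ge0.
    - apply: measurable_funTS; apply: measurable_EFin_normr_powR.
      by apply: measurable_funB; [apply: hdef; exact: Lf|exact: mlim].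
    - by move=> x _; exact: poweR_ge0.
    - exact: measurable_funTS.
    - apply: filterS (close s r s0 dr) => x cl xs; rewrite -poweR_EFin.
      by apply: le_poweR; [exact: ltW|rewrite lee_fin|have [] := cl xs].
  rewrite intH; last exact: mQ.
  apply: (le_trans (lee_wpmul2l _
    (tailF s r _ s 0 s0 s0 (A20 _ r0) dr (@subset_refl _ _) (fun j => growth r j r1)))).
    by rewrite lee_fin powR_ge0.
  rewrite -EFinM lee_fin le_eqVlt; apply/orP; left; apply/eqP.
  have -> : C * (r / s) `^ beta * (cp * (A * 2 `^ sigma * r `^ sigma)) * s `^ mu =
      E * r `^ (beta + sigma).
    rewrite powR_divl// /E (powRN s beta) (powRDp _ _ r0).
    by ring.
  rewrite powRM ?powR_ge0// -powRrM.
  have -> : (beta + sigma) * q = - del by rewrite /del; ring.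
  by ring.
move=> r M r0 M0 FM.
pose R' := 2 * dR * r.
have dr : 2 * dR * r <= R' by rewrite lexx.
have R0 : 0 < R' by rewrite !mulr_gt0.
have FM0 : (F f (3 * dR * R') <= M%:E)%E.
  have := FM 0%N; rewrite expr0 powR1 mulr1 mul1r.
  by have -> : 3 * dR * R' = 6 * dR * dR * r by rewrite /R'; ring.
have FMj (j : nat) : (F f (2 ^+ j.+1 * R') <= (M * (2 ^+ j) `^ (- gamma))%:E)%E.
  apply: le_trans (FM j); apply: morrey_norm_mono.
  have -> : 2 ^+ j.+1 * R' = 4 * dR * (2 ^+ j * r) by rewrite /R' exprS; ring.
  rewrite ler_wpM2r ?mulr_ge0 ?(ltW r0) ?(ltW (pow0 j))// -[leLHS]mulr1 ler_pM//.
  by rewrite ler_wpM2r//; lra.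
pose g := cutoff f R'.
have mg : measurable_fun [set: LT] g by exact: measurable_cutoff.
have MK0 : 0 <= M * kap sh p by rewrite mulr_ge0 ?(ltW M0) ?(ltW kp0).
have gnorm : (morrey_norm sh p lambda setT g <= M%:E)%E.
  have J0 (V : set LT) (g' : LT -> R) : (0 <= strong_integral p V g')%E.
    by apply: integral_ge0 => y _; rewrite lee_fin powR_ge0.
  have [_ H] := @averaged_normP R n (strong_integral p) sh p lambda _ setT g p0 MK0 J0.
  have -> : M = M * kap sh p * kappa R n sh `^ (- p^-1).
    by rewrite -mulrA -powRDp ?kappa_gt0// subrr powRr0 mulr1.
  apply: H => z s s0 _; apply: (cutoff_strong_le mf p1 R0 MK0 _ _ z s0).
    by have /andP[] := lambda0.
  move=> z' s' s'0 sub; exact: (morrey_norm_le_integral p0 (ltW M0) FM0 s'0 sub).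
have gmem : mem_fspace (morrey sh p lambda setT) g.
  by split; [exact: mg|apply: le_lt_trans gnorm _; rewrite ltry].
have [gext mTg normTg] := hT0 gmem.
have gE r' : R' <= r' -> (g \* \1_(Q sh (0 : Rn) r'))%R = g.
  move=> Rr; apply/funext => y; rewrite cutoffE; case: ifPn => // yr.
  rewrite /g cutoffE memNset// => yR; move/negP: yr; apply; apply/mem_set.
  by move: yR; rewrite !QE /= => /lt_le_trans; apply.
have mT : measurable_fun [set: LT] (T g) by apply: hdef; exact: Lf.
have aeg := extension_limit_eq q0 mT mTg gE gext.
have normTgM : (averaged_norm J sh q mu setT (T0 g) <=
    (a * M * kappa R n sh `^ (- q^-1))%:E)%E.
  apply: (le_trans normTg); apply: (le_trans (lee_wpmul2l _ gnorm)).
    by rewrite lee_fin ltW.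
  rewrite -EFinM lee_fin /a le_eqVlt; apply/orP; left; apply/eqP.
  have -> : C0 * kap sh q * M * kappa R n sh `^ (- q^-1) =
    C0 * M * (kap sh q * kappa R n sh `^ (- q^-1)) by ring.
  by rewrite -powRDp ?kappa_gt0// subrr powRr0 mulr1.
have aM0 : 0 <= a * M by rewrite mulr_ge0 ?(ltW a0) ?(ltW M0).
have [J_ge0 J_add] := hJ.
have [JTg _] := @averaged_normP R n J sh q mu _ setT (T0 g) q0 aM0 J_ge0.
have abM0 : 0 <= 4 * (a + b) * M.
  by rewrite !mulr_ge0 ?addr_ge0 ?(ltW a0) ?(ltW bb0) ?(ltW M0).
have [_ fin] := @averaged_normP R n J sh q mu _ (Q sh 0 r) (dyadic_limit sh T f)
  q0 abM0 J_ge0.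
have -> : 4 * (a + b) * kappa R n sh `^ (- q^-1) * M =
  4 * (a + b) * M * kappa R n sh `^ (- q^-1) by ring.
apply: fin => z s s0 sub.
have mQ := measurable_Q sh z s.
have maj : {ae lebesgue, forall x : LT, Q sh z s x ->
    (`|dyadic_limit sh T f x|%:E <=
      `|T0 g x|%:E + C3%:E * tail_potential W sh alpha f R' x)%E}.
  apply: filterS2 aeg (close r R' r0 dr) => x -> cl /sub xr.
  by have [] := cl xr.
apply: (le_trans (J_add _ _ _ _ mQ mlim mTg (mH R') (H0 R') maj)).
rewrite intH; last exact: mQ.
have t1 := JTg normTgM z s s0 (@subsetT _ _).
have t2 := tailF r R' M s z r0 s0 M0 dr sub FMj.
have C3q : (0 <= (C3 `^ q)%:E)%E by rewrite lee_fin powR_ge0.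
have RrE : R' / r = 2 * dR by rewrite /R' mulfK// gt_eqF.
have sm0 : 0 <= s `^ mu by exact: powR_ge0.
have aMs0 : 0 <= a * M * s `^ mu by rewrite mulr_ge0.
have bM0 : 0 <= b * M by exact: mulr_ge0 (ltW bb0) (ltW M0).
have bMs0 : 0 <= b * M * s `^ mu by exact: mulr_ge0.
have t3 : ((C3 `^ q)%:E * \int[lebesgue]_(x in (Q sh z s : set LT))
    (tail_potential W sh alpha f R' x `^ q) <= ((b * M * s `^ mu) `^ q * s ^+ n.+1)%:E)%E.
  apply: le_trans (lee_wpmul2l C3q t2) _; rewrite -EFinM RrE lee_fin [leLHS]mulrA.
  apply: ler_wpM2r; first by rewrite exprn_ge0// ltW.
  rewrite -powRM ?(ltW C30)//; last first.
    by rewrite !mulr_ge0 ?powR_ge0 ?(ltW CC0) ?(ltW cp0) ?(ltW M0).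
  by rewrite le_eqVlt; apply/orP; left; apply/eqP; congr (_ `^ _); rewrite /b; ring.
apply: (le_trans (lee_wpmul2l _ (leeD t1 t3))); first by rewrite lee_fin powR_ge0.
rewrite -EFinD -EFinM lee_fin.
rewrite -mulrDl mulrA ler_wpM2r ?exprn_ge0 ?(ltW s0)//.
have le1 : (a * M * s `^ mu) `^ q <= ((a + b) * M * s `^ mu) `^ q.
  apply: le_powR_pos => //; last exact: ltW.
  apply: ler_wpM2r; first exact: sm0.
  by apply: ler_wpM2r; [exact: ltW|rewrite lerDl ltW].
have le2 : (b * M * s `^ mu) `^ q <= ((a + b) * M * s `^ mu) `^ q.
  apply: le_powR_pos => //; last exact: ltW.
  apply: ler_wpM2r; first exact: sm0.
  by apply: ler_wpM2r; [exact: ltW|rewrite lerDr ltW].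
have two : 2 <= 2 `^ q by apply: le1r_powR => //; rewrite ler1n.
have -> : 4 * (a + b) * M * s `^ mu = 2 * (2 * ((a + b) * M * s `^ mu)) by ring.
have ab0 : 0 <= (a + b) * M by exact: mulr_ge0 (addr_ge0 (ltW a0) (ltW bb0)) (ltW M0).
have abs0 : 0 <= (a + b) * M * s `^ mu by exact: mulr_ge0.
have PM (u : R) : 0 <= u -> (2 * (2 * u)) `^ q = 2 `^ q * (2 `^ q * u `^ q).
  by move=> u0; rewrite !powRM ?mulr_ge0.
rewrite (PM _ abs0); apply: ler_wpM2l; first exact: powR_ge0.
apply: (le_trans (lerD le1 le2)); rewrite -mulr2n -[leLHS]mulr_natl.
by rewrite ler_wpM2r ?powR_ge0.
Qed.

End fixed_bound.

(** * Transfer of boundedness to the B-spaces *)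

Definition averaged (J : set LT -> (LT -> R) -> \bar R) (q mu : R) (U : set Rn) : fspace R n := FSpace
  (fun f => measurable_fun (U : set LT) f /\ (averaged_norm J sh q mu U f < +oo)%E)
  (averaged_norm J sh q mu U).

Variables (w : R -> R) (D : R).
Hypotheses (w0 : forall r : R, 0 < r -> 0 < w r) (D0 : 0 < D).
Hypothesis wD : forall r x : R, 0 < r -> 1 <= x -> w r <= D * x `^ sigma * w (x * r).


(** The intervals [1, +oo[ and ]0, +oo[ are both increasing unions of half-lines that
    start with [1, +oo[. The local bound of the extension has the form required by
    Lu_bound. *)
Lemma extends_bounded_B_space J (I : set R) (rho : nat -> R) (u : \bar R) :
  quasi_additive q J -> (forall N, 0 < rho N) -> rho 0%N = 1 ->
  nondecreasing_seq (fun N => `[rho N, +oo[%classic) ->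
  I = \bigcup_N `[rho N, +oo[%classic -> (0 < u)%E ->
  extends_bounded sh q T (morrey sh p lambda setT) (averaged J q mu setT) ->
  extends_bounded sh q T (B_space I sh w u (morrey sh p lambda))
    (B_space I sh w u (averaged J q mu)).
Proof.
move=> hJ rho0 rho1 ndI IE u0 [T0 [C0 C00 hT0]].
have hT0' g : mem_fspace (morrey sh p lambda setT) g ->
    [/\ extension_limit sh q T g (T0 g), measurable_fun [set: LT] (T0 g) &
      (averaged_norm J sh q mu setT (T0 g) <= C0%:E * morrey_norm sh p lambda setT g)%E].
  by move=> /hT0[? [? _] ?].
have [gamma [C [sg C_gt0 ext]]] := dyadic_extension hJ C00 hT0'.
have a01 : 0 < (2 : R) `^ (sigma + gamma) < 1.
  by rewrite powR_gt0//= powR2_lt1.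
set c0 := 6 * dR * dR in ext.
have c01 : 1 <= c0 by rewrite /c0 -!natrM ler1n.
set k := C * D * (2 ^+ Num.bound (2 * c0)) `^ sigma.
have k0 : 0 < k by rewrite /k !mulr_gt0// powR_gt0// exprn_gt0.
set k1 := D * 2 `^ sigma.
have k10 : 0 < k1 by rewrite /k1 mulr_gt0// powR_gt0.
exists (dyadic_limit sh T).
exists (Lu_bound_const k k1 (2 `^ (sigma + gamma)) u).
  exact: Lu_bound_const_gt0.
move=> f [mf memf Nf]; set N := Lu_norm _ _ _ in Nf.
have F0 r : 0 < r -> (0 <= F f r)%E by move=> r0; exact: morrey_norm_ge0.
have Fmono (r t : R) : 0 < r -> r <= t -> (F f r <= F f t)%E.
  by move=> _ rt; exact: morrey_norm_mono.
have Ffin r : 0 < r -> (F f r < +oo)%E by move=> /memf[].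
have I_ge1 (r : R) : 1 <= r -> I r.
  by move=> r1; rewrite IE; exists 0%N; rewrite //= in_itv/= andbT rho1.
have growth r : I r -> ((w r)%:E * F f r <= (Lu_growth_const k1 u)%:E * N)%E.
  move=> Ir; exact: (Lu_growth w0 D0 sigma0 wD F0 Fmono rho0 IE u0 Ir).
have g0 : 0 < Lu_growth_const k1 u.
  by rewrite /Lu_growth_const; case: (u) => [v||] //; rewrite mulr_gt0// powR_gt0.
have w1 := w0 ltr01.
have N0 : (0 <= N)%E.
  have := le_trans (mule_ge0 _ (F0 1 ltr01)) (growth 1 (I_ge1 1 (lexx _))).
  by rewrite lee_fin => /(_ (ltW w1)); rewrite pmule_rge0// lte_fin.
(* the L^u norm bounds w r * F f r, and w decays at most like r ^ (- sigma) *)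
have [A A0 growA] : exists2 A : R, 0 < A &
    forall r, 1 <= r -> (F f r <= (A * r `^ sigma)%:E)%E.
  have [N' NE] : exists N' : R, N = N'%:E.
    by exists (fine N); rewrite fineK// ge0_fin_numE.
  have N'0 : 0 <= N' by rewrite -lee_fin -NE.
  exists (D / w 1 * (Lu_growth_const k1 u * N') + 1) => [|r r1].
    have Dw0 : 0 <= D / w 1 := divr_ge0 (ltW D0) (ltW w1).
    by rewrite ltr_wpDl// mulr_ge0// (mulr_ge0 (ltW g0)).
  have r0 : 0 < r := lt_le_trans ltr01 r1.
  have := growth r (I_ge1 r r1); rewrite NE -EFinM.
  have := @wD 1 r ltr01 r1; rewrite mulr1.
  have := Ffin r r0; have := F0 r r0.
  case: (F f r) => [x x0 _ wx|//|//].
  rewrite -EFinM !lee_fin => wxN; have wr := w0 r0.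
  have rs : 0 < r `^ sigma by rewrite powR_gt0.
  move: (Lu_growth_const k1 u * N') wxN => K wxK.
  have x0' : 0 <= x by [].
  apply: (@le_trans _ _ (D / w 1 * K * r `^ sigma)); last first.
    by rewrite ler_pM2r// lerDl.
  rewrite -(ler_pM2l w1) !mulrA [w 1 * D]mulrC mulfK ?gt_eqF//.
  apply: (@le_trans _ _ (D * r `^ sigma * (w r * x))).
    by rewrite mulrA; exact: ler_wpM2r.
  have -> : D * K * r `^ sigma = D * r `^ sigma * K by ring.
  by rewrite ler_pM2l// mulr_gt0.
have [mlim lim FYle] := ext f A mf Ffin A0 growA.
pose FY r := averaged_norm J sh q mu (Q sh (0 : Rn) r) (dyadic_limit sh T f).
have FY0 r : 0 < r -> (0 <= FY r)%E by move=> r0; exact: averaged_norm_ge0.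
have main : (Lu_norm u I (fun r => (w r)%:E * FY r)%E <=
    (Lu_bound_const k k1 (2 `^ (sigma + gamma)) u)%:E * N)%E.
  exact: (Lu_bound w0 D0 sigma0 wD sg c01 C_gt0 F0 FY0 Fmono FYle rho0 ndI IE u0).
split; [exact: lim| |exact: main].
split; first exact: mlim.
- move=> r r0; split; first exact: (measurable_funTS mlim).
  have c0r j : 0 < c0 * (2 ^+ j * r).
    by rewrite mulr_gt0 ?(lt_le_trans ltr01 c01)// mulr_gt0// exprn_gt0.
  (* 1 is added to c0 r because the growth of F f is known for radii at least 1 *)
  pose M := A * (1 + c0 * r) `^ sigma.
  have M0 : 0 < M.
    rewrite mulr_gt0// powR_gt0// ltr_wpDr// mulr_ge0 ?(ltW r0)//.
    exact: le_trans ler01 c01.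
  apply: (@le_lt_trans _ _ (C * M)%:E); last exact: ltry.
  apply: FYle => // j.
  have tj : c0 * (2 ^+ j * r) <= 2 ^+ j * (1 + c0 * r).
    by rewrite mulrDr mulr1 mulrCA lerDr exprn_ge0.
  have t1 : 1 <= 2 ^+ j * (1 + c0 * r).
    have c0r0 : 0 <= c0 * r by rewrite mulr_ge0 ?(ltW r0)// (le_trans ler01 c01).
    have e2 : (1 : R) <= 2 ^+ j by rewrite exprn_ege1// ler1n.
    by apply: (le_trans e2); apply: ler_peMr; [exact: le_trans e2|rewrite lerDl].
  apply: le_trans (Fmono _ _ (c0r j) tj) _.
  apply: le_trans (growA _ t1) _; rewrite lee_fin /M.
  have c0r0 : 0 <= 1 + c0 * r by rewrite addr_ge0// mulr_ge0 ?(ltW r0)// (le_trans ler01 c01).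
  rewrite powRM ?exprn_ge0// -[leRHS]mulrA ler_pM2l// [leRHS]mulrC.
  apply: ler_wpM2r; first exact: powR_ge0.
  apply: ler_powR; first by rewrite exprn_ege1// ler1n.
  by move: sg; lra.
- apply: (le_lt_trans main); case: (N) Nf N0 => [N'||] //.
  by move=> _ _; rewrite -EFinM ltry.
Qed.

End extension.

(** * Weights built from Theta and the two kinds of B-spaces *)

Section intervals.
Context {R : realType}.

Lemma itv1y_bigcup : `[1%R, +oo[%classic = \bigcup_(N : nat) `[(fun=> 1 : R) N, +oo[%classic.
Proof. by rewrite bigcup_const//; exists 0%N. Qed.

Lemma itv0y_bigcup : `]0%R, +oo[%classic = \bigcup_N `[(2 ^- N : R), +oo[%classic.
Proof.
apply/seteqP; split => r /=; rewrite in_itv/= andbT.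
  move=> r0; exists (Num.bound r^-1) => //=; rewrite in_itv/= andbT.
  have ri : 0 <= r^-1 by rewrite invr_ge0 ltW.
  rewrite invf_ple ?posrE ?exprn_gt0//.
  exact: le_expr2_bound.
by move=> [N _]; rewrite /= in_itv/= andbT; apply: lt_le_trans; rewrite invr_gt0 exprn_gt0.
Qed.

Lemma nondecreasing_itvXV : nondecreasing_seq (fun N => `[(2 ^- N : R), +oo[%classic).
Proof.
move=> i j ij; apply/subsetPset => r /=; rewrite !in_itv/= !andbT; apply: le_trans.
by rewrite lef_pV2 ?posrE ?exprn_gt0// ler_weXn2l// ler1n.
Qed.

End intervals.

(** For t <= 1 the condition on Theta gives Theta (t r) <= C Theta r; it is applied at
    t = x ^ (- tau), and sigma alone accounts for the growth in x. *)
Lemma Theta_star_weight (R : realType) (Theta : R -> R) (sigma tau : R) :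
  Theta_star Theta -> 0 < tau ->
  let w := fun r : R => r `^ (- sigma) * Theta (r `^ tau) in
  (forall r, 0 < r -> 0 < w r) /\ exists2 D : R, 0 < D &
    forall r x, 0 < r -> 1 <= x -> w r <= D * x `^ sigma * w (x * r).
Proof.
move=> [gt0Theta [C [eps1 [eps2 [C0 /andP[e10 _] /andP[e20 _] CTheta]]]]] tau0 w.
split=> [r r0|]; first by rewrite mulr_gt0 ?gt0Theta ?powR_gt0.
exists C => // r x r0 x1; have x0 : 0 < x := lt_le_trans ltr01 x1.
have xr0 : 0 < (x * r) `^ tau by rewrite powR_gt0// mulr_gt0.
have t0 : 0 < x `^ (- tau) by rewrite powR_gt0.
have t1 : x `^ (- tau) <= 1.
  by rewrite -[leRHS](powRr0 x); apply: ler_powR => //; rewrite oppr_le0 ltW.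
have := CTheta _ _ xr0 t0.
have -> : x `^ (- tau) * (x * r) `^ tau = r `^ tau.
  by rewrite powRM ?ltW// mulrA -powRDp// addNr powRr0 mul1r.
have le1 (e : R) : 0 < e -> (x `^ (- tau)) `^ e <= 1.
  move=> e_gt0; have := @le_powR_pos R _ 1 e (ltW t0) t1 (ltW e_gt0).
  by rewrite powR1.
have m1 : Num.max ((x `^ (- tau)) `^ eps1) ((x `^ (- tau)) `^ eps2) <= 1.
  by rewrite ge_max !le1.
rewrite ler_pdivrMr ?gt0Theta// => le.
rewrite /w [in leRHS](powRM (- sigma) (ltW x0) (ltW r0)).
have -> : C * x `^ sigma * (x `^ (- sigma) * r `^ (- sigma) * Theta ((x * r) `^ tau)) =
    r `^ (- sigma) * (x `^ sigma * x `^ (- sigma)) * (C * Theta ((x * r) `^ tau)) by ring.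
rewrite -powRDp// subrr powRr0 mulr1 ler_pM2l ?powR_gt0//.
apply: (le_trans le); apply: ler_wpM2r; first by rewrite ltW// gt0Theta.
by rewrite ler_piMr// ltW.
Qed.

Theorem theorem5p5 (R : realType) (n : nat) (sh : Q_shape)
    (p q lambda mu : R) (u : \bar R) (Theta : R -> R) (sigma tau : R)
    (T : ('rV[R]_n.+1 -> R) -> 'rV[R]_n.+1 -> R)
    (alpha : R) (pt : \bar R) (Omega : 'rV[R]_n.+1 -> R) :
  1 <= p -> 1 <= q ->
  - (n.+1%:R / p) <= lambda < 0 -> - (n.+1%:R / q) <= mu < 0 ->
  (0 < u)%E -> Theta_star Theta -> 0 < tau -> tau < sigma ->
  defined_on_L1comp T -> sublinear T -> diff_bounded T ->
  0 <= alpha < n.+1%:R -> (1 <= pt)%E ->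
  homogeneous0 Omega -> in_Lp_sphere pt Omega ->
  size_condition T Omega alpha ->
  [/\ mu = lambda + alpha, (hoelder_conjugate p%:E <= pt)%E &
      sigma + lambda + alpha < 0] \/
  [/\ mu = lambda + alpha, (q%:E <= pt)%E &
      (sigma%:E + lambda%:E + n.+1%:R%:E / pt + alpha%:E < 0)%E] ->
  let w := fun r : R => r `^ (- sigma) * Theta (r `^ tau) in
  (extends_bounded sh q T (morrey sh p lambda setT) (morrey sh q mu setT) ->
   extends_bounded sh q T (B_inhom sh w u (morrey sh p lambda))
     (B_inhom sh w u (morrey sh q mu)) /\
   extends_bounded sh q T (B_hom sh w u (morrey sh p lambda))
     (B_hom sh w u (morrey sh q mu))) /\
  (extends_bounded sh q T (morrey sh p lambda setT)
     (weak_morrey sh q mu setT) ->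
   extends_bounded sh q T (B_inhom sh w u (morrey sh p lambda))
     (B_inhom sh w u (weak_morrey sh q mu)) /\
   extends_bounded sh q T (B_hom sh w u (morrey sh p lambda))
     (B_hom sh w u (weak_morrey sh q mu))).
Proof.
move=> p1 q1 lam /andP[_ mu0] u0 HTheta tau0 tausigma hdef _ hdiff alphad pt1 hOmega LOmega
  hsize cond w.
have sigma0 : 0 < sigma := lt_trans tau0 tausigma.
have [w0 [D D0 wD]] := @Theta_star_weight R Theta sigma tau HTheta tau0.
have q0 : 0 < q := lt_le_trans ltr01 q1.
have ext J I rho := @extends_bounded_B_space R n sh T pt Omega p q lambda mu sigma alpha
  p1 q1 lam mu0 sigma0 hdef hdiff alphad pt1 hOmega LOmega hsize cond w D w0 D0 wD J I rho u.
have inhom J : quasi_additive q J ->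
    extends_bounded sh q T (morrey sh p lambda setT) (averaged sh J q mu setT) ->
    extends_bounded sh q T (B_inhom sh w u (morrey sh p lambda))
      (B_inhom sh w u (averaged sh J q mu)).
  move=> hJ; apply: (ext J _ (fun=> 1)) => //.
  exact: itv1y_bigcup.
have hom J : quasi_additive q J ->
    extends_bounded sh q T (morrey sh p lambda setT) (averaged sh J q mu setT) ->
    extends_bounded sh q T (B_hom sh w u (morrey sh p lambda))
      (B_hom sh w u (averaged sh J q mu)).
  move=> hJ; apply: (ext J _ (fun N => 2 ^- N)) => //.
  - exact: invr1.
  - exact: nondecreasing_itvXV.
  - exact: itv0y_bigcup.
have strong := strong_quasi_additive (n := n) q0.
have weak := weak_quasi_additive (n := n) q0.
split=> H; split.
- exact: (inhom _ strong H).
- exact: (hom _ strong H).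
- exact: (inhom _ weak H).
- exact: (hom _ weak H).
Qed.
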